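(* Let $\Omega\subset\mathbb{C}$ be a (Lebesgue) measurable set with area $s=|\Omega|<\infty$, and let $N\ge 1$ be an integer. Then $$\sum_{j=1}^{N}\lambda_j(\Omega)\ \le\ \sum_{j=1}^{N}\lambda_j(D_s)\ =\ N-e^{-|\Omega|}\sum_{k=0}^{N-1}(N-k)\frac{|\Omega|^{k}}{k!}.$$ The bound is attained by the centered disc $D_s$ of area $s$, and it is also attained by every disc of area $s$ in $\mathbb{C}$ (with arbitrary center).
   Context: The Bargmann--Fock space $\mathcal{F}^2(\mathbb{C})$ is the Hilbert space of entire functions $F:\mathbb{C}\to\mathbb{C}$ with $\|F\|^2=\int_{\mathbb{C}}|F(z)|^2e^{-\pi|z|^2}\,\mathrm{d}A(z)<\infty$, where $\mathrm{d}A(z)=dx\,dy$ for $z=x+iy$, with inner product $\langle F,G\rangle=\int_{\mathbb{C}}F(z)\overline{G(z)}e^{-\pi|z|^2}\,\mathrm{d}A(z)$. It is a closed subspace of $L^2(\mathbb{C},e^{-\pi|z|^2}\mathrm{d}A)$; let $P_{\mathcal{F}^2}$ be the orthogonal projection of that $L^2$ space onto it. For a measurable set $\Omega\subset\mathbb{C}$ of finite area $|\Omega|$ (Lebesgue measure), $T_\Omega:\mathcal{F}^2(\mathbb{C})\to\mathcal{F}^2(\mathbb{C})$ is the Toeplitz operator $T_\Omega F=P_{\mathcal{F}^2}(\mathbf{1}_\Omega F)$. Its quadratic form is $\langle T_\Omega F,F\rangle=\int_\Omega|F(z)|^2e^{-\pi|z|^2}\,\mathrm{d}A(z)$. It is a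 positive trace-class operator with $0\le T_\Omega\le I$ and $\operatorname{Tr}(T_\Omega)=|\Omega|$. Its eigenvalues, repeated according to multiplicity, are arranged in nonincreasing order: $\lambda_1(\Omega)\ge\lambda_2(\Omega)\ge\cdots\ge 0$. $D_s=\{z\in\mathbb{C}:\pi|z|^2<s\}$ is the centered disc of area $s$ (in the degenerate case $s=0$ it is the empty set). Convention: $0^0=1$. *)

(* Defs.v *)
From HB Require Import structures.
From mathcomp Require Import all_boot all_order all_algebra.
From mathcomp Require Import complex.
From mathcomp Require Import all_classical all_reals all_analysis.

Set Implicit Arguments.
Unset Strict Implicit.
Unset Printing Implicit Defensive.

Import Order.TTheory GRing.Theory Num.Theory.
Import numFieldNormedType.Exports.

Local Open Scope classical_set_scope.
Local Open Scope ring_scope.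
Local Open Scope complex_scope.

Import ComplexField.Normc.

Section BargmannFock.
Variable R : realType.
Local Notation C := R[i].

Local Notation borel2 := ((@lebesgue_measure R) \x (@lebesgue_measure R))%E.

(* Two-dimensional Lebesgue measure, on the (complete) sigma-algebra of
   Lebesgue measurable subsets of the plane rather than on the Borel sets. *)
Definition leb2 :=
  @completed_measure_extension _ _ _ borel2.
HB.instance Definition _ := Measure.on leb2.

(* C carries no measurable structure of its own: sets and functions on C are
   pulled back to the plane along this bijection. *)
Definition toC (p : R * R) : C := p.1 +i* p.2.

Definition lebesgue_measurable (A : set C) : Prop :=
  (borel2^*)%mu.-cara.-measurable (toC @^-1` A).

Definition area (A : set C) : \bar R := leb2 (toC @^-1` A).

Definition gauss_weight (z : C) : R := expR (- (pi * normc z ^+ 2)).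

Definition integralC (f : C -> C) : C :=
  (\int[leb2]_(p in setT) complex.Re (f (toC p))) +i*
  (\int[leb2]_(p in setT) complex.Im (f (toC p))).

Definition inner (F G : C -> C) : C :=
  integralC (fun z => F z * conjc (G z) * (gauss_weight z)%:C).

Definition sqnorm (F : C -> C) : \bar R :=
  (\int[leb2]_(p in setT) (normc (F (toC p)) ^+ 2 * gauss_weight (toC p))%:E)%E.

(* Complex differentiability: the regular module R[i]^o makes the scalars of
   the difference quotient complex (R[i] alone is a module over R). *)
Definition entire (F : C -> C) : Prop :=
  forall z : C, derivable (F : C^o -> C^o) z 1.

Definition fock : set (C -> C) :=
  [set F | entire F /\ (sqnorm F < +oo)%E].

(* H is the orthogonal projection onto fock of f, an element of the weighted
   L^2 space: H lies in fock and f - H is orthogonal to fock. *)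
Definition is_fock_proj (f H : C -> C) : Prop :=
  fock H /\ forall G, fock G -> inner (fun z => f z - H z) G = 0.

(* The choice is vacuous on L^2, as fock is closed there and two elements of
   fock that agree almost everywhere are equal. *)
Definition fock_proj (f : C -> C) : C -> C :=
  xget (fun=> 0) (is_fock_proj f).

Definition toeplitz (Omega : set C) (F : C -> C) : C -> C :=
  fock_proj (fun z => \1_Omega z * F z).

Definition fock_eigenspace (T : (C -> C) -> C -> C) (mu : R) : set (C -> C) :=
  [set F | fock F /\ T F = (fun z => mu%:C * F z)].

Definition lin_comb n (b : 'I_n -> C -> C) (c : 'I_n -> C) : C -> C :=
  fun z => \sum_(i < n) c i * b i z.

Definition has_dim (V : set (C -> C)) (n : nat) : Prop :=
  exists b : 'I_n -> C -> C,
    (forall c, lin_comb b c = (fun=> 0) -> forall i, c i = 0) /\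
    V = range (lin_comb b).

(* lam lists, from index 0 on, the eigenvalues of a positive compact operator:
   every mu > 0 occurs in lam exactly as often as the dimension of its
   eigenspace (so not at all if mu is not an eigenvalue).  Nothing is prescribed
   for mu = 0: zeros fill the places left after the positive eigenvalues when
   these are finitely many, and do not occur otherwise. *)
Definition eigenvalue_seq (T : (C -> C) -> C -> C) (lam : nat -> R) : Prop :=
  [/\ nonincreasing_seq lam,
      forall j, 0 <= lam j
    & forall mu, 0 < mu ->
        exists n, has_dim (fock_eigenspace T mu) n /\ ([set j | lam j = mu] #= `I_n)%card].

(* eigval Omega j is the (j+1)-st eigenvalue of toeplitz Omega.  For Omega
   measurable of finite area that operator is positive and trace class, so that
   a sequence as above exists; it is unique. *)
Definition eigval (Omega : set C) : nat -> R :=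
  xget (fun=> 0) (eigenvalue_seq (toeplitz Omega)).

Definition disc (c : C) (r : R) : set C := [set z | normc (z - c) < r].

Definition centered_disc (s : R) : set C := [set z | pi * normc z ^+ 2 < s].

End BargmannFock.

(* Main.v *)
Require Import Defs.
From HB Require Import structures.
From mathcomp Require Import all_boot all_order all_algebra.
From mathcomp Require Import complex spectral sesquilinear ring lra zify.
From mathcomp Require Import all_classical all_reals all_analysis.
From mathcomp Require Import measurable_realfun.
Set Implicit Arguments.
Unset Strict Implicit.
Unset Printing Implicit Defensive.
Import Order.TTheory GRing.Theory Num.Theory.
Import numFieldNormedType.Exports.
Local Open Scope classical_set_scope.
Local Open Scope ring_scope.
Local Open Scope complex_scope.
Import ComplexField.Normc.
Local Open Scope sesquilinear_scope.

                                                                            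
                                                                             
                                                                                 
                                                                                
                                                                                   
                                                          
                                                      
                                                                                
                                                                                     
                                                                            
                                                                                   
                                                                    
                                                                            
                                                                                
                                                                             

                                       

(** Put [s = |Omega|]. The normalized monomials [fmon k] are an orthonormal basis of the Fock space.
    For the centered disc they diagonalize the Toeplitz operator, with eigenvalues
    [poisson_tail k s = P(Poisson(s) > k)]. Hence the sum of the first [N] is the expectation of
    [min(N, Poisson(s))], which is the closed formula of the theorem ([disc_eigenvalue_seq],
    [sum_poisson_tail]). For an arbitrary [Omega] it has to be shown that any [p <= N] orthonormal
    functions of the Fock space have total mass in [Omega] at most this expectation ([planar_conc]);
    applied to eigenfunctions this bounds the eigenvalue sum.

    The planar bound is a limit of bounds on spheres. Fix [b > 0] and let
    [v = 1 / (1 + b pi |z|^2)]. Polynomials of degree at most [M] with the weight [v^(M+2)] form a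
    Hilbert space of dimension [M+1], namely the sections of degree [M] over a sphere of area [1/b]
    in stereographic coordinates. Let [T_M] be the compression of the indicator of [Omega] to it
    ([sphere_op]). The claim is that the [N] largest eigenvalues of [T_M] sum to at most the
    expectation of [min(N, K)], where [K] is binomial with parameters [M+1] and [b s]
    ([sphere_kyfan]).

    No rearrangement is used; the claim is pulled down from infinite degree. Since
    [1 = (1 + b pi |z|^2) v], the density [|P|^2 v^(M+2)] equals the sum of [|P|^2] and
    [|sqrt(b pi) z P|^2], both times [v^(M+3)]. So a family at level [M] becomes a pair of families
    at level [M+1], with the same total norm but with Bessel constant [(M+1)/(M+2)] in place of [1].
    Such a family cannot concentrate on the top [N] eigenvectors, and [kyfan_step] turns this into a
    recursion: if [B(M, N)] bounds the [N] largest eigenvalues of [T_M], one may take [B(M, N) =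
    ((M+1-N) B(M+1, N) + N B(M+1, N+1)) / (M+2)]. The binomial expectations satisfy exactly this
    recursion ([binom_mean_elevation], [minr_nat_elevation]). In dimension [n] the trivial bound
    [min(N, n b s)] exceeds the binomial expectation by at most [sqrt n], and the descent from
    dimension [n] to dimension [M+1] multiplies the excess by [(M+1)/n]. The remaining error
    [(M+1)/sqrt n] tends to [0] ([kyfan_descent]).

    Finally take [b = 1/(M+2)] and let [M] grow: the spherical weights dominate the Gaussian, the
    spherical basis tends to [fmon], the binomial law tends to the Poisson law, and Fatou's lemma
    gives the planar bound. Discs with another center are handled by the Weyl translations, which
    are unitary on the Fock space ([eigenvalue_seq_weyl]). The function theory behind this, namely
    Goursat's theorem, the mean value property, the reproducing kernel and the convergence of Taylor
    sums, is derived from complex differentiability alone. *)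

(** * Sums of the largest eigenvalues of a Hermitian matrix *)

Section KyFan.
Variable R : realType.
Local Notation C := R[i].

Lemma normc_sqE (z : C) : (normc z ^+ 2)%:C = z * conjc z.
Proof. by rewrite rmorphXn /= -sqr_normc. Qed.

Lemma normc_sq (z : C) : normc z ^+ 2 = complex.Re z ^+ 2 + complex.Im z ^+ 2.
Proof. by case: z => a b /=; rewrite sqr_sqrtr // addr_ge0 ?sqr_ge0. Qed.

Lemma normc_ge0 (z : C) : 0 <= normc z.
Proof. by case: z => a b /=; exact: sqrtr_ge0. Qed.

Lemma normc_real (x : R) : normc x%:C = `|x|.
Proof. by rewrite /= expr0n /= addr0 sqrtr_sqr. Qed.

Lemma normc_conj (z : C) : normc (conjc z) = normc z.
Proof. by case: z => a b /=; rewrite sqrrN. Qed.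

Lemma Re_sum (I : Type) (r : seq I) (P : pred I) (F : I -> C) :
  complex.Re (\sum_(i <- r | P i) F i) = \sum_(i <- r | P i) complex.Re (F i).
Proof. by elim/big_rec2: _ => // i x y _ <-; case: (F i) => ? ?; case: y. Qed.

Definition fro m n (X : 'M[C]_(m, n)) : R := \sum_i \sum_j normc (X i j) ^+ 2.

Definition qf m n (T : 'M[C]_n) (X : 'M[C]_(m, n)) : R :=
  complex.Re (\tr (X *m T *m X^t*)).

(** The operator inequality [X^* X <= rho], tested on vectors: the rows of [X] form a Bessel family
    with constant [rho]. *)
Definition bessel m n (X : 'M[C]_(m, n)) (rho : R) :=
  forall v : 'cV[C]_n, fro (X *m v) <= rho * fro v.

                                                                         
                                                                        
(** Ky Fan's variational form of the bound [B] on the sum of the [N] largest eigenvalues of a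
    positive [T]. Admitting all Bessel families, rather than orthonormal ones only, gives a class
    stable under the stacking used in the descent. *)
Definition kyfan_le n (T : 'M[C]_n) (N : nat) (B : R) :=
  forall p (X : 'M[C]_(p, n)), bessel X 1 -> fro X <= N%:R -> qf T X <= B.

Lemma trmxC_mul m n p (A : 'M[C]_(m, n)) (B : 'M[C]_(n, p)) :
  (A *m B)^t* = B^t* *m A^t*.
Proof. by rewrite trmx_mul map_mxM. Qed.

Lemma fro_trE m n (X : 'M[C]_(m, n)) : (fro X)%:C = \tr (X *m X^t*).
Proof.
rewrite /mxtrace /fro rmorph_sum /=; apply: eq_bigr => i _.
rewrite mxE rmorph_sum /=; apply: eq_bigr => j _.
by rewrite normc_sqE !mxE.
Qed.

Lemma fro_mulr_unitary m n p (X : 'M[C]_(m, n)) (P : 'M[C]_(n, p)) :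
  P *m P^t* = 1%:M -> fro (X *m P) = fro X.
Proof.
move=> PP; apply: (@complexI R); rewrite !fro_trE.
by rewrite trmxC_mul -mulmxA (mulmxA P) PP mul1mx.
Qed.

Lemma fro_mull_unitary m n (P : 'M[C]_m) (X : 'M[C]_(m, n)) :
  P^t* *m P = 1%:M -> fro (P *m X) = fro X.
Proof.
move=> PP; apply: (@complexI R); rewrite !fro_trE.
by rewrite trmxC_mul mxtrace_mulC -mulmxA (mulmxA _ P) PP mul1mx mxtrace_mulC.
Qed.

Lemma qf_diag m n (d : 'rV[C]_n) (Y : 'M[C]_(m, n)) :
  d \is a mxOver Num.real ->
  qf (diag_mx d) Y = \sum_k complex.Re (d 0 k) * \sum_j normc (Y j k) ^+ 2.
Proof.
move=> /mxOverP dr; rewrite /qf /mxtrace Re_sum.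
under [RHS]eq_bigr do rewrite mulr_sumr.
rewrite exchange_big /=; apply: eq_bigr => j _.
rewrite mxE Re_sum; apply: eq_bigr => k _.
rewrite mul_mx_diag !mxE.
have /complex_realP [x ->] := dr 0 k.
rewrite -mulrA (mulrC x%:C) mulrA -normc_sqE -rmorphM /=.
by rewrite mulrC.
Qed.

(** Greedy choice: the maximum outside [A] is moved into [A] at each step. The witness [i0] carries
    the next value, which serves as threshold in [kyfan_step]. *)
Lemma top_indices (I : finType) (d : I -> R) (N : nat) : (N < #|I|)%N ->
  exists (A : {set I}) (i0 : I), [/\ #|A| = N, i0 \notin A,
    forall i, i \in A -> d i0 <= d i & forall i, i \notin A -> d i <= d i0].
Proof.
have pick_max (A : {set I}) : (#|A| < #|I|)%N -> exists2 i0, i0 \notin A &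
    forall i, i \notin A -> d i <= d i0.
  move=> ltA; have /existsP [x0 x0A] : [exists x, x \notin A].
    rewrite -negb_forall; apply/negP => /forallP AT.
    move: ltA; rewrite ltnNge => /negP; apply; rewrite leq_eqVlt; apply/orP; left.
    by apply/eqP; apply: eq_card => x; rewrite AT.
  have [i0 i0A i0P] := @Order.TotalTheory.arg_maxP _ _ I x0 (fun x => x \notin A) d x0A.
  by exists i0.
elim: N => [|N IH] ltN.
  have [] := @pick_max finset.set0; first by rewrite finset.cards0.
  move=> i0 _ i0P; exists finset.set0, i0; rewrite finset.cards0 finset.in_set0; split => // i.
  by rewrite finset.in_set0.
have [A [i0 [cA i0A lo hi]]] := IH (ltnW ltN).
have c1 : #|i0 |: A| = N.+1 by rewrite finset.cardsU1 i0A cA.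
have [|i1 i1A i1P] := @pick_max (i0 |: A)%SET; first by rewrite c1.
exists (i0 |: A)%SET, i1; split => // i.
have di : d i1 <= d i0 by apply: hi; move: i1A; rewrite finset.in_setU1 negb_or => /andP[].
by rewrite finset.in_setU1 => /orP[/eqP -> //|/lo]; exact: le_trans.
Qed.

(** In an eigenbasis of [T] the family spreads weights [x k] over the eigenvalues, with each
    [x k <= rho] and total at most [N]. The best choice puts [rho] on the top [N] eigenvalues and
    the leftover [(1 - rho) N] on the next one. This value is the combination of the sums of the top
    [N] and of the top [N+1] eigenvalues that appears on the right. *)
Lemma kyfan_step n (T : 'M[C]_n) (N : nat) (b1 b2 rho : R) :
  T \is hermsymmx -> (forall v : 'rV[C]_n, 0 <= qf T v) ->
  (N < n)%N -> 0 <= rho <= 1 -> (1 - rho) * N%:R <= rho ->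
  kyfan_le T N b1 -> kyfan_le T N.+1 b2 ->
  forall p (X : 'M[C]_(p, n)), bessel X rho -> fro X <= N%:R ->
    qf T X <= (rho - (1 - rho) * N%:R) * b1 + ((1 - rho) * N%:R) * b2.
Proof.
move=> Th T0 ltN /andP[rho0 rho1] rhoN k1 k2 p X Xb Xf.
pose P := spectralmx T; pose sp := spectral_diag T.
have Pu : P \is unitarymx := spectral_unitarymx T.
have PP : P *m P^t* = 1%:M by apply/unitarymxP.
have PP' : P^t* *m P = 1%:M by rewrite (mulmx1C PP).
have TE : T = P^t* *m diag_mx sp *m P.
  by rewrite -(invmx_unitary Pu); apply/orthomx_spectralP/hermitian_normalmx.
have spr : sp \is a mxOver Num.real by exact: hermitian_spectral_diag_real.
have qfE q (Y : 'M[C]_(q, n)) : qf T Y = qf (diag_mx sp) (Y *m P^t*).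
  by rewrite /qf TE trmxC_mul trmxCK !mulmxA.
pose d k := complex.Re (sp 0 k).
have d0 k : 0 <= d k.
  have := T0 (row k P).
  rewrite qfE qf_diag // -row_mul PP.
  rewrite (bigD1 k) //= [X in _ + X]big1 => [|j jk]; last first.
    by rewrite big1 ?mulr0 // => i _; rewrite !mxE (negPf (_ : k != j)) 1?eq_sym //
       normc0 expr0n.
  rewrite big_ord_recl big_ord0 !mxE eqxx normc1 expr1n !addr0 mulr1; exact.
(* The test family is the spectral projection onto the eigenvectors indexed by [A]. *)
have testA (A : {set 'I_n}) B : kyfan_le T #|A| B -> \sum_(k in A) d k <= B.
  move=> kA; pose a : 'rV[C]_n := \row_k (k \in A)%:R.
  have aE m (Y : 'M[C]_(n, m)) i j :
      normc ((diag_mx a *m Y) i j) ^+ 2 = (i \in A)%:R * normc (Y i j) ^+ 2.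
    rewrite mul_diag_mx !mxE normcM exprMn.
    by case: (i \in A); rewrite ?normc1 ?normc0 ?expr1n ?expr0n.
  have := kA _ (diag_mx a *m P); rewrite qfE -mulmxA PP mulmx1 qf_diag //.
  have -> : \sum_k complex.Re (sp 0 k) * \sum_j normc (diag_mx a j k) ^+ 2 =
            \sum_(k in A) d k.
    rewrite [RHS]big_mkcond /=; apply: eq_bigr => k _.
    rewrite (bigD1 k) //= big1 ?addr0 => [|j jk].
      rewrite !mxE eqxx mulr1n /d; case: (k \in A);
      by rewrite ?normc1 ?normc0 ?expr1n ?expr0n ?mulr1 ?mulr0.
    by rewrite !mxE (negPf jk) mulr0n normc0 expr0n.
  apply.
    move=> v; rewrite mul1r -mulmxA -[leRHS](fro_mull_unitary v PP').
    apply: ler_sum => i _; apply: ler_sum => j _; rewrite aE.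
    by case: (i \in A); rewrite ?mul1r ?mul0r ?sqr_ge0.
  rewrite fro_mulr_unitary // -sum1_card natr_sum [leRHS]big_mkcond /=.
  apply: ler_sum => i _; rewrite (bigD1 i) //= big1 ?addr0 => [|j ji].
    rewrite !mxE eqxx mulr1n; case: (i \in A);
    by rewrite ?normc1 ?normc0 ?expr1n ?expr0n.
  by rewrite !mxE eq_sym (negPf ji) mulr0n normc0 expr0n.
pose Y := X *m P^t*; pose x k := \sum_j normc (Y j k) ^+ 2.
have x0 k : 0 <= x k by apply: sumr_ge0 => j _; exact: sqr_ge0.
have xr k : x k <= rho.
  have -> : x k = fro (X *m col k (P^t*)).
    rewrite /fro /x; apply: eq_bigr => j _.
    by rewrite big_ord_recl big_ord0 addr0 colE mulmxA -colE [in RHS]mxE.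
  apply: le_trans (Xb _) _; rewrite -[leRHS]mulr1 ler_wpM2l //.
  rewrite -(@fro_mull_unitary _ _ P) // colE mulmxA PP mul1mx /fro.
  rewrite (bigD1 k) //= [X in _ + X]big1 => [|j jk]; rewrite big_ord_recl big_ord0 !mxE.
    by rewrite eqxx normc1 expr1n !addr0.
  by rewrite (negPf jk) normc0 expr0n addr0.
have xs : \sum_k x k <= N%:R.
  rewrite exchange_big /= -/(fro Y) (_ : fro Y = fro X) //.
  by apply: fro_mulr_unitary; rewrite trmxCK.
have [|A [i0 [cA i0A lo hi]]] := @top_indices _ d N; first by rewrite card_ord.
have s1 : \sum_(k in A) d k <= b1 by apply: testA; rewrite cA.
have s2 : \sum_(k in A) d k + d i0 <= b2.
  have := @testA (i0 |: A)%SET b2; rewrite finset.cardsU1 i0A cA finset.big_setU1 //= addrC.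
  exact.
(* Linear programming duality: after subtracting the threshold [d i0], the terms in [A] are
   nonnegative and take [x k <= rho], the others are nonpositive and are dropped. *)
have main : qf T X <= d i0 * N%:R + rho * \sum_(k in A) (d k - d i0).
  rewrite qfE qf_diag //.
  have -> : \sum_k complex.Re (sp 0 k) * \sum_j normc ((X *m P^t*) j k) ^+ 2 =
      d i0 * \sum_k x k + \sum_k (d k - d i0) * x k.
    by rewrite mulr_sumr -big_split /=; apply: eq_bigr => k _; rewrite -/(d k) -/(x k); ring.
  apply: lerD; first by rewrite ler_wpM2l.
  rewrite mulr_sumr [leRHS]big_mkcond /=; apply: ler_sum => k _.
  case: ifPn => kA.
    by rewrite mulrC ler_wpM2r // subr_ge0 lo.
  by rewrite mulr_le0_ge0 // subr_le0 hi.
apply: le_trans main _.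
rewrite sumrB sumr_const cA -mulr_natr.
set S := \sum_(k in A) d k in s1 s2 *.
have : (rho - (1 - rho) * N%:R) * S <= (rho - (1 - rho) * N%:R) * b1.
  by rewrite ler_wpM2l // subr_ge0.
have : ((1 - rho) * N%:R) * (S + d i0) <= ((1 - rho) * N%:R) * b2.
  by rewrite ler_wpM2l // mulr_ge0 // subr_ge0.
lra.
Qed.

End KyFan.

(** * Binomial expectations and their degree elevation *)

Section Bernstein.
Variable R : realType.
Implicit Types (s : R) (f g : nat -> R).

                                                                      
(** The expectation of [f K] for [K] binomial with parameters [n] and [s], that is, the Bernstein
    polynomial of [f], computed by conditioning on one trial at a time. *)
Fixpoint binom_mean (n : nat) s f : R :=
  if n is m.+1 then (1 - s) * binom_mean m s f + s * binom_mean m s (fun k => f k.+1)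
  else f 0%N.

Lemma binom_mean_lin n s f g a b :
  binom_mean n s (fun k => a * f k + b * g k) = a * binom_mean n s f + b * binom_mean n s g.
Proof. by elim: n f g => //= n IH f g; rewrite !IH; ring. Qed.

Lemma eq_binom_mean n s f g : f =1 g -> binom_mean n s f = binom_mean n s g.
Proof. by move=> /funext ->. Qed.

Lemma binom_mean_cst n s a : binom_mean n s (fun=> a) = a.
Proof. by elim: n => //= n IH; rewrite IH; ring. Qed.

Lemma le_binom_mean n s f g : 0 <= s <= 1 -> (forall k, f k <= g k) ->
  binom_mean n s f <= binom_mean n s g.
Proof.
move=> /andP[s0 s1]; elim: n f g => //= n IH f g fg.
by apply: lerD; rewrite ler_wpM2l ?subr_ge0 ?IH.
Qed.

(** Deleting a uniformly chosen trial among [n+1] leaves [n] trials; given [k] successes, the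
    deleted one is a success with probability [k/(n+1)]. At [k = 0] the value [f k.-1] has
    coefficient [0]. *)
Lemma binom_mean_elevation n s f :
  n.+1%:R * binom_mean n s f =
  binom_mean n.+1 s (fun k => (n.+1%:R - k%:R) * f k + k%:R * f k.-1).
Proof.
elim: n f => [|n IH] f; first by rewrite /=; ring.
rewrite [RHS]/=.
have E1 h : binom_mean n.+1 s (fun k => (n.+2%:R - k%:R) * h k + k%:R * h k.-1) =
    binom_mean n.+1 s h + n.+1%:R * binom_mean n s h.
  rewrite IH -[binom_mean n.+1 s h]mul1r -[X in _ + X]mul1r -binom_mean_lin.
  by apply: eq_binom_mean => k; rewrite -!natr1; ring.
rewrite -/(binom_mean n.+1 s (fun k => (n.+2%:R - k%:R) * f k + k%:R * f k.-1)).
rewrite -/(binom_mean n.+1 s (fun k => (n.+2%:R - k.+1%:R) * f k.+1 + k.+1%:R * f k)).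
rewrite E1.
have -> : binom_mean n.+1 s (fun k => (n.+2%:R - k.+1%:R) * f k.+1 + k.+1%:R * f k) =
    binom_mean n.+1 s f + n.+1%:R * binom_mean n s (fun k => f k.+1).
  rewrite IH -[binom_mean n.+1 s f]mul1r -[X in _ + X]mul1r -binom_mean_lin.
  by apply: eq_binom_mean => -[|k]; rewrite -!natr1 /=; ring.
by rewrite /= -!natr1; ring.
Qed.

Lemma binom_mean_variance n s a :
  binom_mean n s (fun k => (k%:R - a) ^+ 2) = (n%:R * s - a) ^+ 2 + n%:R * s * (1 - s).
Proof.
elim: n a => [|n IH] a; first by rewrite /=; ring.
rewrite /= IH.
have -> : binom_mean n s (fun k => (k.+1%:R - a) ^+ 2) =
    binom_mean n s (fun k => (k%:R - (a - 1)) ^+ 2).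
  by apply: eq_binom_mean => k; rewrite -natr1; ring.
by rewrite IH -natr1; ring.
Qed.

Definition minr_nat (N k : nat) : R := Num.min N%:R k%:R.

(** Jensen's inequality goes the other way for the concave [min]; the loss is at most the mean
    absolute deviation, hence at most [sqrt n] by the variance. *)
Lemma min_mean_le_binom_mean n s N : (0 < n)%N -> 0 <= s <= 1 ->
  Num.min N%:R (n%:R * s) <= binom_mean n s (minr_nat N) + Num.sqrt n%:R.
Proof.
move=> n0 s01; set t := Num.sqrt n%:R.
have t0 : 0 < t by rewrite sqrtr_gt0 ltr0n.
have tt : t ^+ 2 = n%:R by rewrite sqr_sqrtr.
have -> : Num.min N%:R (n%:R * s) = binom_mean n s (fun=> Num.min N%:R (n%:R * s)).
  by rewrite binom_mean_cst.
have : binom_mean n s (fun=> Num.min N%:R (n%:R * s)) <=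
  binom_mean n s (fun k => 1 * (1 * minr_nat N k + (2 * t)^-1 * (k%:R - n%:R * s) ^+ 2) + t / 2 * 1).
  apply: le_binom_mean => // k; rewrite !mul1r mulr1 /minr_nat.
  set y := k%:R - n%:R * s.
  (* Linearizing the absolute value at scale [t = sqrt n] makes both terms contribute at most
     [t / 2] after averaging. *)
  have yt : `|y| <= (2 * t)^-1 * y ^+ 2 + t / 2.
    rewrite -(ler_pM2l (x := 2 * t)) ?mulr_gt0 // mulrDr mulrA divff ?mulf_neq0 ?gt_eqF //.
    rewrite mul1r -(real_normK (num_real y)).
    have := sqr_ge0 (`|y| - t); nra.
  have : Num.min N%:R (n%:R * s) <= Num.min N%:R k%:R + `|y|.
    have y0 := normr_ge0 y; have y1 := ler_norm (- y); rewrite normrN in y1.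
    rewrite ge_min; case: (leP (N%:R : R) k%:R) => Nk; first by rewrite lerDl y0.
    apply/orP; right; move: y1; rewrite /y; lra.
  move: yt; lra.
move=> /le_trans; apply; rewrite !binom_mean_lin binom_mean_cst binom_mean_variance subrr expr0n /= add0r.
rewrite !mul1r -addrA lerD2l mulr1.
have : (2 * t)^-1 * (n%:R * s * (1 - s)) <= t / 2.
  rewrite -(ler_pM2l (x := 2 * t)) ?mulr_gt0 // mulrA divff ?mulf_neq0 ?gt_eqF //.
  rewrite mul1r -tt.
  have -> : 2 * t * (t / 2) = t ^+ 2 by rewrite expr2; field.
  have := s01 => /andP[s0 s1].
  rewrite -mulrA ler_piMr ?sqr_ge0 //; nra.
lra.
Qed.

(** With [binom_mean_elevation] this shows that the expectations of [min(N, K)] satisfy the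
    recursion of [kyfan_step] with equality. Both sides are [(M+1) k] for [k <= N] and [(M+2) N]
    beyond. *)
Lemma minr_nat_elevation M N k :
  (M.+2%:R - k%:R) * minr_nat N k + k%:R * minr_nat N k.-1 =
  (M.+1%:R - N%:R) * minr_nat N k + N%:R * minr_nat N.+1 k.
Proof.
have [kN|Nk] := leqP k N.
  rewrite /minr_nat !min_r ?ler_nat //; try lia.
  by case: k kN => [|k] kN /=; rewrite -!natr1; ring.
rewrite /minr_nat !min_l ?ler_nat //; try lia.
by rewrite -!natr1; ring.
Qed.

End Bernstein.

(** * Descent of Ky Fan bounds from level [M+1] to level [M] *)

Section Descent.
Variable R : realType.
Local Notation C := R[i].

                                                                               
                                                            
(** In the orthonormal bases [smon] of two consecutive levels, this is the inclusion of polynomials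
    of degree at most [M] into degree at most [M+1]; [shift_mx] is multiplication by
    [sqrt(b pi) z]. *)
Definition keep_mx M : 'M[C]_(M.+1, M.+2) := \matrix_(i, j) (
  (Num.sqrt ((M.+1 - i)%:R / M.+2%:R))%:C *+ (j == widen_ord (leqnSn _) i)).
Definition shift_mx M : 'M[C]_(M.+1, M.+2) := \matrix_(i, j) (
  (Num.sqrt (i.+1%:R / M.+2%:R))%:C *+ (j == lift ord0 i)).

Lemma sum_pick n (j0 : 'I_n) (F : 'I_n -> C) (c : C) :
  \sum_j (c *+ (j == j0)) * F j = c * F j0.
Proof.
rewrite (bigD1 j0) //= eqxx mulr1n big1 ?addr0 // => j /negPf ->.
by rewrite mulr0n mul0r.
Qed.

Lemma normc_sqrt (x : R) (z : C) : 0 <= x ->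
  normc ((Num.sqrt x)%:C * z) ^+ 2 = x * normc z ^+ 2.
Proof.
by move=> x0; rewrite normcM exprMn normc_real real_normK ?num_real // sqr_sqrtr.
Qed.

(** The gain of the descent: coordinate [i] receives [(M+1-i)/(M+2)] from [keep_mx] and [i/(M+2)]
    from [shift_mx], which gives the Bessel constant [(M+1)/(M+2) < 1]. *)
Lemma fro_keep_shift M (v : 'cV[C]_M.+2) :
  fro (keep_mx M *m v) + fro (shift_mx M *m v) = M.+1%:R / M.+2%:R * fro v.
Proof.
rewrite /fro mulr_sumr.
under eq_bigr do rewrite big_ord_recl big_ord0 addr0 mxE.
under [X in _ + X]eq_bigr do rewrite big_ord_recl big_ord0 addr0 mxE.
under [RHS]eq_bigr do rewrite big_ord_recl big_ord0 addr0.
transitivity (\sum_(i < M.+1) (M.+1 - i)%:R / M.+2%:R *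
    normc (v (widen_ord (leqnSn _) i) ord0) ^+ 2 +
    \sum_(i < M.+1) i.+1%:R / M.+2%:R * normc (v (lift ord0 i) ord0) ^+ 2).
  by congr (_ + _); apply: eq_bigr => i _; under eq_bigr do rewrite mxE;
     rewrite sum_pick normc_sqrt // divr_ge0.
have -> : \sum_(i < M.+1) (M.+1 - i)%:R / M.+2%:R *
    normc (v (widen_ord (leqnSn _) i) ord0) ^+ 2 =
    \sum_(i < M.+2) (M.+1 - i)%:R / M.+2%:R * normc (v i ord0) ^+ 2.
  by rewrite [RHS]big_ord_recr /= subnn !mul0r addr0.
have -> : \sum_(i < M.+1) i.+1%:R / M.+2%:R * normc (v (lift ord0 i) ord0) ^+ 2 =
    \sum_(i < M.+2) i%:R / M.+2%:R * normc (v i ord0) ^+ 2.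
  by rewrite [RHS]big_ord_recl /= !mul0r add0r; apply: eq_bigr => i _; rewrite /= ?lift0 ?/bump ?leq0n ?add1n.
rewrite -big_split /=; apply: eq_bigr => i _.
by rewrite -!mulrDl -natrD subnK // -ltnS.
Qed.

(** The two maps together form an isometry into two copies of the next level, since the squared
    coefficients [(M+1-i)/(M+2)] and [(i+1)/(M+2)] add up to [1]. *)
Lemma fro_mul_keep_shift M p (X : 'M[C]_(p, M.+1)) :
  fro (X *m keep_mx M) + fro (X *m shift_mx M) = fro X.
Proof.
rewrite /fro -big_split /=; apply: eq_bigr => i _.
rewrite big_ord_recr [X in _ + X]big_ord_recl /=.
have -> : normc ((X *m keep_mx M) i ord_max) ^+ 2 = 0.
  rewrite mxE big1 ?normc0 ?expr0n // => j _.
  by rewrite mxE -val_eqE /= eqn_leq leqNgt ltn_ord mulr0n mulr0.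
have -> : normc ((X *m shift_mx M) i ord0) ^+ 2 = 0.
  by rewrite mxE big1 ?normc0 ?expr0n // => j _; rewrite mxE -val_eqE /= mulr0n mulr0.
rewrite addr0 add0r -big_split /=; apply: eq_bigr => j _.
rewrite !mxE.
have -> : \sum_j0 X i j0 * keep_mx M j0 (widen_ord (leqnSn M.+1) j) =
    (Num.sqrt ((M.+1 - j)%:R / M.+2%:R))%:C * X i j.
  rewrite -(sum_pick j (fun j0 => X i j0)); apply: eq_bigr => k _.
  rewrite mxE mulrC -val_eqE /= val_eqE eq_sym.
  by case: eqP => [->|].
have -> : \sum_j0 X i j0 * shift_mx M j0 (lift ord0 j) =
    (Num.sqrt (j.+1%:R / M.+2%:R))%:C * X i j.
  rewrite -(sum_pick j (fun j0 => X i j0)); apply: eq_bigr => k _.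
  rewrite mxE mulrC (inj_eq (@lift_inj _ ord0)) eq_sym.
  by case: eqP => [->|].
rewrite !normc_sqrt ?divr_ge0 // -mulrDl -mulrDl -natrD addnS subnK; last exact: ltnW.
by rewrite divff ?mul1r // pnatr_eq0.
Qed.

Lemma fro_col_mx m1 m2 n (A : 'M[C]_(m1, n)) (B : 'M[C]_(m2, n)) :
  fro (col_mx A B) = fro A + fro B.
Proof.
rewrite /fro big_split_ord /=; congr (_ + _); apply: eq_bigr => i _;
by apply: eq_bigr => j _; rewrite ?col_mxEu ?col_mxEd.
Qed.

Lemma qf_col_mx m1 m2 n (T : 'M[C]_n) (A : 'M[C]_(m1, n)) (B : 'M[C]_(m2, n)) :
  qf T (col_mx A B) = qf T A + qf T B.
Proof.
rewrite /qf tr_col_mx map_row_mx mul_col_mx mul_col_row mxtrace_block.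
by case: (\tr _) => ? ?; case: (\tr _).
Qed.

Variables (T : forall M, 'M[C]_M.+1) (s : R).
Hypothesis s01 : 0 <= s <= 1.
Hypothesis T_herm : forall M, T M \is hermsymmx.
Hypothesis T_psd : forall M (v : 'rV[C]_M.+1), 0 <= qf (T M) v.
Hypothesis T_rec : forall M p (X : 'M[C]_(p, M.+1)),
  qf (T M) X = qf (T M.+1) (X *m keep_mx M) + qf (T M.+1) (X *m shift_mx M).
Hypothesis T_base : forall M N, kyfan_le (T M) N (Num.min N%:R (M.+1%:R * s)).

(** Induction on the distance [d] to a top level of dimension [n = M+d+1], where the trivial bound
    [T_base] starts with excess [sqrt n]. The two weights of [kyfan_step] add up to [(M+1)/(M+2)],
    so each step down scales the excess by this factor, and the product telescopes to [(M+1)/n]. *)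
Lemma kyfan_descent_err d M N : (N <= M.+1)%N ->
  kyfan_le (T M) N (binom_mean M.+1 s (minr_nat R N) +
    Num.sqrt (M + d).+1%:R * (M.+1%:R / (M + d).+1%:R)).
Proof.
elim: d M N => [|d IH] M N NM p X Xb Xf.
  apply: le_trans (T_base Xb Xf) _; rewrite addn0 divff ?pnatr_eq0 // mulr1.
  exact: min_mean_le_binom_mean.
have M2 : 0 < M.+2%:R :> R by rewrite ltr0n.
have M2' : 1 + M.+1%:R = M.+2%:R :> R by rewrite nat1r.
pose rho : R := M.+1%:R / M.+2%:R.
have rhoE : 1 - rho = M.+2%:R^-1.
  apply: (mulIf (lt0r_neq0 M2)).
  by rewrite mulrBl mul1r /rho divfK ?gt_eqF // mulVf ?gt_eqF // -M2' addrK.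
pose e : R := Num.sqrt (M + d.+1).+1%:R * (M.+2%:R / (M + d.+1).+1%:R).
have IHM K : (K <= M.+2)%N -> kyfan_le (T M.+1) K (binom_mean M.+2 s (minr_nat R K) + e).
  by move=> KM; have := IH M.+1 K KM; rewrite addSnnS.
rewrite T_rec -qf_col_mx.
have := @kyfan_step R _ (T M.+1) N _ _ rho (T_herm _) (@T_psd _) (NM : (N < M.+2)%N) _ _
  (IHM _ (leqW NM)) (IHM N.+1 NM) _ (col_mx (X *m keep_mx M) (X *m shift_mx M)).
move=> H; apply: le_trans (H _ _ _ _) _.
- by rewrite divr_ge0 //= ler_pdivrMr // mul1r ler_nat.
- by rewrite rhoE /rho mulrC ler_pM2r ?invr_gt0 // ler_nat.
- move=> v; rewrite mul_col_mx fro_col_mx -fro_keep_shift -!mulmxA.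
  by apply: lerD; rewrite -[leRHS]mul1r; apply: Xb.
- by rewrite fro_col_mx fro_mul_keep_shift.
have E : binom_mean M.+1 s (minr_nat R N) = (M.+2%:R)^-1 *
    ((M.+1%:R - N%:R) * binom_mean M.+2 s (minr_nat R N) + N%:R * binom_mean M.+2 s (minr_nat R N.+1)).
  apply: (mulfI (lt0r_neq0 M2)); rewrite mulrA divff ?mul1r ?gt_eqF //.
  by rewrite binom_mean_elevation -binom_mean_lin; apply: eq_binom_mean => k; exact: minr_nat_elevation.
rewrite E rhoE /e /rho; set b1 := binom_mean _ _ _; set b2 := binom_mean _ _ _.
rewrite le_eqVlt; apply/orP; left; apply/eqP.
have d0 : (M + d.+1).+1%:R != 0 :> R by rewrite pnatr_eq0.
have m0 : M.+2%:R != 0 :> R by rewrite pnatr_eq0.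
have rN : M.+1%:R = M.+2%:R - 1 :> R by rewrite -M2' addrAC subrr add0r.
move: d0 m0; rewrite rN.
move: (M + d.+1).+1%:R M.+2%:R => u w u0 w0.
by field; rewrite u0 w0.
Qed.

Lemma kyfan_descent M N : (N <= M.+1)%N ->
  kyfan_le (T M) N (binom_mean M.+1 s (minr_nat R N)).
Proof.
move=> NM p X Xb Xf; apply/ler_addgt0Pr => e e0.
(* The error at distance [k] is [(M+1) / sqrt(M+k+1)], which this choice makes at most [e]. *)
pose k := Num.truncn ((M.+1%:R / e) ^+ 2).
have := kyfan_descent_err k NM Xb Xf => /le_trans; apply; rewrite lerD2l.
set n := (M + k).+1.
have n0 : 0 < n%:R :> R by rewrite ltr0n.
have -> : Num.sqrt n%:R * (M.+1%:R / n%:R) = M.+1%:R / Num.sqrt n%:R :> R.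
  have aux (u w x : R) : u != 0 -> u ^+ 2 = w -> u * (x / w) = x / u.
    by move=> u0 <-; field.
  by apply: aux; [rewrite gt_eqF // sqrtr_gt0|rewrite sqr_sqrtr // ltW].
rewrite ler_pdivrMr ?sqrtr_gt0 // mulrC -ler_pdivrMr //.
rewrite -[leLHS]ger0_norm ?divr_ge0 ?(ltW e0) // -sqrtr_sqr ler_wsqrtr //.
apply: ltW; apply: lt_le_trans (truncnS_gt _) _.
by rewrite ler_nat /n ltnS leq_addl.
Qed.

End Descent.

                                      

(** * Comparing the completed plane measure with the Borel product measure *)

Section Plane.
Variable R : realType.
Local Notation lam := (@lebesgue_measure R).
Local Notation borel2 := ((@lebesgue_measure R) \x (@lebesgue_measure R))%E.

(** An open set is a countable union of the open squares with rational center and rational half side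
    that it contains. *)
Lemma open2_measurable (U : set (R * R)) : open U -> measurable U.
Proof.
move=> oU.
pose B (a b r : rat) : set (R * R) :=
  `]ratr a - ratr r, ratr a + ratr r[ `*` `]ratr b - ratr r, ratr b + ratr r[.
have -> : U = \bigcup_a \bigcup_b \bigcup_(r in [set r | B a b r `<=` U]) B a b r.
  apply/seteqP; split => [[x y] Uxy|p [a _ [b _ [r /= Br]]]]; last exact: Br.
  have /nbhs_ballP[e /= e0 eU] : nbhs (x, y) U by exact: open_nbhs_nbhs.
  have [r] : exists r : rat, ratr r \in `]0, e / 2[.
    by apply: rat_in_itvoo; rewrite divr_gt0.
  rewrite in_itv /= => /andP[r0 re].
  have [a] : exists a : rat, ratr a \in `]x - ratr r, x + ratr r[.
    by apply: rat_in_itvoo; lra.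
  rewrite in_itv /= => /andP[ax1 ax2].
  have [b] : exists b : rat, ratr b \in `]y - ratr r, y + ratr r[.
    by apply: rat_in_itvoo; lra.
  rewrite in_itv /= => /andP[bx1 bx2].
  exists a => //; exists b => //; exists r; last first.
    by split; rewrite /= in_itv /=; lra.
  move=> [u v] [/=]; rewrite !in_itv /= => /andP[u1 u2] /andP[v1 v2].
  by apply: eU; split => /=; rewrite /ball /= ltr_norml; lra.
apply: bigcupT_measurable_rat => a; apply: bigcupT_measurable_rat => b.
rewrite bigcup_mkcond; apply: bigcupT_measurable_rat => r.
by case: ifP => // _; apply: measurableX; exact: measurable_itv.
Qed.

Lemma continuous2_measurable (f : R * R -> R) : continuous f ->
  measurable_fun setT f.
Proof.
move=> /continuousP cf; apply: (measurability _ (measurable_realfun.RGenOpens.measurableE R)).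
move=> _ [_ [a [b ->] <-]]; rewrite setTI; apply: open2_measurable.
exact/cf/interval_open.
Qed.

Definition plane := caratheodory_type (borel2^*)%mu.

Lemma borel_leb_measurable (A : set (R * R)) :
  measurable A -> (borel2^*)%mu.-cara.-measurable A.
Proof. by move=> mA; apply: (@caratheodory_measurable_mu_ext _ _ _ borel2 A mA). Qed.

Lemma measurable_plane_id : measurable_fun setT (id : plane -> R * R).
Proof. by move=> _ A mA; rewrite setTI; exact: borel_leb_measurable. Qed.

Lemma borel_plane_fun d (T : measurableType d) (f : R * R -> T) :
  measurable_fun setT f -> measurable_fun setT (f : plane -> T).
Proof. by move=> mf; exact: (measurableT_comp mf measurable_plane_id). Qed.

Lemma leb2E (A : set (R * R)) : measurable A -> leb2 A = borel2 A.
Proof. by move=> mA; rewrite /leb2 /completed_measure_extension measurable_mu_extE. Qed.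

(** The identity is measurable from the completed plane to the Borel plane and pushes [leb2] to the
    product measure; this makes Tonelli's theorem available for Borel functions. *)
Lemma ge0_integral_leb2 (f : R * R -> \bar R) : measurable_fun setT f ->
  (forall x, (0 <= f x)%E) ->
  (\int[@leb2 R]_x f x = \int[borel2]_x f x)%E.
Proof.
move=> mf f0.
pose phi := id : plane -> measurableTypeR R * measurableTypeR R.
have mphi : measurable_fun setT phi by exact: measurable_plane_id.
transitivity (\int[pushforward (@leb2 R) phi]_x f x)%E; last first.
  by apply: eq_measure_integral => A mA _; exact: leb2E.
have := @ge0_integral_pushforward _ _ _ _ R phi mphi (@leb2 R) setT f
  measurableT mf (fun y _ => f0 y).
by rewrite preimage_setT => ->.
Qed.

Lemma integral_leb2 (f : R * R -> \bar R) : measurable_fun setT f ->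
  (\int[@leb2 R]_x f x = \int[borel2]_x f x)%E.
Proof.
move=> mf; rewrite integralE [RHS]integralE.
by congr (_ - _)%E; apply: ge0_integral_leb2 => //;
   [exact: measurable_funepos|exact: measurable_funeneg].
Qed.

Lemma lebesgue_measureD (a : R) (A : set R) : measurable A ->
  pushforward lam (fun x => x + a : measurableTypeR R) A = lam A.
Proof.
move=> mA; apply/esym/lebesgue_measure_unique => //=.
  by apply: measurable_funD.
move=> mf _ [[u v]] _ <-.
rewrite /pushforward (_ : _ @^-1` _ = `]u - a, v - a]%classic); last first.
  by apply/seteqP; split => x; rewrite /= !in_itv /= ltrBlDr lerBrDr.
rewrite !lebesgue_measure_itv /= !lte_fin ltrD2r.
by case: ifP => // _; rewrite -!EFinB; congr (_%:E); ring.
Qed.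

Lemma ge0_integral_addr (a : R) (f : R -> \bar R) : measurable_fun setT f ->
  (forall x, (0 <= f x)%E) -> (\int[lam]_x f (x + a)%R = \int[lam]_x f x)%E.
Proof.
move=> mf f0.
pose phi := (fun x : R => x + a) : measurableTypeR R -> measurableTypeR R.
have mphi : measurable_fun setT phi by exact: measurable_funD.
transitivity (\int[pushforward lam phi]_x f x)%E; last first.
  by apply: eq_measure_integral => A mA _; exact: lebesgue_measureD.
have := @ge0_integral_pushforward _ _ _ _ R phi mphi lam setT f
  measurableT mf (fun y _ => f0 y).
by rewrite preimage_setT => ->.
Qed.

End Plane.

(** * Invariance under shears, translations and rotations; the area of a disc *)

Section PlaneInvariance.
Variable R : realType.
Local Notation lam := (@lebesgue_measure R).
Local Notation borel2 := ((@lebesgue_measure R) \x (@lebesgue_measure R))%E.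

Lemma FTC_everywhere (F f : R -> R) a b : a <= b ->
  (forall x : R, is_derive x 1 F (f x)) -> continuous f ->
  (\int[lam]_(x in `[a, b]) (f x)%:E = (F b - F a)%:E)%E.
Proof.
rewrite le_eqVlt => /predU1P[->|ab] dF cf.
  by rewrite set_itv1 integral_set1 subrr.
have cF : continuous F.
  by move=> x; apply/differentiable_continuous/derivable1_diffP; case: (dF x).
rewrite (@continuous_FTC2 _ f F a b) //.
- by move=> x; apply: continuous_subspaceT.
- split; first by move=> x _; case: (dF x).
  + by apply: cvg_at_right_filter; exact: cF.
  + by apply: cvg_at_left_filter; exact: cF.
- by move=> x _; rewrite derive1E; case: (dF x).
Qed.

Section Shears.
Variable f : R * R -> \bar R.
Hypotheses (mf : measurable_fun setT f) (f0 : forall p, (0 <= f p)%E).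

(** By Tonelli, a shear translates each horizontal line, and one-dimensional translations preserve
    Lebesgue measure. *)
Lemma ge0_integral_shear1 (g : R -> R) : measurable_fun setT g ->
  (\int[borel2]_p f (p.1 + g p.2, p.2)%R = \int[borel2]_p f p)%E.
Proof.
move=> mg.
have mS : measurable_fun setT (fun p : R * R => (p.1 + g p.2, p.2)).
  apply: measurable_fun_pair => //.
  by apply: measurable_funD => //; exact: measurableT_comp.
have mfS := measurableT_comp mf mS.
rewrite (@fubini_tonelli2 _ _ _ _ _ lam lam (fun p => f (p.1 + g p.2, p.2))  mfS _) //.
rewrite (@fubini_tonelli2 _ _ _ _ _ lam lam f mf f0).
apply: eq_integral => y _; rewrite /fubini_G /=.
apply: (@ge0_integral_addr R (g y) (fun x => f (x, y))) => //.
exact: measurable_fun_pair1.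
Qed.

Lemma ge0_integral_shear2 (g : R -> R) : measurable_fun setT g ->
  (\int[borel2]_p f (p.1, p.2 + g p.1)%R = \int[borel2]_p f p)%E.
Proof.
move=> mg.
have mS : measurable_fun setT (fun p : R * R => (p.1, p.2 + g p.1)).
  apply: measurable_fun_pair => //.
  by apply: measurable_funD => //; exact: measurableT_comp.
have mfS := measurableT_comp mf mS.
rewrite (@fubini_tonelli1 _ _ _ _ _ lam lam (fun p => f (p.1, p.2 + g p.1))  mfS _) //.
rewrite (@fubini_tonelli1 _ _ _ _ _ lam lam f mf f0).
apply: eq_integral => x _; rewrite /fubini_F /=.
apply: (@ge0_integral_addr R (g x) (fun y => f (x, y))) => //.
exact: measurable_fun_pair2.
Qed.

End Shears.

Lemma ge0_integral_translate (f : R * R -> \bar R) (a b : R) :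
  measurable_fun setT f -> (forall p, (0 <= f p)%E) ->
  (\int[borel2]_p f (p.1 + a, p.2 + b)%R = \int[borel2]_p f p)%E.
Proof.
move=> mf f0.
rewrite -(ge0_integral_shear1 mf f0 (measurable_cst a)) /=.
rewrite -(@ge0_integral_shear2 (fun p => f (p.1 + a, p.2)) _ _ (cst b)) //.
apply: measurableT_comp => //; apply: measurable_fun_pair => //.
exact: measurable_funD.
Qed.

Definition rotp (c s : R) (p : R * R) : R * R :=
  (c * p.1 - s * p.2, s * p.1 + c * p.2).

Lemma measurable_rotp c s : measurable_fun setT (rotp c s).
Proof.
apply: measurable_fun_pair.
  by apply: measurable_funB; apply: measurable_funM.
by apply: measurable_funD; apply: measurable_funM.
Qed.

                                                                        
(** A rotation with nonzero sine is a product of three shears, so no change of variables formula for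
    linear maps enters. *)
Lemma ge0_integral_rot (f : R * R -> \bar R) (c s : R) :
  c ^+ 2 + s ^+ 2 = 1 ->
  measurable_fun setT f -> (forall p, (0 <= f p)%E) ->
  (\int[borel2]_p f (rotp c s p) = \int[borel2]_p f p)%E.
Proof.
have gen (g : R * R -> \bar R) u v : v != 0 -> u ^+ 2 + v ^+ 2 = 1 ->
    measurable_fun setT g -> (forall p, (0 <= g p)%E) ->
    (\int[borel2]_p g (rotp u v p) = \int[borel2]_p g p)%E.
  (* For the angle [theta] with cosine [u] and sine [v] this is [- tan(theta / 2)], the coefficient
     of the two horizontal shears; the vertical one has coefficient [v]. *)
  move=> v0 uv mg g0; pose a := (u - 1) / v.
  have mM (k : R) : measurable_fun setT ( *%R k) by exact: measurable_funM.
  rewrite -[RHS](ge0_integral_shear1 mg g0 (mM a)).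
  have m1 : measurable_fun setT (fun p : R * R => g (p.1 + a * p.2, p.2)).
    apply: measurableT_comp => //; apply: measurable_fun_pair => //.
    by apply: measurable_funD => //; exact: measurable_funM.
  rewrite -[RHS](ge0_integral_shear2 m1 _ (mM v)) //=.
  set g2 := fun p : R * R => g (p.1 + a * (p.2 + v * p.1), p.2 + v * p.1).
  have mS : measurable_fun setT (fun p : R * R => (p.1, p.2 + v * p.1)).
    apply: measurable_fun_pair => //.
    by apply: measurable_funD => //; exact: measurable_funM.
  have m2 : measurable_fun setT g2 by exact: (measurableT_comp m1 mS).
  rewrite -[RHS](ge0_integral_shear1 m2 (fun=> g0 _) (mM a)).
  apply: eq_integral => -[x y] _; rewrite /g2 /rotp /=; congr (g (_, _)).
    have h : v ^+ 2 = (1 - u) * (1 + u) by rewrite -[1 - u]opprB; nra.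
    have h3 : a * v = u - 1 by rewrite /a divfK.
    have h2 : a * (1 + u) = - v.
      apply: (mulIf v0); rewrite mulrAC h3 mulNr -expr2 h; ring.
    transitivity ((1 + a * v) * x + a * (1 + (1 + a * v)) * y); last by ring.
    by rewrite h3 subrKC h2; ring.
  by rewrite /a; field.
have [->|s0] := eqVneq s 0; last exact: gen.
rewrite expr0n /= addr0 => /eqP; rewrite sqrf_eq1 => /orP[/eqP->|/eqP->] mf f0.
  by apply: eq_integral => -[x y] _; rewrite /rotp /=; congr (f (_, _)); ring.
(* The half turn has zero sine and is treated as two quarter turns. *)
have i2 : (0 : R) ^+ 2 + 1 ^+ 2 = 1 by rewrite expr0n expr1n add0r.
rewrite -[RHS](gen f 0 1 (oner_neq0 _) i2 mf f0).
rewrite -[RHS](gen (f \o rotp 0 1) 0 1 (oner_neq0 _) i2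
  (measurableT_comp mf (measurable_rotp 0 1)) (fun p => f0 _)).
by apply: eq_integral => -[x y] _; rewrite /rotp /=; congr (f (_, _)); ring.
Qed.

(** The substitution [x = r sin u] turns the chord length into [2 r^2 cos^2 u]. Outside [[-r, r]]
    the square root of a negative number is [0], so the integral over the line is the one over the
    interval. *)
Lemma integral_half_chords (r : R) : 0 <= r ->
  (\int[lam]_x (2 * Num.sqrt (r ^+ 2 - x ^+ 2))%:E = (pi * r ^+ 2)%:E)%E.
Proof.
move=> r0.
have [->|rn0] := eqVneq r 0.
  rewrite expr0n mulr0 (eq_integral (cst 0%E)) ?integral0 // => x _.
  by rewrite /= sub0r ler0_sqrtr ?mulr0 // oppr_le0 sqr_ge0.
have {}r0 : 0 < r by rewrite lt_neqAle eq_sym rn0.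
have -> : (\int[lam]_x (2 * Num.sqrt (r ^+ 2 - x ^+ 2))%:E =
    \int[lam]_(x in `[(- r)%R, r]) (2 * Num.sqrt (r ^+ 2 - x ^+ 2))%:E)%E.
  rewrite [RHS]integral_mkcond; apply: eq_integral => x _; rewrite patchE.
  case: ifPn => //; rewrite notin_setE /= in_itv /= -ler_norml => /negP.
  rewrite -ltNge => rx; rewrite ler0_sqrtr ?mulr0 //.
  rewrite subr_le0 -(@real_normK _ x) ?num_real // ler_sqr ?nnegrE ?normr_ge0 ?(ltW r0) //.
  exact: ltW.
have p2 : 0 < pi / 2 :> R by rewrite divr_gt0 ?pi_gt0.
pose F (u : R) := r * sin u.
have dF (u : R) : is_derive u 1 F (r * cos u).
  by apply: is_deriveZ.
have DF : F^`()%classic = (fun u => r * cos u).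
  by apply/funext => u; rewrite derive1E; case: (dF u).
have cFd : continuous (fun u : R => r * cos u).
  by move=> u; apply: cvgM; [exact: cvg_cst|exact: continuous_cos].
have cF : continuous F.
  by move=> u; apply: cvgM; [exact: cvg_cst|exact: continuous_sin].
have Fr : F (pi / 2) = r by rewrite /F sin_pihalf mulr1.
have FNr : F (- (pi / 2)) = - r by rewrite /F sinN sin_pihalf mulrN1.
transitivity (\int[lam]_(x in `[(F (- (pi / 2)))%R, (F (pi / 2))%R])
  (2 * Num.sqrt (r ^+ 2 - x ^+ 2))%:E)%E; first by rewrite Fr FNr.
rewrite (@integration_by_substitution_increasing _ F
  (fun x => 2 * Num.sqrt (r ^+ 2 - x ^+ 2))).
- transitivity (\int[lam]_(u in `[(- (pi / 2))%R, (pi / 2)%R])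
     (2 * r ^+ 2 * cos u ^+ 2)%:E)%E.
    apply: eq_integral => u; rewrite inE /= in_itv /= => up.
    rewrite DF; change ((2 * Num.sqrt (r ^+ 2 - (r * sin u) ^+ 2) * (r * cos u))%:E = (2 * r ^+ 2 * cos u ^+ 2)%:E).
    have -> : r ^+ 2 - (r * sin u) ^+ 2 = (r * cos u) ^+ 2.
      by rewrite !exprMn cos2sin2; ring.
    rewrite sqrtr_sqr ger0_norm; first by congr (_%:E); ring.
    by rewrite mulr_ge0 ?(ltW r0) // cos_ge0_pihalf.
  have dG (u : R) : is_derive u 1 (fun u : R => r ^+ 2 * (u + sin u * cos u))
      (2 * r ^+ 2 * cos u ^+ 2).
    have H : is_derive u 1 (fun u : R => r ^+ 2 * (u + sin u * cos u))
        (r ^+ 2 *: (1 + (sin u *: (- sin u) + cos u *: cos u))).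
      by apply: is_deriveZ.
    move: H; congr is_derive; rewrite /GRing.scale /=.
    by have := cos2Dsin2 u; rewrite !expr2; nra.
  have cG : continuous (fun u : R => 2 * r ^+ 2 * cos u ^+ 2).
    move=> u; apply: cvgM; first exact: cvg_cst.
    by under eq_fun do rewrite expr2; rewrite expr2;
       apply: cvgM; exact: continuous_cos.
  rewrite (FTC_everywhere _ dG cG); last by lra.
  by rewrite cosN sinN cos_pihalf; congr (_%:E); field.
- by lra.
- move=> x y xI yI xy; rewrite /F ltr_pM2l // ltr_sin //.
- by rewrite DF => x _; exact: cFd.
- by rewrite DF; apply/cvg_ex; exists (r * cos (- (pi / 2))); apply: cvg_at_right_filter; exact: cFd.
- by rewrite DF; apply/cvg_ex; exists (r * cos (pi / 2)); apply: cvg_at_left_filter; exact: cFd.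
- split; first by move=> x _; case: (dF x).
  + by apply: cvg_at_right_filter; exact: cF.
  + by apply: cvg_at_left_filter; exact: cF.
- apply: continuous_subspaceT => x; apply: cvgM; first exact: cvg_cst.
  apply: continuous_comp; last exact: sqrt_continuous.
  apply: cvgB; first exact: cvg_cst.
  by under eq_fun do rewrite expr2; rewrite expr2; apply: cvgM; exact: cvg_id.
Qed.

End PlaneInvariance.

(** * Radial integration in the variable [t = pi |z|^2] *)

Section DiscArea.
Variable R : realType.
Local Notation lam := (@lebesgue_measure R).
Local Notation borel2 := ((@lebesgue_measure R) \x (@lebesgue_measure R))%E.

Definition pisq (p : R * R) : R := pi * (p.1 ^+ 2 + p.2 ^+ 2).

Lemma pisq_ge0 p : 0 <= pisq p.
Proof. by rewrite mulr_ge0 ?pi_ge0 // addr_ge0 ?sqr_ge0. Qed.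

Lemma continuous_pisq : continuous pisq.
Proof.
move=> p; apply: cvgM; first exact: cvg_cst.
apply: cvgD.
  by under eq_fun do rewrite expr2; rewrite expr2; apply: cvgM; exact: cvg_fst.
by under eq_fun do rewrite expr2; rewrite expr2; apply: cvgM; exact: cvg_snd.
Qed.

Lemma measurable_pisq : measurable_fun setT pisq.
Proof. exact: continuous2_measurable continuous_pisq. Qed.

Lemma measurable_pisq_lt t : measurable [set p | pisq p < t].
Proof.
rewrite (_ : [set p | _] = pisq @^-1` `]-oo, t[%classic); last first.
  by apply/seteqP; split => p; rewrite /= in_itv.
by rewrite -[X in measurable X]setTI; apply: measurable_pisq.
Qed.

Lemma area_pisq_lt t : 0 <= t -> borel2 [set p | pisq p < t] = t%:E.
Proof.
move=> t0; pose r := Num.sqrt (t / pi).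
have tpi : 0 <= t / pi by rewrite divr_ge0 ?pi_ge0.
have r0 : 0 <= r by rewrite sqrtr_ge0.
have rr : r ^+ 2 = t / pi by rewrite sqr_sqrtr.
transitivity (\int[lam]_x (2 * Num.sqrt (r ^+ 2 - x ^+ 2))%:E)%E; last first.
  by rewrite integral_half_chords // rr mulrC divfK // gt_eqF ?pi_gt0.
rewrite /product_measure1 /=; apply: eq_integral => x _ /=.
have -> : xsection [set p | pisq p < t] x =
    `](- Num.sqrt (r ^+ 2 - x ^+ 2)), (Num.sqrt (r ^+ 2 - x ^+ 2))[%classic.
  apply/seteqP; split => y; rewrite /xsection /= inE /= in_itv /= -ltr_norml.
    rewrite /pisq /= mulrC -ltr_pdivlMr ?pi_gt0 // -rr => h.
    by rewrite -sqrtr_sqr ltr_sqrt ?subr_gt0; [nra | have := sqr_ge0 y; nra].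
  rewrite /pisq /= mulrC -ltr_pdivlMr ?pi_gt0 // -rr => h.
  have h0 : 0 < Num.sqrt (r ^+ 2 - x ^+ 2) by exact: le_lt_trans h.
  rewrite sqrtr_gt0 in h0.
  by move: h; rewrite -sqrtr_sqr ltr_sqrt //; lra.
rewrite lebesgue_measure_itv /= lte_fin.
have := sqrtr_ge0 (r ^+ 2 - x ^+ 2); set q := Num.sqrt _.
rewrite le_eqVlt => /predU1P[<-|q0]; first by rewrite oppr0 ltxx mulr0.
by rewrite gtrN // -EFinB; congr (_%:E); ring.
Qed.

(** The disc [pi |z|^2 < t] has area [t], so the two measures agree on half-lines, which form a
    generating family stable under intersection. This replaces polar coordinates. *)
Lemma pushforward_pisq (A : set R) : measurable A -> A `<=` `[0, +oo[ ->
  borel2 (pisq @^-1` A) = lam A.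
Proof.
move=> mA A0.
pose Q := pisq : measurableTypeR R * measurableTypeR R -> measurableTypeR R.
have mQ : measurable_fun setT Q by exact: measurable_pisq.
have mD : measurable (`[0, +oo[%classic : set (measurableTypeR R)).
  exact: measurable_itv.
pose m1 : {measure set (measurableTypeR R) -> \bar R} := pushforward borel2 Q.
pose m2 : {measure set (measurableTypeR R) -> \bar R} := mrestr lam mD.
have lamD t : lam (`]-oo, t[ `&` `[0, +oo[) = (Num.max t 0)%:E.
  rewrite (_ : _ `&` _ = `[0, t[%classic); last first.
    apply/seteqP; split => x /=; rewrite !in_itv /= ?andbT.
      by move=> [-> ->].
    by move=> /andP[-> ->].
  rewrite lebesgue_measure_itv /= lte_fin; case: (ltP 0 t) => t0 //.
  by rewrite -EFinB subr0.
have borelQ t : borel2 (pisq @^-1` `]-oo, t[) = (Num.max t 0)%:E.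
  case: (leP t 0) => t0.
    rewrite (_ : _ @^-1` _ = set0) ?measure0 //.
    rewrite -subset0 => p /=; rewrite in_itv /= => pt.
    by have := pisq_ge0 p; rewrite leNgt (lt_le_trans pt).
  rewrite (_ : _ @^-1` _ = [set p | pisq p < t]).
    exact: area_pisq_lt (ltW t0).
  by apply/seteqP; split => p; rewrite /= in_itv.
pose G := @measurable_realfun.RGenInftyO.G R.
pose g (n : nat) : set R := `]-oo, n%:R[%classic.
have GI : setI_closed G.
  move=> _ _ [x ->] [y ->]; exists (Num.min x y); apply/seteqP; split => z /=;
    rewrite !in_itv /= lt_min; first by move=> [-> ->].
  by move=> /andP[-> ->].
have Gg n : G (g n) by exists n%:R.
have gT : \bigcup_k g k = setT.
  apply/seteqP; split => // x _; exists (Num.truncn x).+1 => //=.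
  by rewrite /g /= in_itv /= truncnS_gt.
have E1 B : G B -> m1 mQ B = m2 B.
  by move=> [t ->]; rewrite /m1 /m2 /= /pushforward /mrestr lamD borelQ.
have E2 n : (m1 mQ (g n) < +oo)%E by rewrite /m1 /= /pushforward borelQ ltry.
have := @measure_unique _ R (measurableTypeR R) G g
  (measurable_realfun.RGenInftyO.measurableE R) GI Gg gT (m1 mQ) m2 E1 E2 A mA.
by rewrite /m1 /m2 /= /pushforward /mrestr (setIidl A0).
Qed.

Lemma ge0_integral_radial (g : R -> \bar R) : measurable_fun setT g ->
  (forall x, (0 <= g x)%E) ->
  (\int[@leb2 R]_p g (pisq p) = \int[lam]_(t in `[0%R, +oo[) g t)%E.
Proof.
move=> mg g0; rewrite ge0_integral_leb2 //; last first.
  exact: (measurableT_comp mg measurable_pisq).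
pose Q := pisq : measurableTypeR R * measurableTypeR R -> measurableTypeR R.
have mQ : measurable_fun setT Q by exact: measurable_pisq.
have mD : measurable (`[0, +oo[%classic : set (measurableTypeR R)).
  exact: measurable_itv.
have := @ge0_integral_pushforward _ _ _ _ R Q mQ borel2 `[0, +oo[%classic g mD
  (measurable_funTS mg) (fun y _ => g0 y).
rewrite (_ : Q @^-1` _ = setT); last first.
  by apply/seteqP; split => // p _; rewrite /= in_itv /= andbT pisq_ge0.
move=> <-; apply: eq_measure_integral => A mA AD.
exact: pushforward_pisq.
Qed.

End DiscArea.

                         

(** * Complex differentiability and the complex exponential *)

Section Holomorphic.
Variable R : realType.
Local Notation C := R[i].
Implicit Types (F G : C -> C) (z h : C).

(** Complex differentiability at [z] with derivative [A], with real tolerances so that estimates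
    take place in [R]; [entireP] links it to [entire]. *)
Definition cdiff F z (A : C) := forall e : R, 0 < e -> exists2 d : R, 0 < d &
  forall h, normc h < d -> normc (F (z + h) - F z - A * h) <= e * normc h.

Lemma normE z : `|z| = (normc z)%:C. Proof. by []. Qed.

Lemma gt0_real_complex (e : C) : 0 < e -> exists2 d : R, 0 < d & e = d%:C.
Proof. by case: e => a b; rewrite ltcE /= => /andP[/eqP -> a0]; exists a. Qed.

Lemma ltr0_realc (k : R) : (0 < k%:C :> C) = (0 < k).
Proof. by rewrite ltcE /= eqxx. Qed.

Lemma derivable_cdiff F z :
  derivable (F : C^o -> C^o) z 1 -> exists A, cdiff F z A.
Proof.
move=> /cvg_ex [A /= FA]; exists A => e e0.
have /cvgrPdist_le := FA => /(_ e%:C).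
rewrite ltr0_realc => /(_ e0) -[d' /= /gt0_real_complex[d d0 ->] dP].
exists d => // h hd.
have [->|h0] := eqVneq h 0.
  by rewrite addr0 subrr mulr0 subr0 normc0 mulr0.
have := dP h; rewrite /ball_ /= sub0r normrN normE ltcR => /(_ hd h0).
rewrite normE lecR /GRing.scale /= => H.
have -> : F (z + h) - F z - A * h = - h * (A - h^-1 * (F (h * 1 + z) - F z)).
  by rewrite mulr1 (addrC h) mulrBr !mulNr opprK mulrA divff // mul1r; ring.
by rewrite normcM normcN mulrC ler_wpM2r // normc_ge0.
Qed.

Lemma cdiff_derivable F z A :
  cdiff F z A -> derivable (F : C^o -> C^o) z 1.
Proof.
move=> FA; apply/cvg_ex; exists A; apply/cvgrPdist_le => e' /gt0_real_complex[e e0 ->].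
have [d d0 dP] := FA e e0.
exists d%:C; first by rewrite /= ltr0_realc.
move=> h /=; rewrite /ball_ /= sub0r normrN normE ltcR => hd h0.
have := dP h hd; rewrite normE lecR /GRing.scale /= => H.
have hn : 0 < normc h.
  rewrite lt_neqAle normc_ge0 andbT eq_sym; apply: contra h0 => /eqP /eq0_normc /eqP; exact.
rewrite -(ler_pM2r hn) -normcM; apply: le_trans H.
rewrite mulr1 (addrC h) mulrBl mulrAC mulVf // mul1r.
by rewrite -normcN opprB.
Qed.

Lemma entireP F : entire F <-> forall z, exists A, cdiff F z A.
Proof.
split=> [eF z|H z]; first exact: derivable_cdiff (eF z).
by have [A] := H z; exact: cdiff_derivable.
Qed.

Lemma le_normcB z z' : normc z - normc z' <= normc (z - z').
Proof. by rewrite lerBlDr; apply: le_trans (le_normcD _ _); rewrite subrK. Qed.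

Lemma le_Re_normc z : `|complex.Re z| <= normc z.
Proof.
case: z => a b /=; rewrite -sqrtr_sqr ler_wsqrtr // lerDl; exact: sqr_ge0.
Qed.

Lemma le_Im_normc z : `|complex.Im z| <= normc z.
Proof.
case: z => a b /=; rewrite -sqrtr_sqr ler_wsqrtr // lerDr; exact: sqr_ge0.
Qed.

Lemma normc_le_add z : normc z <= `|complex.Re z| + `|complex.Im z|.
Proof.
have h0 : 0 <= `|complex.Re z| + `|complex.Im z| by rewrite addr_ge0.
rewrite -(ler_sqr (x := normc z)) ?nnegrE ?normc_ge0 // normc_sq.
rewrite -[complex.Re z ^+ 2]real_normK ?num_real // -[complex.Im z ^+ 2]real_normK ?num_real //.
rewrite sqrrD; have := mulr_ge0 (normr_ge0 (complex.Re z)) (normr_ge0 (complex.Im z)); lra.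
Qed.

Lemma cdiff_cont F z A : cdiff F z A -> forall e : R, 0 < e -> exists2 d : R, 0 < d &
  forall h, normc h < d -> normc (F (z + h) - F z) < e.
Proof.
move=> FA e e0; have [d d0 dP] := FA 1 ltr01.
have nA := normc_ge0 A.
exists (Num.min d (e / (normc A + 1))).
  by rewrite lt_min d0 divr_gt0 // ltr_wpDl.
move=> h; rewrite lt_min => /andP[/dP h1].
rewrite ltr_pdivlMr; last by rewrite ltr_wpDl.
move=> h2; rewrite -[_ - F z](subrK (A * h)).
apply: le_lt_trans (le_normcD _ _) _; rewrite normcM.
by apply: le_lt_trans h2; rewrite mulrDr mulr1 mul1r in h1 *; rewrite addrC mulrC lerD2l.
Qed.

Lemma entire_continuous2 F : entire F ->
  continuous (fun p : R * R => complex.Re (F (toC p))) /\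
  continuous (fun p : R * R => complex.Im (F (toC p))).
Proof.
move=> /entireP eF.
have key p (e : R) : 0 < e -> \forall q \near nbhs p,
    normc (F (toC p) - F (toC q)) < e.
  move=> e0; have [A /cdiff_cont /(_ e e0) [d d0 dP]] := eF (toC p).
  exists (ball p.1 (d / 2), ball p.2 (d / 2)).
    by split; exact: nbhsx_ballx (divr_gt0 d0 _).
  move=> [x y] [/=]; rewrite /ball /= => hx hy.
  have e1 : toC p + (toC (x, y) - toC p) = toC (x, y) by rewrite addrC subrK.
  rewrite -normcN opprB -e1; apply: dP.
  apply: le_lt_trans (normc_le_add _) _; rewrite /toC /=.
  by rewrite -(normrN (x - _)) -(normrN (y - _)) !opprB; lra.
split=> p; apply/cvgrPdist_lt => e e0; apply: filterS (key p e e0) => q; apply: le_lt_trans;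
  [apply: le_trans (le_Re_normc _)|apply: le_trans (le_Im_normc _)];
  by case: (F (toC p)) => ? ?; case: (F (toC q)).
Qed.

Lemma entire_cst (a : C) : entire (fun=> a).
Proof. by move=> z; exact: derivable_cst. Qed.

Lemma entire_id : entire (@id C).
Proof. by move=> z; exact: derivable_id. Qed.

Lemma entireD F G : entire F -> entire G -> entire (fun z => F z + G z).
Proof. by move=> eF eG z; exact: (derivableD (eF z) (eG z)). Qed.

Lemma entireM F G : entire F -> entire G -> entire (fun z => F z * G z).
Proof. by move=> eF eG z; exact: (derivableM (eF z) (eG z)). Qed.

Lemma entireZ (a : C) F : entire F -> entire (fun z => a * F z).
Proof. by move=> eF; exact: (@entireM (fun=> a) F (@entire_cst a) eF). Qed.

Lemma entireX F n : entire F -> entire (fun z => F z ^+ n).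
Proof.
move=> eF; elim: n => [|n IH]; first exact: entire_cst.
by under eq_fun do rewrite exprS; exact: entireM.
Qed.

Lemma entire_exp n : entire (fun z : C => z ^+ n).
Proof. exact: (@entireX (fun z => z) n entire_id). Qed.

Lemma entire_sum (I : Type) (r : seq I) (F : I -> C -> C) :
  (forall i, entire (F i)) -> entire (fun z => \sum_(i <- r) F i z).
Proof.
move=> eF; elim: r => [|i r IH].
  have -> : (fun z => \sum_(j <- [::]) F j z) = (fun=> 0 : C).
    by apply/funext => z; rewrite big_nil.
  exact: (@entire_cst 0).
have -> : (fun z => \sum_(j <- i :: r) F j z) =
    (fun z => F i z + \sum_(j <- r) F j z) by apply/funext => z; rewrite big_cons.
exact: (@entireD (F i) (fun z => \sum_(j <- r) F j z) (eF i) IH).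
Qed.

Lemma entire_comp F G : entire F -> entire G -> entire (fun z => F (G z)).
Proof.
move=> /entireP eF /entireP eG; apply/entireP => z.
have [A FA] := eF (G z); have [B GB] := eG z; exists (A * B) => e e0.
have nA := normc_ge0 A; have nB := normc_ge0 B.
have [|d1 d10 H1] := FA (e / (2 * (normc B + 1))).
  by rewrite divr_gt0 // mulr_gt0 // ltr_wpDl.
pose e2 := Num.min 1 (e / (2 * (normc A + 1))).
have e20 : 0 < e2 by rewrite lt_min ltr01 divr_gt0 // mulr_gt0 // ltr_wpDl.
have [d2 d20 H2] := GB e2 e20.
have [d3 d30 H3] := cdiff_cont GB d10.
exists (Num.min d2 d3); first by rewrite lt_min d20.
move=> h; rewrite lt_min => /andP[/H2 h2 /H3 h3].
pose k := G (z + h) - G z; have hn := normc_ge0 h.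
have kh : normc k <= (normc B + 1) * normc h.
  rewrite -[k](subrK (B * h)); apply: le_trans (le_normcD _ _) _.
  rewrite normcM addrC mulrDl lerD2l mul1r; apply: le_trans h2 _.
  by rewrite -[leRHS]mul1r ler_wpM2r // ge_min lexx.
have -> : F (G (z + h)) - F (G z) - A * B * h =
    (F (G z + k) - F (G z) - A * k) + A * (k - B * h).
  by rewrite /k subrKC; ring.
apply: le_trans (le_normcD _ _) _.
have -> : e * normc h = e / 2 * normc h + e / 2 * normc h by field.
apply: lerD.
  apply: le_trans (H1 _ h3) _; rewrite invfM mulrA -mulrA ler_wpM2l ?divr_ge0 ?(ltW e0) //.
  by rewrite mulrC ler_pdivrMr ?ltr_wpDl // mulrC.
rewrite normcM; apply: le_trans (ler_wpM2l nA h2) _.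
rewrite mulrA ler_wpM2r //.
have : normc A * e2 <= normc A * (e / (2 * (normc A + 1))).
  by rewrite ler_wpM2l // ge_min lexx orbT.
move=> /le_trans; apply.
have A1 : 0 < normc A + 1 by rewrite ltr_wpDl.
have -> : normc A * (e / (2 * (normc A + 1))) = (e / 2) * (normc A / (normc A + 1)).
  by field; rewrite gt_eqF.
by rewrite ler_piMr ?divr_ge0 ?(ltW e0) // ler_pdivrMr // mul1r lerDl.
Qed.

Lemma entire_shift F (c : C) : entire F -> entire (fun z => F (z + c)).
Proof. by move=> eF; apply: (entire_comp eF); apply: (entireD entire_id (@entire_cst c)). Qed.

Lemma entire_scale F (a : C) : entire F -> entire (fun z => F (a * z)).
Proof. by move=> eF; apply: (entire_comp eF); apply: (entireZ entire_id). Qed.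

Definition cexp (z : C) : C :=
  (expR (complex.Re z))%:C * (cos (complex.Im z) +i* sin (complex.Im z)).

Lemma cexpD z z' : cexp (z + z') = cexp z * cexp z'.
Proof.
case: z => a b; case: z' => c d; rewrite /cexp /= expRD cosD sinD.
by apply/eqP; rewrite eq_complex /=; apply/andP; split; apply/eqP; ring.
Qed.

Lemma normc_cexp z : normc (cexp z) = expR (complex.Re z).
Proof.
rewrite /cexp normcM normc_real ger0_norm ?expR_ge0 //=.
by rewrite cos2Dsin2 sqrtr1 mulr1.
Qed.

Lemma cexp0 : cexp 0 = 1.
Proof. by rewrite /cexp /= expR0 cos0 sin0 mul1r. Qed.

Lemma real_diff0 (f : R -> R) (a : R) : is_derive (0 : R) 1 f a ->
  forall e : R, 0 < e -> exists2 d : R, 0 < d &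
    forall t, `|t| < d -> `|f t - f 0 - a * t| <= e * `|t|.
Proof.
move=> [df fa] e e0.
have : h^-1 *: (f (h *: 1 + 0) - f 0) @[h --> 0^'] --> a by rewrite -fa; exact: df.
move=> /cvgrPdist_le /(_ e e0) [d /= d0 dP].
exists d => // t td; have [->|t0] := eqVneq t 0.
  by rewrite subrr mulr0 subrr normr0 mulr0.
have := dP t; rewrite /ball_ /= sub0r normrN => /(_ td t0).
rewrite /GRing.scale /= mulr1 addr0 => H.
have -> : f t - f 0 - a * t = - t * (a - t^-1 * (f t - f 0)).
  by rewrite mulrBr !mulNr opprK mulrA divff // mul1r; ring.
by rewrite normrM normrN mulrC ler_wpM2r.
Qed.

Lemma cdiff_cexp0 : cdiff cexp 0 1.
Proof.
move=> e e0.
(* The real and imaginary errors add up to [9 e1 |h|] below, and [e1 <= 1] keeps the quadratic terms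
   under control. *)
have [e1 [e10 e11 e1e]] : exists e1 : R, [/\ 0 < e1, e1 <= 1 & e1 <= e / 10].
  exists (Num.min 1 (e / 10)); split; rewrite ?ge_min ?lexx ?orbT //.
  by rewrite lt_min ltr01 divr_gt0.
have [d1 d10 H1] := @real_diff0 (@expR R) 1 (eq_ind_r (is_derive (0:R) 1 expR)
  (is_derive_expR 0) (esym (@expR0 R))) e1 e10.
have Dc : is_derive (0 : R) 1 (@cos R) 0.
  by have := is_derive_cos (0 : R); rewrite sin0 oppr0.
have Ds : is_derive (0 : R) 1 (@sin R) 1.
  by have := is_derive_sin (0 : R); rewrite cos0.
have [d2 d20 H2] := real_diff0 Dc e10.
have [d3 d30 H3] := real_diff0 Ds e10.
exists (Num.min e1 (Num.min d1 (Num.min d2 d3))); first by rewrite !lt_min e10 d10 d20 d30.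
move=> h; rewrite !lt_min => /and4P[he h1 h2 h3].
have rh := le_Re_normc h; have ih := le_Im_normc h.
have {}H1 := H1 _ (le_lt_trans rh h1).
have {}H2 := H2 _ (le_lt_trans ih h2).
have {}H3 := H3 _ (le_lt_trans ih h3).
move: rh ih H1 H2 H3; rewrite expR0 cos0 sin0 mul1r mul0r !subr0 add0r cexp0 mul1r.
move=> rh ih H1 H2 H3; rewrite mul1r.
have n0 := normc_ge0 h; apply: le_trans (normc_le_add _) _.
move: he n0 {h1 h2 h3} rh ih H1 H2 H3; set n := normc h.
case: h @n => x y; set n := normc _ => /= ne n0 rx iy.
rewrite /cexp /=; set E := expR x; set c := cos y; set s := sin y => H1 H2 H3.
rewrite !mul0r !subr0 addr0.
set t1 := E - 1 - x in H1; set t2 := c - 1 in H2; set t3 := s - y in H3.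
have -> : E * c - 1 - x = t1 + t2 * (1 + x + t1).
  by rewrite /t1 /t2; ring.
have -> : E * s - y = t3 + (x + t1) * s.
  by rewrite /t1 /t3; ring.
have b1 : `|t1| <= e1 * n by apply: le_trans H1 _; rewrite ler_wpM2l // ltW.
have b2 : `|t2| <= e1 * n by apply: le_trans H2 _; rewrite ler_wpM2l // ltW.
have b3 : `|t3| <= e1 * n by apply: le_trans H3 _; rewrite ler_wpM2l // ltW.
have bs : `|s| <= 2 * n.
  have -> : s = t3 + y by rewrite /t3 subrK.
  by apply: le_trans (ler_normD _ _) _; nra.
have bxt : `|x + t1| <= 2 * n by apply: le_trans (ler_normD _ _) _; nra.
have m1 : `|t2 * (1 + x + t1)| <= e1 * n * 3.
  rewrite normrM -addrA; apply: ler_pM => //.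
  by apply: le_trans (ler_normD _ _) _; rewrite normr1; nra.
have m2 : `|(x + t1) * s| <= 4 * e1 * n.
  rewrite normrM; apply: le_trans (ler_pM _ _ bxt bs) _ => //; nra.
apply: le_trans (lerD (ler_normD _ _) (ler_normD _ _)) _.
apply: le_trans (lerD (lerD b1 m1) (lerD b3 m2)) _.
have h9 : e1 * n <= e / 10 * n by rewrite ler_wpM2r.
have en : 0 <= e * n by rewrite mulr_ge0 // ltW.
have -> : e1 * n + e1 * n * 3 + (e1 * n + 4 * e1 * n) = 9 * (e1 * n) by ring.
by apply: le_trans (ler_wpM2l _ h9) _ => //; lra.
Qed.

Lemma entire_cexp : entire cexp.
Proof.
apply/entireP => z; exists (cexp z) => e e0.
have z0 : 0 < normc (cexp z) by rewrite normc_cexp expR_gt0.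
have [|d d0 dP] := cdiff_cexp0 (e := e / normc (cexp z)); first by rewrite divr_gt0.
exists d => // h /dP; rewrite add0r cexp0 mul1r => H.
have -> : cexp (z + h) - cexp z - cexp z * h = cexp z * (cexp h - 1 - h).
  by rewrite cexpD; ring.
by rewrite normcM mulrC -ler_pdivlMr // mulrAC.
Qed.

End Holomorphic.

(** * Integrals of continuous functions over segments *)

Section Interval.
Variable R : realType.
Local Notation lam := (@lebesgue_measure R).
Implicit Types (f g : R -> R) (a b c : R).

Definition iint f a b : R := \int[lam]_(x in `[a, b]) f x.

Lemma continuous_itv_integrable f a b : continuous f ->
  lam.-integrable `[a, b] (EFin \o f).
Proof.
move=> cf; apply: continuous_compact_integrable; first exact: segment_compact.
exact: continuous_subspaceT.
Qed.

Lemma iintB f g a b : continuous f -> continuous g ->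
  iint (fun x => f x - g x) a b = iint f a b - iint g a b.
Proof. by move=> cf cg; rewrite /iint RintegralB //; exact: continuous_itv_integrable. Qed.

Lemma iint_split f a b c : a <= b -> b <= c -> continuous f ->
  iint f a c = iint f a b + iint f b c.
Proof.
move=> ab bc cf; apply/eqP; rewrite addrC -subr_eq; apply/eqP.
rewrite /iint Rintegral_itvB //; last exact: continuous_itv_integrable.
rewrite Rintegral_itv_obnd_cbnd //.
apply: integrableS (continuous_itv_integrable b c cf) => //; exact: subset_itv_oc_cc.
Qed.

Lemma iint_cst (k : R) a b : a <= b -> iint (fun=> k) a b = k * (b - a).
Proof.
move=> ab; rewrite /iint Rintegral_cst //= lebesgue_measure_itv /= lte_fin.
move: ab; rewrite le_eqVlt => /predU1P[->|->]; last by rewrite -EFinB.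
by rewrite ltxx /= subrr.
Qed.

Lemma iint_bound f a b k M : a <= b -> continuous f ->
  (forall x, a <= x <= b -> `|f x - k| <= M) ->
  `|iint f a b - k * (b - a)| <= M * (b - a).
Proof.
move=> ab cf fk; rewrite -iint_cst // -iintB //; last by move=> ?; exact: cvg_cst.
have cfk : continuous (fun x => f x - k).
  by move=> x; apply: cvgB; [exact: cf|exact: cvg_cst].
apply: le_trans (le_normr_Rintegral _ _) _ => //.
  exact: (continuous_itv_integrable a b cfk).
rewrite -(iint_cst M ab); apply: le_Rintegral => //=.
- apply: (continuous_itv_integrable (f := fun x => `|f x - k|)) => x.
  by apply: cvg_norm; exact: cfk.
- by apply: (continuous_itv_integrable (f := fun=> M)) => x; exact: cvg_cst.
Qed.

End Interval.

(** * Goursat's theorem for rectangles *)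

Section Goursat.
Variable R : realType.
Local Notation C := R[i].
Variable Phi : C -> C.
Hypothesis ePhi : entire Phi.

Let u (x y : R) := complex.Re (Phi (x +i* y)).
Let v (x y : R) := complex.Im (Phi (x +i* y)).

Let cont2 : [/\ forall y, continuous (u^~ y), forall x, continuous (u x),
  forall y, continuous (v^~ y) & forall x, continuous (v x)].
Proof.
have [cu cv] := entire_continuous2 ePhi.
split => t s.
- exact: (cvg_comp _ (fun p => complex.Re (Phi (toC p))) (cvg_pair cvg_id (cvg_cst t)) (cu (s, t))).
- exact: (cvg_comp _ (fun p => complex.Re (Phi (toC p))) (cvg_pair (cvg_cst t) cvg_id) (cu (t, s))).
- exact: (cvg_comp _ (fun p => complex.Im (Phi (toC p))) (cvg_pair cvg_id (cvg_cst t)) (cv (s, t))).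
- exact: (cvg_comp _ (fun p => complex.Im (Phi (toC p))) (cvg_pair (cvg_cst t) cvg_id) (cv (t, s))).
Qed.

                                                                      
                                
(** The imaginary part of the contour integral of [Phi] along the positively oriented boundary of
    the rectangle [[a, b] x [c, d]]. *)
Definition bdry (a b c d : R) : R :=
  iint (fun x => v x c - v x d) a b + iint (fun y => u b y - u a y) c d.

Let cB (f g : R -> R) : continuous f -> continuous g -> continuous (fun x => f x - g x).
Proof. by move=> cf cg x; apply: cvgB; [exact: cf|exact: cg]. Qed.

Lemma bdry_split1 a m b c d : a <= m -> m <= b ->
  bdry a b c d = bdry a m c d + bdry m b c d.
Proof.
move=> am mb; have [u1 u2 v1 v2] := cont2.
rewrite /bdry (iint_split am mb); last exact: cB.
by rewrite !(iintB c d) //; ring.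
Qed.

Lemma bdry_split2 a b c m d : c <= m -> m <= d ->
  bdry a b c d = bdry a b c m + bdry a b m d.
Proof.
move=> am mb; have [u1 u2 v1 v2] := cont2.
rewrite /bdry (iint_split am mb); last exact: cB.
by rewrite !(iintB a b) //; ring.
Qed.

(** The affine part of [Phi] at [z0] contributes nothing, because its horizontal and vertical terms
    cancel by the Cauchy-Riemann equations. The remainder is small relative to the size of the
    rectangle and is integrated over sides of that size. *)
Lemma bdry_local z0 : forall e : R, 0 < e -> exists2 d : R, 0 < d &
  forall a b c k : R, a <= complex.Re z0 <= b -> c <= complex.Im z0 <= k ->
    (b - a) + (k - c) < d ->
    `|bdry a b c k| <= e * ((b - a) + (k - c)) ^+ 2.
Proof.
move=> e e0; have /entireP /(_ z0) [A PA] := ePhi.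
have [|d d0 dP] := PA (e / 4); first by rewrite divr_gt0.
exists d => // a b c k; case: z0 A PA dP => x0 y0 [al be] PA dP /= xab ycd dd.
set D := (b - a) + (k - c) in dd *.
have ab : a <= b by case/andP: xab; exact: le_trans.
have ck : c <= k by case/andP: ycd; exact: le_trans.
have D0 : 0 <= D by rewrite addr_ge0 // subr_ge0.
pose p0 := Phi (x0 +i* y0).
have near x y : a <= x <= b -> c <= y <= k ->
    `|u x y - (complex.Re p0 + (al * (x - x0) - be * (y - y0)))| <= e / 4 * D /\
    `|v x y - (complex.Im p0 + (al * (y - y0) + be * (x - x0)))| <= e / 4 * D.
  move=> xb yb; pose h := (x - x0) +i* (y - y0) : C.
  have hD : normc h <= D.
    apply: le_trans (normc_le_add _) _; rewrite /= /D; apply: lerD; rewrite ler_norml; lra.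
  have := dP h (le_lt_trans hD dd).
  have -> : (x0 +i* y0) + h = x +i* y.
    by apply/eqP; rewrite eq_complex /= !subrKC !eqxx.
  rewrite -/p0 => H; have {}H : normc (Phi (x +i* y) - p0 - (al +i* be) * h) <= e / 4 * D.
    by apply: le_trans H _; rewrite ler_wpM2l // divr_ge0 // ltW.
  split; [apply: le_trans (le_trans (le_Re_normc _) H)|apply: le_trans (le_trans (le_Im_normc _) H)];
  rewrite /u /v /h; case: (Phi _) => ? ?; case: (p0) => ? ? /=;
  rewrite le_eqVlt; apply/orP; left; apply/eqP; congr (`|_|); ring.
have [u1 u2 v1 v2] := cont2.
have B1 : `|iint (fun x => v x c - v x k) a b - al * (c - k) * (b - a)|
    <= e / 2 * D * (b - a).
  apply: iint_bound => //; first exact: cB.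
  move=> x xb.
  have [|_ H1] := near x c xb; first by rewrite lexx.
  have [|_ H2] := near x k xb; first by rewrite lexx ck.
  have -> : v x c - v x k - al * (c - k) =
    (v x c - (complex.Im p0 + (al * (c - y0) + be * (x - x0)))) -
    (v x k - (complex.Im p0 + (al * (k - y0) + be * (x - x0)))) by ring.
  apply: le_trans (ler_normB _ _) _; lra.
have B2 : `|iint (fun y => u b y - u a y) c k - al * (b - a) * (k - c)|
    <= e / 2 * D * (k - c).
  apply: iint_bound => //; first exact: cB.
  move=> y yb.
  have [|H1 _] := near b y _ yb; first by rewrite lexx ab.
  have [|H2 _] := near a y _ yb; first by rewrite lexx.
  have -> : u b y - u a y - al * (b - a) =
    (u b y - (complex.Re p0 + (al * (b - x0) - be * (y - y0)))) -
    (u a y - (complex.Re p0 + (al * (a - x0) - be * (y - y0)))) by ring.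
  apply: le_trans (ler_normB _ _) _; lra.
have -> : bdry a b c k = (iint (fun x => v x c - v x k) a b - al * (c - k) * (b - a)) +
    (iint (fun y => u b y - u a y) c k - al * (b - a) * (k - c)).
  by rewrite /bdry; ring.
apply: le_trans (ler_normD _ _) _; apply: le_trans (lerD B1 B2) _.
rewrite -mulrDr -/D expr2 mulrA; apply: ler_wpM2r => //; apply: ler_wpM2r => //; lra.
Qed.

(** Repeated quartering keeps a subrectangle whose boundary integral is at least a quarter of the
    previous one. The rectangles shrink to a point, where [bdry_local] beats the factor [4 ^ n]. *)
Lemma goursat a b c d : a <= b -> c <= d -> bdry a b c d = 0.
Proof.
move=> ab cd.
pose w n : R := (b - a) / 2 ^+ n; pose h n : R := (d - c) / 2 ^+ n.
have w0 n : 0 <= w n by rewrite divr_ge0 ?subr_ge0 // exprn_ge0.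
have h0 n : 0 <= h n by rewrite divr_ge0 ?subr_ge0 // exprn_ge0.
have wS n : w n = w n.+1 + w n.+1.
  by rewrite /w exprS; field; rewrite expf_neq0.
have hS n : h n = h n.+1 + h n.+1.
  by rewrite /h exprS; field; rewrite expf_neq0.
pose J n (q : R * R) := bdry q.1 (q.1 + w n) q.2 (q.2 + h n).
have step (nq : nat * (R * R)) : exists q' : R * R,
    [/\ nq.2.1 <= q'.1, q'.1 + w nq.1.+1 <= nq.2.1 + w nq.1,
        nq.2.2 <= q'.2, q'.2 + h nq.1.+1 <= nq.2.2 + h nq.1 &
        `|J nq.1 nq.2| <= 4 * `|J nq.1.+1 q'|].
  case: nq => n [x y] /=.
  have W := w0 n.+1; have H := h0 n.+1.
  have -> : J n (x, y) = J n.+1 (x, y) + J n.+1 (x, y + h n.+1) +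
      (J n.+1 (x + w n.+1, y) + J n.+1 (x + w n.+1, y + h n.+1)).
    rewrite /J /= (wS n) (hS n) !addrA (@bdry_split1 x (x + w n.+1)) ?lerDl //.
    by rewrite !(@bdry_split2 _ _ y (y + h n.+1) (y + h n.+1 + h n.+1)) ?lerDl // !addrA.
  rewrite (wS n) (hS n).
  set j1 := J _ (x, y); set j2 := J _ (x, _); set j3 := J _ (_, y); set j4 := J _ (_, _).
  have T : `|j1 + j2 + (j3 + j4)| <= `|j1| + `|j2| + (`|j3| + `|j4|).
    by apply: le_trans (ler_normD _ _) _; apply: lerD; exact: ler_normD.
  have [q1|q1] := leP `|j1 + j2 + (j3 + j4)| (4 * `|j1|).
    by exists (x, y); split => [||||//] /=; lra.
  have [q2|q2] := leP `|j1 + j2 + (j3 + j4)| (4 * `|j2|).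
    by exists (x, y + h n.+1); split => [||||//] /=; lra.
  have [q3|q3] := leP `|j1 + j2 + (j3 + j4)| (4 * `|j3|).
    by exists (x + w n.+1, y); split => [||||//] /=; lra.
  have [q4|q4] := leP `|j1 + j2 + (j3 + j4)| (4 * `|j4|).
    by exists (x + w n.+1, y + h n.+1); split => [||||//] /=; lra.
  lra.
have [next nextP] := boolp.choice step.
pose s := fix s n := if n is m.+1 then next (m, s m) else (a, c).
have sS n : s n.+1 = next (n, s n) by [].
have mono1 n m : (n <= m)%N -> (s n).1 <= (s m).1 /\ (s m).1 + w m <= (s n).1 + w n.
  elim: m => [|m IH]; first by rewrite leqn0 => /eqP ->.
  rewrite leq_eqVlt => /predU1P[->//|/IH[i1 i2]].
  by have [/= n1 n2 _ _ _] := nextP (m, s m); rewrite ?sS; split; lra.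
have mono2 n m : (n <= m)%N -> (s n).2 <= (s m).2 /\ (s m).2 + h m <= (s n).2 + h n.
  elim: m => [|m IH]; first by rewrite leqn0 => /eqP ->.
  rewrite leq_eqVlt => /predU1P[->//|/IH[i1 i2]].
  by have [/= _ _ n1 n2 _] := nextP (m, s m); rewrite ?sS; split; lra.
have Js n : `|bdry a b c d| <= 4 ^+ n * `|J n (s n)|.
  elim: n => [|n IH].
    by rewrite expr0 mul1r /J /= /w /h expr0 !divr1 !subrKC.
  apply: le_trans IH _; rewrite exprSr -mulrA ler_wpM2l ?exprn_ge0 //.
  by have [_ _ _ _] := nextP (n, s n).
(* Nested intervals: the supremum of the left endpoints lies in all of them. *)
have limit (t : nat -> R) (l : nat -> R) :
    (forall n m, (n <= m)%N -> t n <= t m /\ t m + l m <= t n + l n) ->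
    (forall n, 0 <= l n) -> exists x, forall n, t n <= x <= t n + l n.
  move=> tm l0; exists (sup (range t)) => n.
  have bnd m : t m <= t n + l n.
    have [nm|mn] := leqP n m.
      by have [_] := tm n m nm; apply: le_trans; rewrite lerDl.
    by have [H _] := tm m n (ltnW mn); apply: le_trans H _; rewrite lerDl.
  apply/andP; split.
    apply: ub_le_sup; last by exists n.
    by exists (t n + l n) => _ [m _ <-].
  apply: sup_le_ub; first by exists (t 0%N); exists 0%N.
  by move=> _ [m _ <-].
have [x0 x0P] := limit _ _ mono1 w0.
have [y0 y0P] := limit _ _ mono2 h0.
apply/eqP; rewrite -normr_le0; apply/ler_addgt0Pr => e e0; rewrite add0r.
pose S := (b - a) + (d - c); have S0 : 0 <= S by rewrite addr_ge0 // subr_ge0.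
have [|dl dl0 dlP] := @bdry_local (x0 +i* y0) (e / (S ^+ 2 + 1)).
  by rewrite divr_gt0 // ltr_wpDl // sqr_ge0.
pose n := Num.truncn (S / dl).
have pn : S / 2 ^+ n < dl.
  rewrite ltr_pdivrMr ?exprn_gt0 // mulrC -ltr_pdivrMr //.
  apply: lt_le_trans (truncnS_gt _) _; rewrite -/n -natrX ler_nat; exact: ltn_expl.
have whn : (s n).1 + w n - (s n).1 + ((s n).2 + h n - (s n).2) = S / 2 ^+ n.
  by rewrite /w /h /S; ring.
apply: le_trans (Js n) _.
have := dlP (s n).1 ((s n).1 + w n) (s n).2 ((s n).2 + h n) (x0P n) (y0P n).
rewrite whn => /(_ pn) H.
apply: le_trans (ler_wpM2l _ H) _; first exact: exprn_ge0.
have -> : 4 ^+ n * (e / (S ^+ 2 + 1) * (S / 2 ^+ n) ^+ 2) = e * (S ^+ 2 / (S ^+ 2 + 1)).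
  have -> : (4 : R) = 2 * 2 by ring.
  have S2 : S ^+ 2 + 1 != 0 by rewrite gt_eqF // ltr_wpDl // sqr_ge0.
  have p2 : (2 : R) ^+ n != 0 by rewrite expf_neq0.
  rewrite exprMn expr_div_n; move: S2 p2; move: (S ^+ 2) (2 ^+ n) => X Y X0 Y0.
  by field; rewrite X0 Y0.
rewrite ler_piMr ?(ltW e0) // ler_pdivrMr ?ltr_wpDl ?sqr_ge0 // mul1r lerDl //.
Qed.

End Goursat.

(** * The mean value property on circles *)

Section MeanValue.
Variable R : realType.
Local Notation C := R[i].

Definition cis (t : R) : C := cos t +i* sin t.

Lemma cexp_real_im (x y : R) : cexp (x +i* y) = (expR x)%:C * cis y.
Proof. by []. Qed.

Lemma normc_cis t : normc (cis t) = 1.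
Proof. by rewrite /= cos2Dsin2 sqrtr1. Qed.

(** In logarithmic coordinates the circle becomes a vertical segment of length [2 pi]. Goursat
    applied to [F (cexp w * z)] shows that the integral over the segment does not depend on its
    abscissa, and far to the left the integrand is close to [F 0]. *)
Lemma mean_value_Re (F : C -> C) (z : C) : entire F ->
  iint (fun t => complex.Re (F (cis t * z))) 0 (pi *+ 2) =
  complex.Re (F 0) * (pi *+ 2).
Proof.
move=> eF; pose Phi w := F (cexp w * z).
have ePhi : entire Phi.
  apply: (entire_comp eF); apply: (entireM (@entire_cexp R) (@entire_cst _ z)).
pose u (x y : R) := complex.Re (Phi (x +i* y)).
have cu x : continuous (u x).
  move=> y; have [cu _] := entire_continuous2 ePhi.
  exact: (cvg_comp _ (fun p => complex.Re (Phi (toC p))) (cvg_pair (cvg_cst x) cvg_id) (cu (x, y))).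
have pi0 : 0 <= pi *+ 2 :> R by rewrite mulrn_wge0 // pi_ge0.
have const a : a <= 0 -> iint (u a) 0 (pi *+ 2) = iint (u 0) 0 (pi *+ 2).
  move=> a0; have := goursat ePhi a0 pi0; rewrite /bdry.
  (* The two horizontal sides cancel by the period [2 pi i] of the exponential. *)
  have -> : iint (fun x => complex.Im (Phi (x +i* 0)) -
      complex.Im (Phi (x +i* (pi *+ 2)))) a 0 = 0.
    rewrite (_ : (fun x => _) = (fun=> 0)); first by rewrite iint_cst // mul0r.
    apply/funext => x; rewrite /Phi !cexp_real_im /cis cos2pi sin2pi cos0 sin0.
    exact: subrr.
  by rewrite add0r (iintB _ _ (cu _) (cu _)) => /eqP; rewrite subr_eq0 => /eqP <-.
have -> : (fun t => complex.Re (F (cis t * z))) = u 0.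
  by apply/funext => t; rewrite /u /Phi cexp_real_im expR0 mul1r.
apply/eqP; rewrite -subr_eq0 -normr_le0; apply/ler_addgt0Pr => e e0; rewrite add0r.
have /entireP /(_ 0) [A FA] := eF.
have [|d d0 dP] := cdiff_cont FA (e := e / (pi *+ 2)).
  by rewrite divr_gt0 // mulrn_wgt0 // pi_gt0.
have z1 : 0 < normc z + 1 by rewrite ltr_wpDl // normc_ge0.
(* The radius factor [t] keeps [t * cis y * z] within distance [d] of the origin; the abscissa used
   is [ln t], which is nonpositive since [t <= 1]. *)
pose t := Num.min 1 (d / (normc z + 1)).
have t0 : 0 < t by rewrite lt_min ltr01 divr_gt0.
have lt0 : ln t <= 0 by rewrite ln_le0 // ge_min lexx.
rewrite -(const _ lt0).
have -> : e = e / (pi *+ 2) * (pi *+ 2 - 0).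
  by rewrite subr0 divfK // mulrn_eq0 /= gt_eqF // pi_gt0.
rewrite -[X in _ - _ * X]subr0; apply: iint_bound => // y _.
rewrite /u /Phi cexp_real_im lnK ?posrE //.
have := dP (t%:C * cis y * z); rewrite add0r => H.
have /H h : normc (t%:C * cis y * z) < d.
  rewrite !normcM normc_cis mulr1 normc_real ger0_norm ?(ltW t0) //.
  apply: (@le_lt_trans _ _ (d / (normc z + 1) * normc z)).
    by rewrite ler_wpM2r ?normc_ge0 // ge_min lexx orbT.
  by rewrite mulrAC ltr_pdivrMr // ltr_pM2l // ltrDl.
apply: le_trans (ltW h); apply: le_trans (le_Re_normc _).
by case: (F _) => ? ?; case: (F 0).
Qed.

Lemma mean_value_Im (F : C -> C) (z : C) : entire F ->
  iint (fun t => complex.Im (F (cis t * z))) 0 (pi *+ 2) =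
  complex.Im (F 0) * (pi *+ 2).
Proof.
move=> eF; have E (w : C) : complex.Im w = complex.Re (- 'i%C * w).
  by case: w => a b /=; ring.
rewrite E -(mean_value_Re z (entireZ (a := - 'i%C) eF)).
by congr iint; apply/funext => t; rewrite E.
Qed.

End MeanValue.

                       

(** * Complex integrals and the weighted [L2] space *)

Section ComplexIntegral.
Variable R : realType.
Local Notation C := R[i].
Local Notation mu2 := (@leb2 R).
Local Notation Pl := (plane R).
Local Notation Re := (@complex.Re R).
Local Notation Im := (@complex.Im R).
Implicit Types (F G H : C -> C) (a : C).

Definition plane_integrable (f : Pl -> R) := mu2.-integrable setT (fun p : Pl => (f p)%:E).

Lemma plane_integrable_le (f g : Pl -> R) : measurable_fun setT f -> plane_integrable g ->
  (forall p, `|f p| <= g p) -> plane_integrable f.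
Proof.
move=> mf ig fg; apply: (@le_integrable _ _ _ mu2 setT measurableT _ _ _ _ ig).
  exact/measurable_EFinP.
by move=> p _; rewrite /= lee_fin; apply: le_trans (fg p) _; exact: ler_norm.
Qed.

Lemma plane_integrableZ (k : R) (f : Pl -> R) : plane_integrable f -> plane_integrable (fun p => k * f p).
Proof. by move=> fi; exact: (integrableZl measurableT k fi). Qed.

Lemma plane_integrableD (f g : Pl -> R) : plane_integrable f -> plane_integrable g ->
  plane_integrable (fun p => f p + g p).
Proof. by move=> fi gi; exact: (integrableD measurableT fi gi). Qed.

Lemma plane_integrable_eq (f g : Pl -> R) : (forall p, f p = g p) -> plane_integrable f -> plane_integrable g.
Proof. by move=> /funext ->. Qed.

Definition cintegrable F := plane_integrable (fun p => Re (F (toC p))) /\ plane_integrable (fun p => Im (F (toC p))).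

Lemma ReM (z w : C) : Re (z * w) = Re z * Re w - Im z * Im w.
Proof. by case: z => ? ?; case: w. Qed.
Lemma ImM (z w : C) : Im (z * w) = Re z * Im w + Im z * Re w.
Proof. by case: z => ? ?; case: w. Qed.
Lemma ReD (z w : C) : Re (z + w) = Re z + Re w.
Proof. by case: z => ? ?; case: w. Qed.
Lemma ImD (z w : C) : Im (z + w) = Im z + Im w.
Proof. by case: z => ? ?; case: w. Qed.
Lemma ReJ (z : C) : Re (conjc z) = Re z. Proof. by case: z. Qed.
Lemma ImJ (z : C) : Im (conjc z) = - Im z. Proof. by case: z. Qed.

Lemma conjcM (z w : C) : conjc (z * w) = conjc z * conjc w.
Proof. exact: rmorphM. Qed.

Lemma complex_ext (z w : C) : Re z = Re w -> Im z = Im w -> z = w.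
Proof. by case: z => ? ?; case: w => ? ? /= -> ->. Qed.

Section Measurability.
Context d (T : measurableType d).
Implicit Types f g : T -> C.

Definition cmeas f :=
  measurable_fun setT (fun x => Re (f x)) /\ measurable_fun setT (fun x => Im (f x)).

Lemma cmeas_cst a : cmeas (fun=> a). Proof. by split; exact: measurable_cst. Qed.

Lemma cmeasD f g : cmeas f -> cmeas g -> cmeas (fun x => f x + g x).
Proof.
move=> [f1 f2] [g1 g2]; split.
  by under eq_fun do rewrite ReD; exact: measurable_funD.
by under eq_fun do rewrite ImD; exact: measurable_funD.
Qed.

Lemma cmeasM f g : cmeas f -> cmeas g -> cmeas (fun x => f x * g x).
Proof.
move=> [f1 f2] [g1 g2]; split.
  by under eq_fun do rewrite ReM; apply: measurable_funB; exact: measurable_funM.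
by under eq_fun do rewrite ImM; apply: measurable_funD; exact: measurable_funM.
Qed.

Lemma cmeasJ f : cmeas f -> cmeas (fun x => conjc (f x)).
Proof.
move=> [f1 f2]; split; first by under eq_fun do rewrite ReJ.
by under eq_fun do rewrite ImJ; exact: measurable_funN.
Qed.

Lemma cmeas_real (r : T -> R) : measurable_fun setT r -> cmeas (fun x => (r x)%:C).
Proof. by move=> mr; split => //=; exact: measurable_cst. Qed.

Lemma cmeas_toC f : cmeas f <->
  measurable_fun setT (fun x => (Re (f x), Im (f x)) : R * R).
Proof.
split=> [[f1 f2]|m]; first exact: measurable_fun_pair.
by split; [exact: (measurableT_comp measurable_fst m)|exact: (measurableT_comp measurable_snd m)].
Qed.

Lemma cmeas_normc2 f : cmeas f -> measurable_fun setT (fun x => normc (f x) ^+ 2).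
Proof.
move=> [f1 f2]; under eq_fun do rewrite normc_sq !expr2.
by apply: measurable_funD; exact: measurable_funM.
Qed.

End Measurability.

Lemma cmeas_entire F : entire F -> cmeas (fun p : R * R => F (toC p)).
Proof. by move=> /entire_continuous2[c1 c2]; split; exact: continuous2_measurable. Qed.

Definition plane_cmeas F := cmeas (fun p : Pl => F (toC p)).

Lemma cmeas_borel F : cmeas (fun p : R * R => F (toC p)) -> plane_cmeas F.
Proof. by move=> [m1 m2]; split; exact: borel_plane_fun. Qed.

Lemma plane_cmeas_indic (O : set C) : lebesgue_measurable O -> plane_cmeas (fun z => \1_O z).
Proof.
move=> mO; rewrite (_ : (fun z => _) = (fun z => ((\1_O z : R))%:C)).
  apply: cmeas_real; rewrite (_ : (fun p => _) = \1_(@toC R @^-1` O)).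
    exact: measurable_indic.
  by apply/funext => p; rewrite !indicE; congr (nat_of_bool _)%:R; apply/idP/idP;
     rewrite !inE.
by apply/funext => z; rewrite !indicE; case: (_ \in _).
Qed.

Lemma cintegrable_dom F (g : C -> R) : plane_cmeas F -> plane_integrable (fun p => g (toC p)) ->
  (forall z, normc (F z) <= g z) -> cintegrable F.
Proof.
move=> [f1 f2] ig Fg; split.
  by apply: (plane_integrable_le f1 ig) => p; exact: le_trans (le_Re_normc _) (Fg _).
by apply: (plane_integrable_le f2 ig) => p; exact: le_trans (le_Im_normc _) (Fg _).
Qed.

Lemma cintegrable_lin a F G : cintegrable F -> cintegrable G ->
  cintegrable (fun z => a * F z + G z) /\
  integralC (fun z => a * F z + G z) = a * integralC F + integralC G.
Proof.
move=> [f1 f2] [g1 g2].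
have ER : (fun p : Pl => Re (a * F (toC p) + G (toC p))) =
    (fun p => (Re a * Re (F (toC p)) + (- Im a) * Im (F (toC p))) + Re (G (toC p))).
  by apply/funext => p; rewrite ReD ReM mulNr.
have EI : (fun p : Pl => Im (a * F (toC p) + G (toC p))) =
    (fun p => (Re a * Im (F (toC p)) + Im a * Re (F (toC p))) + Im (G (toC p))).
  by apply/funext => p; rewrite ImD ImM.
have i1 := plane_integrableD (plane_integrableZ (Re a) f1) (plane_integrableZ (- Im a) f2).
have i2 := plane_integrableD (plane_integrableZ (Re a) f2) (plane_integrableZ (Im a) f1).
split.
  by split; [rewrite ER; exact: plane_integrableD|rewrite EI; exact: plane_integrableD].
rewrite /integralC; apply: complex_ext.
  rewrite [LHS]/= ER ReD ReM /=.
  rewrite (RintegralD measurableT i1 g1) (RintegralD measurableT (plane_integrableZ _ f1) (plane_integrableZ _ f2)).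
  by rewrite (RintegralZl _ measurableT f1) (RintegralZl _ measurableT f2) mulNr.
rewrite [LHS]/= EI ImD ImM /=.
rewrite (RintegralD measurableT i2 g2) (RintegralD measurableT (plane_integrableZ _ f2) (plane_integrableZ _ f1)).
by rewrite (RintegralZl _ measurableT f1) (RintegralZl _ measurableT f2).
Qed.

Lemma cintegrableZ a F : cintegrable F -> cintegrable (fun z => a * F z) /\
  integralC (fun z => a * F z) = a * integralC F.
Proof.
move=> iF.
have i0 : cintegrable (fun=> 0) by split; exact: (integrable0 mu2).
have [iaF aF] := cintegrable_lin a iF i0.
have I0 : integralC (fun=> 0) = 0 :> C.
  by rewrite /integralC /= /Rintegral integral0.
by move: iaF aF; rewrite I0 addr0; under eq_fun do rewrite addr0.
Qed.

Lemma cintegrable_J F : cintegrable F -> cintegrable (fun z => conjc (F z)) /\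
  integralC (fun z => conjc (F z)) = conjc (integralC F).
Proof.
move=> [f1 f2].
have EI : (fun p : Pl => Im (conjc (F (toC p)))) = (fun p => (-1) * Im (F (toC p))).
  by apply/funext => p; rewrite ImJ mulN1r.
have ER : (fun p : Pl => Re (conjc (F (toC p)))) = (fun p => Re (F (toC p))).
  by apply/funext => p; rewrite ReJ.
split; first by split; [rewrite ER|rewrite EI; exact: plane_integrableZ].
rewrite /integralC; apply: complex_ext; first by rewrite ReJ [LHS]/= ER.
by rewrite ImJ [LHS]/= EI (RintegralZl _ measurableT f2) mulN1r.
Qed.

Local Notation w := (@gauss_weight R).

Lemma gauss_weightE p : w (toC p) = expR (- pisq p).
Proof. by rewrite /gauss_weight normc_sq. Qed.

Lemma gauss_weight_gt0 z : 0 < w z. Proof. exact: expR_gt0. Qed.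

Lemma borel_gauss : measurable_fun setT (fun p : R * R => w (toC p)).
Proof.
under eq_fun do rewrite gauss_weightE.
apply: continuous2_measurable => p.
apply: (continuous_comp (f := fun p : R * R => - pisq p)); last exact: continuous_expR.
by apply: cvgN; exact: continuous_pisq.
Qed.

Lemma measurable_gauss : measurable_fun setT (fun p : Pl => w (toC p)).
Proof. exact: borel_plane_fun borel_gauss. Qed.

Definition L2 F := plane_cmeas F /\ (sqnorm F < +oo)%E.

Definition nrm2 F : R := fine (sqnorm F).

Lemma measurable_sqn F : plane_cmeas F ->
  measurable_fun setT (fun p : Pl => normc (F (toC p)) ^+ 2 * w (toC p)).
Proof. by move=> mF; apply: measurable_funM measurable_gauss; exact: cmeas_normc2. Qed.

Lemma sqn_ge0 F z : 0 <= normc (F z) ^+ 2 * w z.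
Proof. by rewrite mulr_ge0 ?sqr_ge0 // ltW // gauss_weight_gt0. Qed.

Lemma L2P F : L2 F <-> plane_cmeas F /\ plane_integrable (fun p => normc (F (toC p)) ^+ 2 * w (toC p)).
Proof.
have E : (\int[mu2]_p `|(normc (F (toC p)) ^+ 2 * w (toC p))%:E| = sqnorm F)%E.
  by apply: eq_integral => p _; rewrite /= ger0_norm ?sqn_ge0.
split => -[mF h]; split => //.
  by apply/integrableP; split; [exact/measurable_EFinP/measurable_sqn|rewrite E].
by move/integrableP : h => [_]; rewrite E.
Qed.

Lemma sqnorm_ge0 F : (0 <= sqnorm F)%E.
Proof. by apply: integral_ge0 => p _; rewrite lee_fin sqn_ge0. Qed.

Lemma nrm2_ge0 F : 0 <= nrm2 F. Proof. by apply: fine_ge0; exact: sqnorm_ge0. Qed.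

Lemma nrm2E F : L2 F -> sqnorm F = (nrm2 F)%:E.
Proof. by move=> [_ h]; rewrite fineK // ge0_fin_numE // sqnorm_ge0. Qed.

Lemma inner_cintegrable F G : L2 F -> L2 G -> cintegrable (fun z => F z * conjc (G z) * (w z)%:C).
Proof.
move=> /L2P[mF iF] /L2P[mG iG].
apply: (cintegrable_dom (g := fun z => normc (F z) ^+ 2 * w z + normc (G z) ^+ 2 * w z)).
- exact: (cmeasM (cmeasM mF (cmeasJ mG)) (cmeas_real measurable_gauss)).
- exact: plane_integrableD.
- move=> z; rewrite !normcM normc_conj normc_real ger0_norm ?(ltW (gauss_weight_gt0 _)) //.
  rewrite -mulrDl ler_wpM2r ?(ltW (gauss_weight_gt0 _)) //.
  have := sqr_ge0 (normc (F z) - normc (G z)); have := normc_ge0 (F z); have := normc_ge0 (G z); nra.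
Qed.

Lemma L2_lin a F G : L2 F -> L2 G -> L2 (fun z => a * F z + G z).
Proof.
move=> /L2P[mF iF] /L2P[mG iG]; apply/L2P.
have mH : plane_cmeas (fun z => a * F z + G z).
  by apply: cmeasD mG; apply: cmeasM mF; exact: cmeas_cst.
split => //.
have i2 := plane_integrableD (plane_integrableZ (2 * normc a ^+ 2) iF) (plane_integrableZ 2 iG).
apply: (plane_integrable_le (measurable_sqn mH) i2) => p.
rewrite ger0_norm ?(sqn_ge0 (fun z => a * F z + G z)) //.
rewrite !mulrA -mulrDl ler_wpM2r ?(ltW (gauss_weight_gt0 _)) //.
have := le_normcD (a * F (toC p)) (G (toC p)); rewrite normcM.
have := normc_ge0 (a * F (toC p) + G (toC p)).
move: (normc _) (normc a) (normc (F _)) (normc (G _)) => s x y t s0 st.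
apply: (@le_trans _ _ ((x * y + t) ^+ 2)); first by rewrite ler_sqr ?nnegrE // (le_trans s0).
have := sqr_ge0 (x * y - t); nra.
Qed.

Lemma L2_0 : L2 (fun=> 0).
Proof.
split; first exact: cmeas_cst.
by rewrite /sqnorm integral0_eq // => p _; rewrite normc0 expr0n mul0r.
Qed.

Lemma L2_eq F G : (forall z, F z = G z) -> L2 F -> L2 G.
Proof. by move=> /funext ->. Qed.

Lemma L2Z a F : L2 F -> L2 (fun z => a * F z).
Proof.
by move=> h; apply: L2_eq (L2_lin a h L2_0) => z; rewrite addr0.
Qed.

Lemma L2B F G : L2 F -> L2 G -> L2 (fun z => F z - G z).
Proof. by move=> f g; apply: L2_eq (L2_lin (-1) g f) => z; rewrite mulN1r addrC. Qed.

Lemma L2_sum (I : Type) (r : seq I) (c : I -> C) (F : I -> C -> C) :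
  (forall i, L2 (F i)) -> L2 (fun z => \sum_(i <- r) c i * F i z).
Proof.
move=> h; elim: r => [|i r IH].
  by apply: L2_eq L2_0 => z; rewrite big_nil.
by apply: L2_eq (L2_lin (c i) (h i) IH) => z; rewrite big_cons.
Qed.

Lemma L2_indic (O : set C) F : lebesgue_measurable O -> L2 F -> L2 (fun z => \1_O z * F z).
Proof.
move=> mO /L2P[mF iF]; apply/L2P; have mH : plane_cmeas (fun z => \1_O z * F z).
  exact: (cmeasM (plane_cmeas_indic mO) mF).
split => //; apply: (plane_integrable_le (measurable_sqn mH) iF) => p.
rewrite ger0_norm ?(sqn_ge0 (fun z => \1_O z * F z)) //.
rewrite ler_wpM2r ?(ltW (gauss_weight_gt0 _)) // normcM exprMn indicE.
by case: (_ \in _); rewrite ?normc1 ?normc0 ?expr1n ?mul1r // expr0n mul0r sqr_ge0.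
Qed.

Lemma inner_eql F G H : (forall z, F z = G z) -> inner F H = inner G H.
Proof. by move=> /funext ->. Qed.

Lemma inner_linl a F G H : L2 F -> L2 G -> L2 H ->
  inner (fun z => a * F z + G z) H = a * inner F H + inner G H.
Proof.
move=> f g h; rewrite /inner -(cintegrable_lin a (inner_cintegrable f h) (inner_cintegrable g h)).2.
by apply: congr1; apply/funext => z; ring.
Qed.

Lemma inner0l H : L2 H -> inner (fun=> 0) H = 0.
Proof.
move=> h; have := inner_linl 1 L2_0 L2_0 h.
rewrite (_ : (fun z => _) = (fun=> 0)); last by apply/funext => z; rewrite mulr0 addr0.
by rewrite mul1r => /eqP; rewrite -subr_eq subrr eq_sym => /eqP.
Qed.

Lemma innerZl a F H : L2 F -> L2 H -> inner (fun z => a * F z) H = a * inner F H.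
Proof.
move=> f h; have := inner_linl a f L2_0 h.
by rewrite inner0l // addr0 => <-; apply: inner_eql => z; rewrite addr0.
Qed.

Lemma innerBl F G H : L2 F -> L2 G -> L2 H ->
  inner (fun z => F z - G z) H = inner F H - inner G H.
Proof.
move=> f g h; have := inner_linl (-1) g f h.
by rewrite mulN1r addrC => <-; apply: inner_eql => z; rewrite mulN1r addrC.
Qed.

Lemma inner_suml (I : Type) (r : seq I) (c : I -> C) (F : I -> C -> C) H :
  (forall i, L2 (F i)) -> L2 H ->
  inner (fun z => \sum_(i <- r) c i * F i z) H = \sum_(i <- r) c i * inner (F i) H.
Proof.
move=> f h; elim: r => [|i r IH].
  by rewrite big_nil -[RHS](inner0l h); apply: inner_eql => z; rewrite big_nil.
rewrite big_cons -IH -(inner_linl (c i) (f i) (L2_sum r c f) h).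
by apply: inner_eql => z; rewrite big_cons.
Qed.

Lemma innerJ F G : L2 F -> L2 G -> inner G F = conjc (inner F G).
Proof.
move=> f g; rewrite /inner -(cintegrable_J (inner_cintegrable f g)).2; apply: congr1; apply/funext => z.
by rewrite !conjcM conjcK conjc_real (mulrC (conjc _)).
Qed.

Lemma inner_sqnorm F : L2 F -> inner F F = (nrm2 F)%:C.
Proof.
move=> f; rewrite /inner.
have E z : F z * conjc (F z) * (w z)%:C = (normc (F z) ^+ 2 * w z)%:C.
  by rewrite -normc_sqE -rmorphM.
rewrite (_ : (fun z => _) = (fun z => (normc (F z) ^+ 2 * w z)%:C)); last exact/funext.
rewrite /integralC; apply: complex_ext => //=.
by rewrite /Rintegral integral0_eq.
Qed.

Lemma bessel_ineq (I : finType) (e : I -> C -> C) F :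
  (forall i, L2 (e i)) -> (forall i j, inner (e i) (e j) = (i == j)%:R) -> L2 F ->
  \sum_i normc (inner F (e i)) ^+ 2 <= nrm2 F.
Proof.
move=> le oe f; pose c i := inner F (e i).
pose P z := \sum_i c i * e i z.
have lP : L2 P by exact: L2_sum.
have lG : L2 (fun z => F z - P z) by exact: L2B.
have Pe i : inner P (e i) = c i.
  rewrite inner_suml // (bigD1 i) //= oe eqxx mulr1 big1 ?addr0 // => j ji.
  by rewrite oe (negPf ji) mulr0.
have Ge i : inner (e i) (fun z => F z - P z) = 0.
  by rewrite innerJ // innerBl // Pe subrr conjc0.
have : (nrm2 (fun z => F z - P z))%:C = (nrm2 F - \sum_i normc (c i) ^+ 2)%:C.
  rewrite -inner_sqnorm // innerBl //.
  have -> : inner P (fun z => F z - P z) = 0.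
    by rewrite inner_suml // big1 // => i _; rewrite Ge mulr0.
  have -> : inner F (fun z => F z - P z) = conjc (inner F F - inner P F).
    by rewrite innerJ // innerBl.
  have -> : inner P F = (\sum_i normc (c i) ^+ 2)%:C.
    rewrite inner_suml // rmorph_sum; apply: eq_bigr => i _.
    by rewrite (innerJ f (le i)) -/(c i); exact: (esym (normc_sqE (c i))).
  by rewrite subr0 inner_sqnorm // -rmorphB conjc_real.
by move=> /complexI E; rewrite -subr_ge0 -E nrm2_ge0.
Qed.

End ComplexIntegral.

(** * Measure-preserving maps and the orthogonality of monomials *)

Section Invariance.
Variable R : realType.
Local Notation C := R[i].
Local Notation mu2 := (@leb2 R).
Local Notation Pl := (plane R).
Local Notation Re := (@complex.Re R).
Local Notation Im := (@complex.Im R).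
Local Notation borel2 := ((@lebesgue_measure R) \x (@lebesgue_measure R))%E.

Section Transformation.
Variable tau : R * R -> R * R.
Hypothesis mtau : measurable_fun setT tau.
Hypothesis tau_inv : forall f : R * R -> \bar R, measurable_fun setT f ->
  (forall p, (0 <= f p)%E) -> (\int[borel2]_p f (tau p) = \int[borel2]_p f p)%E.

Lemma ge0_integral_tau (f : R * R -> \bar R) : measurable_fun setT f ->
  (forall p, (0 <= f p)%E) -> (\int[mu2]_p f (tau p) = \int[mu2]_p f p)%E.
Proof.
move=> mf f0; rewrite !ge0_integral_leb2 //; first exact: tau_inv.
exact: (measurableT_comp mf mtau).
Qed.

Lemma integral_tau (f : R * R -> \bar R) : measurable_fun setT f ->
  (\int[mu2]_p f (tau p) = \int[mu2]_p f p)%E.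
Proof.
move=> mf; rewrite integralE [RHS]integralE; congr (_ - _)%E.
  apply: etrans (ge0_integral_tau (measurable_funepos mf) (funepos_ge0 f)).
  by apply: eq_integral => p _; rewrite !funeposE.
apply: etrans (ge0_integral_tau (measurable_funeneg mf) (funeneg_ge0 f)).
by apply: eq_integral => p _; rewrite !funenegE.
Qed.

Lemma plane_integrable_tau (f : R * R -> R) : measurable_fun setT f ->
  plane_integrable f -> plane_integrable (fun p : Pl => f (tau p)).
Proof.
move=> mf /integrableP[_ fi]; apply/integrableP; split.
  by apply/measurable_EFinP; apply: borel_plane_fun; exact: (measurableT_comp mf mtau).
rewrite (ge0_integral_tau (f := fun p => `|(f p)%:E|%E)) //.
by apply: measurableT_comp => //; exact/measurable_EFinP.
Qed.

Variable sigma : C -> C.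
Hypothesis sigmaE : forall p, toC (tau p) = sigma (toC p).

Lemma cintegrable_tau (F : C -> C) : cmeas (fun p : R * R => F (toC p)) ->
  cintegrable F -> cintegrable (fun z => F (sigma z)).
Proof.
move=> [m1 m2] [i1 i2]; split.
  by apply: plane_integrable_eq (plane_integrable_tau m1 i1) => p; rewrite sigmaE.
by apply: plane_integrable_eq (plane_integrable_tau m2 i2) => p; rewrite sigmaE.
Qed.

Lemma integralC_tau (F : C -> C) : cmeas (fun p : R * R => F (toC p)) ->
  integralC (fun z => F (sigma z)) = integralC F.
Proof.
move=> [m1 m2]; rewrite /integralC; congr (_ +i* _).
  rewrite /Rintegral -(integral_tau (f := fun p => (Re (F (toC p)))%:E)); last exact/measurable_EFinP.
  by congr fine; apply: eq_integral => p _; rewrite sigmaE.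
rewrite /Rintegral -(integral_tau (f := fun p => (Im (F (toC p)))%:E)); last exact/measurable_EFinP.
by congr fine; apply: eq_integral => p _; rewrite sigmaE.
Qed.

End Transformation.

Lemma toC_rot c s p : toC (rotp c s p) = (c +i* s) * toC p :> C.
Proof. by case: p => x y; apply: complex_ext; rewrite /toC /rotp /=; ring. Qed.

Lemma integralC_rot (F : C -> C) t : cmeas (fun p : R * R => F (toC p)) ->
  integralC (fun z => F (cis t * z)) = integralC F.
Proof.
apply: (integralC_tau (measurable_rotp (cos t) (sin t))); last exact: toC_rot.
by move=> f mf f0; apply: ge0_integral_rot => //; exact: cos2Dsin2.
Qed.

Definition trans (c : C) (p : R * R) : R * R := (p.1 + Re c, p.2 + Im c).

Lemma measurable_trans c : measurable_fun setT (trans c).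
Proof. by apply: measurable_fun_pair; exact: measurable_funD. Qed.

Lemma toC_trans c p : toC (trans c p) = toC p + c :> C.
Proof. by case: c. Qed.

Lemma trans_inv c (f : R * R -> \bar R) : measurable_fun setT f ->
  (forall p, (0 <= f p)%E) -> (\int[borel2]_p f (trans c p) = \int[borel2]_p f p)%E.
Proof. exact: ge0_integral_translate. Qed.

Lemma integralC_trans (F : C -> C) c : cmeas (fun p : R * R => F (toC p)) ->
  integralC (fun z => F (z + c)) = integralC F.
Proof.
exact: (integralC_tau (measurable_trans c) (@trans_inv c) (toC_trans c)).
Qed.

Lemma cintegrable_trans (F : C -> C) c : cmeas (fun p : R * R => F (toC p)) ->
  cintegrable F -> cintegrable (fun z => F (z + c)).
Proof.
exact: (cintegrable_tau (measurable_trans c) (@trans_inv c) (toC_trans c)).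
Qed.

Lemma cisD s t : cis (s + t) = cis s * cis t :> C.
Proof. by rewrite /cis cosD sinD; apply: complex_ext => /=; ring. Qed.

Lemma cisX t n : cis t ^+ n = cis (t *+ n) :> C.
Proof.
elim: n => [|n IH]; first by rewrite expr0 mulr0n /cis cos0 sin0.
by rewrite exprS IH mulrS cisD.
Qed.

Lemma cisJ t : cis t * conjc (cis t) = 1 :> C.
Proof. by rewrite -normc_sqE normc_cis expr1n. Qed.

                                                                
(** Rotation by [pi / |i - j|] fixes the radial factor and multiplies the integrand by [-1], so the
    integral equals its opposite. *)
Lemma monomial_orth (chi : R -> R) (i j : nat) : measurable_fun setT chi -> i != j ->
  cintegrable (fun z => z ^+ i * conjc (z ^+ j) * (chi (pi * normc z ^+ 2))%:C) ->
  integralC (fun z => z ^+ i * conjc (z ^+ j) * (chi (pi * normc z ^+ 2))%:C) = 0.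
Proof.
move=> mchi ij; set F := fun z => _ => iF.
have mF : cmeas (fun p : R * R => F (toC p)).
  apply: cmeasM.
    apply: cmeasM; first exact: (cmeas_entire (@entire_exp R i)).
    exact: (cmeasJ (cmeas_entire (@entire_exp R j))).
  apply: cmeas_real; rewrite (_ : (fun p => _) = chi \o @pisq R).
    exact: (measurableT_comp mchi (@measurable_pisq R)).
  by apply/funext => p; rewrite [RHS]/= /pisq normc_sq.
pose d := (maxn i j - minn i j)%N; pose t : R := pi / d%:R.
have d0 : (d%:R : R) != 0.
  by rewrite pnatr_eq0 /d; move/eqP: ij; lia.
have cd : cis t ^+ d = -1 :> C.
  rewrite cisX -mulr_natr /t divfK // /cis cospi sinpi.
  by apply: complex_ext; rewrite //= oppr0.
have key : cis t ^+ i * conjc (cis t ^+ j) = -1 :> C.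
  have cJ n : cis t ^+ n * conjc (cis t ^+ n) = 1 :> C by rewrite cisX cisJ.
  have cJ' n : conjc (cis t ^+ n) * cis t ^+ n = 1 :> C by rewrite mulrC.
  move: ij; rewrite neq_ltn => /orP[lt|lt].
    have E : (j = d + i)%N by rewrite /d; lia.
    rewrite [in X in _ * X]E exprD conjcM mulrC -mulrA cJ' mulr1 cd.
    by apply: complex_ext => /=; rewrite ?oppr0.
  have E : (i = d + j)%N by rewrite /d; lia.
  by rewrite [in X in X * _]E exprD -mulrA cJ mulr1 cd.
have E z : F (cis t * z) = -1 * F z.
  rewrite /F -key !exprMn conjcM normcM normc_cis mul1r; ring.
have := integralC_rot t mF.
rewrite (_ : (fun z => F (cis t * z)) = (fun z => -1 * F z)); last exact/funext.
rewrite (cintegrableZ (-1) iF).2 mulN1r => /eqP; rewrite eq_sym -addr_eq0 -mulr2n mulrn_eq0 /=.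
by move=> /eqP.
Qed.

Lemma monomial_orthZ (chi : R -> R) (x y : R) (i j : nat) : measurable_fun setT chi -> i != j ->
  x != 0 -> y != 0 ->
  cintegrable (fun z => x%:C * z ^+ i * conjc (y%:C * z ^+ j) * (chi (pi * normc z ^+ 2))%:C) ->
  integralC (fun z => x%:C * z ^+ i * conjc (y%:C * z ^+ j) * (chi (pi * normc z ^+ 2))%:C) = 0.
Proof.
move=> mchi ij x0 y0 iF.
have xy : (x * y)%:C != 0 :> C by rewrite eq_complex /= eqxx andbT mulf_neq0.
have E z : x%:C * z ^+ i * conjc (y%:C * z ^+ j) * (chi (pi * normc z ^+ 2))%:C =
   (x * y)%:C * (z ^+ i * conjc (z ^+ j) * (chi (pi * normc z ^+ 2))%:C).
  by rewrite conjcM conjc_real rmorphM /=; ring.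
have E' z : z ^+ i * conjc (z ^+ j) * (chi (pi * normc z ^+ 2))%:C = ((x * y)%:C)^-1 *
   (x%:C * z ^+ i * conjc (y%:C * z ^+ j) * (chi (pi * normc z ^+ 2))%:C).
  by rewrite E [RHS]mulrA mulVf // mul1r.
have [iF' _] := cintegrableZ ((x * y)%:C)^-1 iF.
have iM : cintegrable (fun z => z ^+ i * conjc (z ^+ j) * (chi (pi * normc z ^+ 2))%:C).
  by under eq_fun do rewrite E'.
under eq_fun do rewrite E.
by rewrite (cintegrableZ _ iM).2 monomial_orth // mulr0.
Qed.

End Invariance.

(** * Gaussian moments of monomials and Poisson tails *)

Section GaussianMoments.
Variable R : realType.
Local Notation C := R[i].
Local Notation mu2 := (@leb2 R).
Local Notation lam := (@lebesgue_measure R).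
Local Notation w := (@gauss_weight R).

Definition poisson_pmf k (t : R) : R := t ^+ k / k`!%:R * expR (- t).

                                                                  
(** For [t >= 0] the probability that a Poisson variable of mean [t] exceeds [k]; it will be the
    eigenvalue of index [k] of the disc of area [t]. *)
Definition poisson_tail k (t : R) : R := 1 - expR (- t) * \sum_(0 <= j < k.+1) t ^+ j / j`!%:R.

Lemma poisson_tailS k t : poisson_tail k.+1 t = poisson_tail k t - poisson_pmf k.+1 t.
Proof. by rewrite /poisson_tail [in LHS]big_nat_recr //= /poisson_pmf; ring. Qed.

Lemma is_derive_expRN (t : R) : is_derive t 1 (fun x : R => expR (- x)) (- expR (- t)).
Proof.
rewrite -mulrN1; exact: (is_derive1_comp (is_derive_expR (- t)) (is_deriveN (is_derive_id t 1))).
Qed.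

Lemma is_derive_exprS n (t : R) :
  is_derive t 1 (fun x : R => x ^+ n.+1) (n.+1%:R * t ^+ n).
Proof.
elim: n => [|n IH]; first by rewrite expr0 mulr1; exact: is_derive_id.
rewrite (_ : (fun x => _) = (fun x : R => x * x ^+ n.+1)); last first.
  by apply/funext => x; rewrite exprS.
apply: (is_derive_eq (is_deriveM (is_derive_id t 1) IH)).
by rewrite /GRing.scale /= -(natr1 n.+1) mulrDl mul1r mulr1 mulrCA -exprS.
Qed.

(** The derivative of [poisson_pmf k.+1] is [poisson_pmf k - poisson_pmf k.+1], so the derivatives
    of the terms telescope. *)
Lemma is_derive_poisson_tail k (t : R) : is_derive t 1 (poisson_tail k) (poisson_pmf k t).
Proof.
have D := is_derive_expRN.
elim: k t => [|k IH] t.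
  rewrite (_ : poisson_tail 0 = fun x => 1 - expR (- x)); last first.
    by apply/funext => x; rewrite /poisson_tail big_nat1 expr0 divr1 mulr1.
  have H : is_derive t 1 (fun x : R => 1 - expR (- x)) (0 - - expR (- t)).
    by apply: is_deriveB.
  by rewrite /poisson_pmf expr0 divr1 mul1r; rewrite sub0r opprK in H.
rewrite (_ : poisson_tail k.+1 = fun x => poisson_tail k x - x ^+ k.+1 * (k.+1`!%:R^-1 * expR (- x))); last first.
  by apply/funext => x; rewrite poisson_tailS /poisson_pmf mulrA.
have H1 : is_derive t 1 (fun x : R => k.+1`!%:R^-1 * expR (- x)) (k.+1`!%:R^-1 * - expR (- t)).
  by apply: is_deriveZ.
have H2 : is_derive t 1 (fun x : R => x ^+ k.+1) (k.+1%:R * t ^+ k).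
  exact: is_derive_exprS.
have H := is_deriveB (IH t) (is_deriveM H2 H1).
apply: is_derive_eq H _; rewrite /GRing.scale /= /poisson_pmf factS natrM.
have k1 : k.+1%:R != 0 :> R by rewrite pnatr_eq0.
have k2 : k`!%:R != 0 :> R by rewrite pnatr_eq0 -lt0n fact_gt0.
by move: k1 k2; move: (k.+1%:R) (k`!%:R) => u v u0 v0; rewrite exprS; field; rewrite u0 v0.
Qed.

Lemma continuous_poisson_pmf k : continuous (poisson_pmf k).
Proof.
move=> t; apply: cvgM.
  apply: cvgM; last exact: cvg_cst.
  exact: exprn_continuous.
by apply: continuous_comp; [exact: opp_continuous|exact: continuous_expR].
Qed.

Lemma poisson_pmf_ge0 k t : 0 <= t -> 0 <= poisson_pmf k t.
Proof. by move=> t0; rewrite mulr_ge0 ?expR_ge0 // divr_ge0 // exprn_ge0. Qed.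

Lemma poisson_tail0 k : poisson_tail k 0 = 0.
Proof.
rewrite /poisson_tail oppr0 expR0 mul1r big_nat_recl //= expr0 divr1 big1 ?addr0 ?subrr //.
by move=> j _; rewrite expr0n /= mul0r.
Qed.

Lemma poisson_tail_cvg k : poisson_tail k t @[t --> +oo] --> (1 : R).
Proof.
elim: k => [|k IH].
  rewrite (_ : poisson_tail 0 = fun x => 1 - expR (- x)); last first.
    by apply/funext => x; rewrite /poisson_tail big_nat1 expr0 divr1 mulr1.
  by rewrite -[X in _ --> X]subr0; apply: cvgB; [exact: cvg_cst|exact: cvgr_expR].
rewrite (_ : poisson_tail k.+1 = fun x => poisson_tail k x - poisson_pmf k.+1 x); last first.
  by apply/funext => x; rewrite poisson_tailS.
rewrite -[X in _ --> X]subr0; apply: cvgB => //.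
(* The upper bound comes from keeping one term, [t^(k+2) / (k+2)!], of the series of [expR t]. *)
apply: (@squeeze_cvgr _ _ _ _ (cst 0) (fun t => k.+2%:R * t^-1)); last 2 first.
- exact: cvg_cst.
- have V : (fun t : R => t^-1) @ +oo --> (0 : R).
    by apply/(gtr0_cvgV0 (f := @id R)); [exact: nbhs_pinfty_gt|exact: cvg_id].
  have := cvgM (cvg_cst (k.+2%:R : R)) V; rewrite mulr0; exact.
near=> t; have t0 : 0 < t by near: t; exact: nbhs_pinfty_gt.
rewrite poisson_pmf_ge0 ?(ltW t0) //=.
have H : t ^+ k.+2 / k.+2`!%:R <= expR t.
  by apply: le_trans (expR_ge1Dxn k.+1 (ltW t0)); rewrite lerDr.
rewrite /poisson_pmf expRN ler_pdivrMr ?expR_gt0 //.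
apply: (@le_trans _ _ (k.+2%:R * t^-1 * (t ^+ k.+2 / k.+2`!%:R))); last first.
  by rewrite ler_wpM2l // mulr_ge0 // invr_ge0 ltW.
rewrite le_eqVlt; apply/orP; left; apply/eqP.
have f0 : k.+1`!%:R != 0 :> R by rewrite pnatr_eq0 -lt0n fact_gt0.
have k0 : k.+2%:R != 0 :> R by rewrite pnatr_eq0.
rewrite (factS k.+1) natrM (exprS t k.+1); move: f0 k0 (lt0r_neq0 t0).
move: (k.+1`!%:R) (k.+2%:R) (t ^+ k.+1) => u v x u0 v0 t1.
by field; rewrite u0 v0 t1.
Unshelve. all: by end_near. Qed.

Lemma integral_poisson_pmfT k : (\int[lam]_(t in `[0%R, +oo[) (poisson_pmf k t)%:E = 1)%E.
Proof.
rewrite (@ge0_continuous_FTC2y _ (poisson_pmf k) (poisson_tail k) 0 1).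
- by rewrite poisson_tail0 sube0.
- by move=> t; exact: poisson_pmf_ge0.
- by apply: continuous_subspaceT; exact: continuous_poisson_pmf.
- exact: poisson_tail_cvg.
- by move=> t _; case: (is_derive_poisson_tail k t).
- apply: cvg_at_right_filter; apply: differentiable_continuous.
  by apply/derivable1_diffP; case: (is_derive_poisson_tail k 0).
- by move=> t _; rewrite derive1E; case: (is_derive_poisson_tail k t).
Qed.

Lemma integral_poisson_pmf k s : 0 <= s ->
  (\int[lam]_(t in `[0%R, +oo[) ((t < s)%R%:R * poisson_pmf k t)%R%:E = (poisson_tail k s)%:E)%E.
Proof.
move=> s0.
have := FTC_everywhere s0 (is_derive_poisson_tail k) (@continuous_poisson_pmf k).
rewrite poisson_tail0 subr0 => <-.
have mg : measurable_fun setT (fun t : R => (poisson_pmf k t)%:E).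
  by apply/measurable_EFinP; exact: (continuous_measurable_fun (@continuous_poisson_pmf k)).
rewrite -integral_itv_bndo_bndc; last exact: measurable_funS mg.
rewrite [LHS]integral_mkcond [RHS]integral_mkcond; apply: eq_integral => t _.
rewrite !patchE !mem_setE !in_itv /= andbT.
by case: (0 <= t) => //=; case: (t < s); rewrite ?mul1r ?mul0r.
Qed.

Lemma ge0_integral_radial_moment (chi : R -> R) k : measurable_fun setT chi ->
  (forall t, 0 <= chi t) ->
  (\int[mu2]_p ((pisq p) ^+ k * chi (pisq p))%:E =
   \int[lam]_(t in `[0%R, +oo[) (t ^+ k * chi t)%:E)%E.
Proof.
move=> mchi chi0.
(* The absolute value makes the function nonnegative on the whole line, as [ge0_integral_radial]
   requires. *)
have mg : measurable_fun setT (fun t : R => (`|t| ^+ k * chi t)%:E).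
  apply/measurable_EFinP; apply: measurable_funM => //.
  by apply: measurable_funX; exact: normr_measurable.
have g0 t : (0 <= (`|t| ^+ k * chi t)%:E)%E by rewrite lee_fin mulr_ge0.
have := ge0_integral_radial mg g0.
under eq_integral => p _ do rewrite ger0_norm ?pisq_ge0 //.
move=> ->; apply: eq_integral => t; rewrite inE /= in_itv /= andbT => t0.
by rewrite ger0_norm.
Qed.

Definition fmon k (z : C) : C := (Num.sqrt (pi ^+ k / k`!%:R))%:C * z ^+ k.

Lemma normc_fmon k z : normc (fmon k z) ^+ 2 = (pi * normc z ^+ 2) ^+ k / k`!%:R.
Proof.
rewrite normc_sqrt; last by rewrite divr_ge0 // exprn_ge0 // pi_ge0.
have -> : normc (z ^+ k) = normc z ^+ k.
  by elim: k => [|k IH]; rewrite ?expr0 ?normc1 // !exprS normcM IH.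
by rewrite exprMn -!exprM mulnC mulrAC.
Qed.

Lemma entire_fmon k : entire (fmon k).
Proof. exact: (entireZ (@entire_exp R k)). Qed.

Lemma measurable_poisson_pmf_disc (b : R -> bool) k : measurable_fun setT (fun t : R => (b t)%:R : R) ->
  measurable_fun setT (fun t : R => (b t)%:R * expR (- t) / k`!%:R : R).
Proof.
move=> mb; apply: measurable_funM => //; apply: measurable_funM => //.
apply: continuous_measurable_fun => t.
by apply: continuous_comp; [exact: opp_continuous|exact: continuous_expR].
Qed.

Lemma integral_fmon k :
  (\int[mu2]_p (normc (fmon k (toC p)) ^+ 2 * w (toC p))%:E = 1)%E.
Proof.
rewrite -(integral_poisson_pmfT k).
transitivity (\int[mu2]_p ((pisq p) ^+ k * (1 * expR (- pisq p) / k`!%:R))%:E)%E.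
  apply: eq_integral => p _; rewrite normc_fmon gauss_weightE normc_sq -/(pisq p).
  by congr (_%:E); rewrite /pisq /=; ring.
rewrite (ge0_integral_radial_moment (chi := fun t => 1 * expR (- t) / k`!%:R)).
- by apply: eq_integral => t _; congr (_%:E); rewrite /poisson_pmf; ring.
- exact: (@measurable_poisson_pmf_disc (fun=> true)).
- by move=> t; rewrite mul1r divr_ge0 // expR_ge0.
Qed.

(** In the variable [t = pi |z|^2] the Gaussian density of [fmon k] is [poisson_pmf k], whose
    primitive is [poisson_tail k]. This is where the eigenvalues of the disc come from. *)
Lemma integral_fmon_disc k s : 0 <= s ->
  (\int[mu2]_p ((pisq p < s)%R%:R * (normc (fmon k (toC p)) ^+ 2 * w (toC p)))%R%:E =
   (poisson_tail k s)%:E)%E.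
Proof.
move=> s0; rewrite -(integral_poisson_pmf k s0).
transitivity (\int[mu2]_p ((pisq p) ^+ k * ((pisq p < s)%R%:R * expR (- pisq p) / k`!%:R))%:E)%E.
  apply: eq_integral => p _; rewrite normc_fmon gauss_weightE normc_sq -/(pisq p).
  by congr (_%:E); rewrite /pisq /=; ring.
rewrite (ge0_integral_radial_moment (chi := fun t => (t < s)%R%:R * expR (- t) / k`!%:R)).
- by apply: eq_integral => t _; congr (_%:E); rewrite /poisson_pmf; ring.
- apply: (@measurable_poisson_pmf_disc (fun t => (t < s)%R)).
  rewrite (_ : (fun t => _) = \1_(`]-oo, s[%classic : set R)).
    by apply: measurable_indic; exact: measurable_itv.
  by apply/funext => t; rewrite indicE; congr (nat_of_bool _)%:R; apply/idP/idP;
     rewrite inE /= in_itv.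
- by move=> t; rewrite divr_ge0 // mulr_ge0 // expR_ge0.
Qed.

Lemma L2_fmon k : L2 (fmon k).
Proof.
split; first exact: cmeas_borel (cmeas_entire (@entire_fmon k)).
by rewrite /sqnorm integral_fmon ltry.
Qed.

Lemma fock_fmon k : fock (fmon k).
Proof. by split; [exact: entire_fmon|exact: (L2_fmon k).2]. Qed.

Lemma fmon_orth_chi (chi : R -> R) i j : measurable_fun setT chi -> i != j ->
  cintegrable (fun z => fmon i z * conjc (fmon j z) * (chi (pi * normc z ^+ 2))%:C) ->
  integralC (fun z => fmon i z * conjc (fmon j z) * (chi (pi * normc z ^+ 2))%:C) = 0.
Proof.
move=> mchi ij; have c0 k : Num.sqrt (pi ^+ k / k`!%:R) != 0 :> R.
  by rewrite gt_eqF // sqrtr_gt0 divr_gt0 ?exprn_gt0 ?pi_gt0 // ltr0n fact_gt0.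
exact: monomial_orthZ mchi ij (c0 i) (c0 j).
Qed.

Lemma inner_fmon i j : inner (fmon i) (fmon j) = (i == j)%:R.
Proof.
have [->|ij] := eqVneq i j.
  rewrite inner_sqnorm; last exact: L2_fmon.
  by rewrite /nrm2 /sqnorm integral_fmon.
apply: (fmon_orth_chi (chi := fun t => expR (- t))) => //.
  apply: continuous_measurable_fun => t.
  by apply: continuous_comp; [exact: opp_continuous|exact: continuous_expR].
exact: inner_cintegrable (L2_fmon i) (L2_fmon j).
Qed.

End GaussianMoments.

(** * Gaussian averages through averages over circles *)

Section Averaging.
Variable R : realType.
Local Notation C := R[i].
Local Notation mu2 := (@leb2 R).
Local Notation Pl := (plane R).
Local Notation Re := (@complex.Re R).
Local Notation Im := (@complex.Im R).
Local Notation lam := (@lebesgue_measure R).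
Local Notation borel2 := ((@lebesgue_measure R) \x (@lebesgue_measure R))%E.
Local Notation w := (@gauss_weight R).
Local Notation I2pi := (`[0%R, (pi *+ 2)%R]%classic : set R).

                                                                                
                                           
(** A named copy of the product measure that carries a sigma-finite instance, so that Fubini's
    theorem applies to its product with the angle. *)
Definition plane_measure := borel2.
HB.instance Definition _ := Measure.on plane_measure.

Lemma plane_measure_sigma_finite : sigma_finite setT plane_measure.
Proof.
have /sigma_finiteP[F [TF ndF Foo]] := @sigma_finiteT _ _ _ lam.
exists (fun n => F n `*` F n).
  rewrite -setXTT {1 2}TF predeqE => -[x y]; split.
    move=> [/= [n _ Fnx] [k _ Gky]]; exists (maxn n k) => //; split.
    - by move: x Fnx; exact/subsetPset/ndF/leq_maxl.
    - by move: y Gky; exact/subsetPset/ndF/leq_maxr.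
  by move=> [n _ []/= ? ?]; split; exists n.
move=> k; have [? ?] := Foo k; split; first exact: measurableX.
by rewrite /plane_measure product_measure1E// lte_mul_pinfty// ge0_fin_numE.
Qed.

HB.instance Definition _ :=
  @Measure_isSigmaFinite.Build _ _ _ plane_measure plane_measure_sigma_finite.

Lemma lam_I2pi : lam I2pi = (pi *+ 2)%:E.
Proof.
rewrite lebesgue_measure_itv /= lte_fin mulrn_wgt0 ?pi_gt0 //.
by rewrite -EFinB subr0.
Qed.

Lemma integral_weight : (\int[borel2]_p (w (toC p))%:E = 1)%E.
Proof.
rewrite -ge0_integral_leb2; last by move=> p; rewrite lee_fin ltW // gauss_weight_gt0.
  rewrite -(@integral_fmon R 0); apply: eq_integral => p _.
  by rewrite normc_fmon expr0 divr1 mul1r.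
by apply/measurable_EFinP; exact: borel_gauss.
Qed.

                                                                       
(** The function [h (cis t * z) * w z] is integrated over angle and plane in both orders.
    Integrating over [z] first gives [2 pi] times the left side, by rotation invariance; integrating
    over [t] first gives [2 pi m w z], and [w] has mass [1]. *)
Lemma average_rotations (h : C -> R) (m : R) :
  measurable_fun setT (fun p : R * R => h (toC p)) ->
  plane_integrable (fun p : Pl => h (toC p) * w (toC p)) ->
  (forall z, lam.-integrable I2pi (fun t => (h (cis t * z))%:E)) ->
  (forall z, iint (fun t => h (cis t * z)) 0 (pi *+ 2) = m * (pi *+ 2)) ->
  \int[mu2]_p (h (toC p) * w (toC p)) = m.
Proof.
move=> mh ih icirc circ.
have mf : measurable_fun setT (fun p : R * R => (h (toC p) * w (toC p))%:E).
  apply/measurable_EFinP; apply: measurable_funM mh _; exact: borel_gauss.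
pose phi (x : measurableTypeR R * (measurableTypeR R * measurableTypeR R)) : \bar R :=
  (\1_I2pi x.1 * (h (cis x.1 * toC x.2) * w (toC x.2)))%:E.
have mphi : measurable_fun setT phi.
  apply/measurable_EFinP; apply: measurable_funM.
    apply: (measurableT_comp _ (@measurable_fst _ _ _ _)).
    by apply: measurable_indic; exact: measurable_itv.
  apply: measurable_funM; last first.
    exact: (measurableT_comp (@borel_gauss R) (@measurable_snd _ _ _ _)).
  have : cmeas (fun x : measurableTypeR R * (measurableTypeR R * measurableTypeR R) =>
      cis x.1 * toC x.2).
    apply: cmeasM; split.
    - exact: (measurableT_comp (continuous_measurable_fun (@continuous_cos R)) (@measurable_fst _ _ _ _)).
    - exact: (measurableT_comp (continuous_measurable_fun (@continuous_sin R)) (@measurable_fst _ _ _ _)).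
    - exact: (measurableT_comp (@measurable_fst _ _ _ _) (@measurable_snd _ _ _ _)).
    - exact: (measurableT_comp (@measurable_snd _ _ _ _) (@measurable_snd _ _ _ _)).
  move=> /cmeas_toC mc.
  have -> : (fun x : measurableTypeR R * (measurableTypeR R * measurableTypeR R) =>
      h (cis x.1 * toC x.2)) = (fun p => h (toC p)) \o
      (fun x => (Re (cis x.1 * toC x.2), Im (cis x.1 * toC x.2))).
    by apply/funext => x; rewrite /toC /=; congr h; case: (_ * _).
  exact: (measurableT_comp mh mc).
have mI : measurable (I2pi : set (measurableTypeR R)) by exact: measurable_itv.
have wrot t p : w (toC (rotp (cos t) (sin t) p)) = w (toC p).
  by rewrite toC_rot /gauss_weight normcM (normc_cis t) mul1r.
have rotE (g : \bar R -> \bar R) t : measurable_fun setT g ->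
    (\int[borel2]_p g ((h (cis t * toC p) * w (toC p))%:E) =
     \int[mu2]_p g ((h (toC p) * w (toC p))%:E))%E.
  move=> mg; rewrite -(integral_tau (measurable_rotp (cos t) (sin t)) _ (measurableT_comp mg mf)).
    rewrite integral_leb2; last first.
      exact: (measurableT_comp mg (measurableT_comp mf (measurable_rotp _ _))).
    by apply: eq_integral => p _ /=; rewrite wrot toC_rot.
  by move=> f mf' f0; apply: ge0_integral_rot => //; exact: cos2Dsin2.
have ind0 (K : \bar R) (F : R -> \bar R) :
    (forall t, F t = if t \in I2pi then K else 0)%E -> (0 <= K)%E \/ K \is a fin_num ->
    (\int[lam]_t F t = K * (pi *+ 2)%:E)%E.
  move=> FE _; rewrite -lam_I2pi -integral_cst; last exact: measurable_itv.
  by rewrite [RHS]integral_mkcond; apply: eq_integral => t _; rewrite FE /patch.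
have iphi : (lam \x plane_measure)%E.-integrable setT phi.
  have H := @integrable12ltyP _ _ _ _ R lam plane_measure phi mphi.
  apply: H.2.
  rewrite (ind0 (\int[mu2]_p `|(h (toC p) * w (toC p))%:E|)%E) => [|t|].
  - have /integrableP[_ Koo] := ih.
    have K0 : (0 <= \int[mu2]_p `|(h (toC p) * w (toC p))%:E|)%E by exact: integral_ge0.
    by apply: lte_mul_pinfty => //; [rewrite ge0_fin_numE|exact: ltry].
  - case: ifPn => tI.
      rewrite -(rotE abse t) //; apply: eq_integral => p _.
      by rewrite /phi /= indicE tI mul1r.
    by rewrite integral0_eq // => p _; rewrite /phi /= indicE (negPf tI) mul0r normr0.
  - by left; apply: integral_ge0.
have := @Fubini _ _ _ _ R lam plane_measure phi iphi.
rewrite (ind0 (\int[mu2]_p (h (toC p) * w (toC p))%:E)%E) => [|t|]; last 2 first.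
- case: ifPn => tI.
    rewrite -(rotE id t) //; apply: eq_integral => p _.
    by rewrite /phi /= indicE tI mul1r.
  by rewrite integral0_eq // => p _; rewrite /phi /= indicE (negPf tI) mul0r.
- by right; exact: integrable_fin_num.
have -> : (\int[plane_measure]_p \int[lam]_t phi (t, p) = (m * (pi *+ 2))%:E)%E.
  transitivity (\int[borel2]_p ((m * (pi *+ 2))%:E * (w (toC p))%:E))%E.
    apply: eq_integral => p _.
    transitivity (\int[lam]_(t in I2pi) ((w (toC p))%:E * (h (cis t * toC p))%:E))%E.
      rewrite [RHS]integral_mkcond; apply: eq_integral => t _; rewrite /phi /patch /= indicE.
      by case: (t \in _); rewrite ?mul0r // mul1r mulrC.
    rewrite (integralZl mI (icirc (toC p))).
    rewrite muleC; congr (_ * _)%E.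
    rewrite -(circ (toC p)) /iint /Rintegral fineK //.
    exact: (integrable_fin_num mI (icirc (toC p))).
  rewrite integralZl //; last first.
    apply/integrableP; split; first by apply/measurable_EFinP; exact: borel_gauss.
    under eq_integral do rewrite /= ger0_norm ?(ltW (gauss_weight_gt0 _)) //.
    by rewrite integral_weight ltry.
  by rewrite integral_weight mule1.
move=> E; have fin : (\int[mu2]_p (h (toC p) * w (toC p))%:E)%E \is a fin_num.
  exact: integrable_fin_num.
move: E; rewrite -(fineK fin) -EFinM => -[] /mulIf; apply.
by rewrite mulrn_eq0 /= gt_eqF // pi_gt0.
Qed.

End Averaging.

(** * The reproducing kernel and convergence of Taylor sums *)

Section Reproducing.
Variable R : realType.
Local Notation C := R[i].
Local Notation mu2 := (@leb2 R).
Local Notation Pl := (plane R).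
Local Notation Re := (@complex.Re R).
Local Notation Im := (@complex.Im R).
Local Notation w := (@gauss_weight R).
Implicit Types (F G H : C -> C) (a z : C).

Lemma fock_L2 F : fock F -> L2 F.
Proof.
by move=> [eF sF]; split; [exact: (cmeas_borel (cmeas_entire eF))|exact: sF].
Qed.

Lemma gauss_mean F : entire F -> cintegrable (fun z => F z * (w z)%:C) ->
  integralC (fun z => F z * (w z)%:C) = F 0.
Proof.
move=> eF [i1 i2]; have [c1 c2] := cmeas_entire eF.
have cont z : continuous (fun t : R => Re (F (cis t * z))) /\
              continuous (fun t : R => Im (F (cis t * z))).
  have eG : entire (fun u => F (cexp u * z)).
    by apply: (entire_comp eF); apply: (entireM (@entire_cexp R) (@entire_cst _ z)).
  have [d1 d2] := entire_continuous2 eG.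
  have E t : cis t = cexp (0 +i* t) :> C by rewrite cexp_real_im expR0 mul1r.
  split.
    rewrite (_ : (fun t => _) = (fun t => Re (F (cexp (toC (0, t)) * z)))); last first.
      by apply/funext => t; rewrite E.
    move=> t; exact: (cvg_comp _ _ (cvg_pair (cvg_cst 0) cvg_id) (d1 (0, t))).
  rewrite (_ : (fun t => _) = (fun t => Im (F (cexp (toC (0, t)) * z)))); last first.
    by apply/funext => t; rewrite E.
  move=> t; exact: (cvg_comp _ _ (cvg_pair (cvg_cst 0) cvg_id) (d2 (0, t))).
have ER z : Re (F z * (w z)%:C) = Re (F z) * w z by rewrite ReM /= mulr0 subr0.
have EI z : Im (F z * (w z)%:C) = Im (F z) * w z by rewrite ImM /= mulr0 add0r.
rewrite /integralC; apply: complex_ext.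
  rewrite [LHS]/=; under eq_Rintegral do rewrite ER.
  apply: (@average_rotations R (fun z => Re (F z)) (Re (F 0)) c1).
  - by apply: plane_integrable_eq i1 => p; rewrite ER.
  - by move=> z; apply: continuous_itv_integrable; exact: (cont z).1.
  - by move=> z; exact: mean_value_Re.
rewrite [LHS]/=; under eq_Rintegral do rewrite EI.
apply: (@average_rotations R (fun z => Im (F z)) (Im (F 0)) c2).
- by apply: plane_integrable_eq i2 => p; rewrite EI.
- by move=> z; apply: continuous_itv_integrable; exact: (cont z).2.
- by move=> z; exact: mean_value_Im.
Qed.

Definition kern a z : C := cexp (pi%:C * conjc a * z).

Lemma entire_kern a : entire (kern a).
Proof. exact: (@entire_scale _ (@cexp R) (pi%:C * conjc a) (@entire_cexp R)). Qed.

Lemma cexp_real (x : R) : cexp x%:C = (expR x)%:C.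
Proof. by rewrite /cexp /= cos0 sin0 mulr1. Qed.

Lemma cexpJ z : conjc (cexp z) = cexp (conjc z).
Proof. by case: z => x y; rewrite /cexp /= cosN sinN; apply: complex_ext => /=; ring. Qed.

Lemma weight_cexp z : (w z)%:C = cexp (- (pi * normc z ^+ 2))%:C.
Proof. by rewrite cexp_real. Qed.

Lemma weight_shift a z : cexp (- (pi%:C * conjc a) * z) * (w z)%:C =
  conjc (kern a (z + a)) * (w (z + a))%:C.
Proof.
rewrite !weight_cexp cexpJ -!cexpD; congr cexp; rewrite !normc_sq.
by case: z => x y; case: a => u v; apply: complex_ext => /=; ring.
Qed.

Lemma normc_kern a z :
  normc (kern a z) ^+ 2 * w z = expR (pi * normc a ^+ 2) * w (z - a).
Proof.
rewrite normc_cexp /gauss_weight expr2 -!expRD; congr expR; rewrite !normc_sq.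
by case: z => x y; case: a => u v /=; ring.
Qed.

Lemma plane_integrable_weight : plane_integrable (fun p : Pl => w (toC p)).
Proof.
have /L2P[_] := @L2_fmon R 0.
by apply: plane_integrable_eq => p; rewrite normc_fmon expr0 divr1 mul1r.
Qed.

Lemma L2_kern a : L2 (kern a).
Proof.
apply/L2P; split; first exact: cmeas_borel (cmeas_entire (@entire_kern a)).
have := plane_integrable_tau (measurable_trans (- a)) (@trans_inv R (- a)) (@borel_gauss R) plane_integrable_weight.
move=> /(plane_integrableZ (expR (pi * normc a ^+ 2))); apply: plane_integrable_eq => p.
by rewrite normc_kern toC_trans.
Qed.

Lemma fock_kern a : fock (kern a).
Proof. by split; [exact: entire_kern|exact: (L2_kern a).2]. Qed.

(** After translation by [a] the integrand is an entire function times the Gaussian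
    ([weight_shift]); its integral is the value at [0], which is [F a]. *)
Lemma reproducing F a : fock F -> inner F (kern a) = F a.
Proof.
move=> fF; have eF := fF.1; have lF := fock_L2 fF.
pose G z := F z * conjc (kern a z) * (w z)%:C.
have iG : cintegrable G := inner_cintegrable lF (L2_kern a).
have mG : cmeas (fun p : R * R => G (toC p)).
  apply: cmeasM; last exact: cmeas_real (@borel_gauss R).
  by apply: cmeasM; [exact: cmeas_entire|apply: cmeasJ; exact: (cmeas_entire (@entire_kern a))].
pose H z := F (z + a) * cexp (- (pi%:C * conjc a) * z).
have GH z : G (z + a) = H z * (w z)%:C.
  by rewrite /H -mulrA weight_shift /G mulrA.
have eH : entire H.
  have e1 : entire (fun z => F (z + a)) by exact: entire_shift.
  have e2 : entire (fun z => cexp (- (pi%:C * conjc a) * z)).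
    exact: (@entire_scale _ (@cexp R) _ (@entire_cexp R)).
  exact: (entireM e1 e2).
have iH : cintegrable (fun z => H z * (w z)%:C).
  by have := cintegrable_trans a mG iG; under eq_fun do rewrite GH.
rewrite /inner -/G -(integralC_trans a mG); under eq_fun do rewrite GH.
by rewrite gauss_mean // /H mulr0 cexp0 mulr1 add0r.
Qed.

Lemma cauchy_schwarz F G : L2 F -> L2 G ->
  normc (inner F G) ^+ 2 <= nrm2 F * nrm2 G.
Proof.
move=> lF lG; set c := inner F G.
have key (x : R) : 0 <= nrm2 F - 2 * x * normc c ^+ 2 + x ^+ 2 * normc c ^+ 2 * nrm2 G.
  pose D z := (- x%:C * c) * G z + F z.
  have lD : L2 D by exact: L2_lin.
  suff -> : nrm2 F - 2 * x * normc c ^+ 2 + x ^+ 2 * normc c ^+ 2 * nrm2 G = nrm2 D.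
    exact: nrm2_ge0.
  apply: (@complexI R); rewrite -(inner_sqnorm lD) inner_linl //.
  have -> : inner G D = conjc (- x%:C * c * inner G G + inner F G).
    by rewrite (innerJ lD lG) inner_linl.
  have -> : inner F D = conjc (- x%:C * c * inner G F + inner F F).
    by rewrite (innerJ lD lF) inner_linl.
  rewrite (innerJ lF lG) -/c !inner_sqnorm //.
  move: (nrm2 G) (nrm2 F) => g f; rewrite normc_sq.
  by case: (c) => u v; apply: complex_ext => /=; ring.
have F0 := nrm2_ge0 F; have G0 := nrm2_ge0 G; have c0 := sqr_ge0 (normc c).
(* If [nrm2 G = 0] the polynomial of [key] is affine in [x] and forces [c = 0]; otherwise it is
   evaluated at its minimum [1 / nrm2 G]. *)
move: G0; rewrite le_eqVlt => /predU1P[G0|G0].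
  rewrite -G0 mulr0 leNgt; apply/negP => cp.
  have := key (nrm2 F / normc c ^+ 2); rewrite -G0 mulr0 addr0.
  have -> : 2 * (nrm2 F / normc c ^+ 2) * normc c ^+ 2 = 2 * nrm2 F.
    by rewrite -mulrA divfK // gt_eqF.
  move: (key 1) cp F0; rewrite -G0 mulr0 addr0 mulr1.
  by move: (nrm2 F) (normc c ^+ 2) => f x h1 h2 h3 h4; lra.
have := key (nrm2 G)^-1.
have -> : nrm2 F - 2 * (nrm2 G)^-1 * normc c ^+ 2 +
    (nrm2 G)^-1 ^+ 2 * normc c ^+ 2 * nrm2 G = nrm2 F - normc c ^+ 2 / nrm2 G.
  move: G0 => /lt0r_neq0; move: (nrm2 G) (nrm2 F) (normc c) => g f x g0.
  by field.
by rewrite subr_ge0 ler_pdivrMr.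
Qed.

Lemma innerBr F G H : L2 F -> L2 G -> L2 H ->
  inner H (fun z => F z - G z) = inner H F - inner H G.
Proof.
move=> lF lG lH; rewrite (innerJ (L2B lF lG) lH) (innerBl lF lG lH).
by rewrite [LHS]rmorphB (innerJ lF lH) (innerJ lG lH).
Qed.

Lemma inner_sumr (I : Type) (r : seq I) (c : I -> C) (e : I -> C -> C) F :
  (forall i, L2 (e i)) -> L2 F ->
  inner F (fun z => \sum_(i <- r) c i * e i z) = \sum_(i <- r) conjc (c i) * inner F (e i).
Proof.
move=> le lF; rewrite (innerJ (L2_sum r c le) lF) inner_suml // rmorph_sum.
by apply: eq_bigr => i _; rewrite [LHS]conjcM (innerJ lF (le i)) conjcK.
Qed.

Definition partial_sum F n z : C := \sum_(0 <= k < n) inner F (fmon k) * fmon k z.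

Lemma L2_partial_sum F n : L2 (partial_sum F n).
Proof. by apply: L2_sum => i; exact: L2_fmon. Qed.

(** The remainder [D] of the kernel is orthogonal to the first [n] monomials, hence to [K]; so its
    squared norm is [inner D (kern a) = D a], a remainder of the exponential series. *)
Lemma kern_tail a n : let K z := \sum_(0 <= k < n) conjc (fmon k a) * fmon k z in
  nrm2 (fun z => kern a z - K z) =
  expR (pi * normc a ^+ 2) - \sum_(0 <= k < n) (pi * normc a ^+ 2) ^+ k / k`!%:R.
Proof.
move=> K; pose D z := kern a z - K z.
have lK : L2 K by apply: L2_sum => i; exact: L2_fmon.
have lD : L2 D by exact: L2B (L2_kern a) lK.
have eK : entire K.
  by apply: entire_sum => k; exact: (entireZ (@entire_fmon R k)).
have fD : fock D.
  split; last exact: lD.2.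
  have := entireD (@entire_kern a) (entireZ (a := -1) eK).
  by under eq_fun do rewrite mulN1r.
have De k : (k < n)%N -> inner D (fmon k) = 0.
  move=> kn; rewrite /D (innerBl (L2_kern a) lK (@L2_fmon R k)).
  rewrite (innerJ (@L2_fmon R k) (L2_kern a)) (reproducing a (@fock_fmon R k)).
  rewrite /K (inner_suml _ _ (@L2_fmon R) (@L2_fmon R k)).
  rewrite (bigD1_seq k) //= ?mem_index_iota ?iota_uniq //.
  rewrite inner_fmon eqxx mulr1 big1 ?addr0 ?subrr // => i ik.
  by rewrite inner_fmon (negPf ik) mulr0.
have DK : inner D K = 0.
  rewrite /K (inner_sumr _ _ (@L2_fmon R) lD).
  by rewrite big_nat big1 // => i /andP[_ lt]; rewrite De // mulr0.
apply: (@complexI R); rewrite -(inner_sqnorm lD).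
have -> : inner D D = conjc (inner D (kern a) - inner D K).
  by rewrite -(innerBr (L2_kern a) lK lD) -(innerJ lD lD).
rewrite DK subr0 (reproducing a fD) /D rmorphB rmorphB rmorph_sum rmorph_sum; congr (_ - _).
  rewrite [LHS]cexpJ -[RHS]cexp_real; congr cexp.
  by rewrite normc_sq; case: (a) => u v; apply: complex_ext => /=; ring.
apply: eq_bigr => k _; rewrite -normc_fmon [RHS]normc_sqE.
by rewrite [LHS]conjcM conjcK.
Qed.

(** The error is the inner product of [F] with the remainder of the kernel, to which Cauchy-Schwarz
    and [kern_tail] apply. Taylor sums thus converge pointwise without any theory of power
    series. *)
Lemma taylor_bound F a n : fock F ->
  normc (F a - partial_sum F n a) ^+ 2 <= nrm2 F *
  (expR (pi * normc a ^+ 2) - \sum_(0 <= k < n) (pi * normc a ^+ 2) ^+ k / k`!%:R).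
Proof.
move=> fF; have lF := fock_L2 fF; rewrite -kern_tail.
pose K z := \sum_(0 <= k < n) conjc (fmon k a) * fmon k z.
have lK : L2 K by apply: L2_sum => i; exact: L2_fmon.
have -> : F a - partial_sum F n a = inner F (fun z => kern a z - K z).
  rewrite (innerBr (L2_kern a) lK lF) (reproducing a fF); congr (_ - _).
  rewrite /K (inner_sumr _ _ (@L2_fmon R) lF).
  by apply: eq_bigr => k _; rewrite conjcK mulrC.
exact: cauchy_schwarz lF (L2B (L2_kern a) lK).
Qed.

Lemma taylor_cvg F a : fock F ->
  (fun n => normc (partial_sum F n a)) @ \oo --> normc (F a).
Proof.
move=> fF; apply/cvgrPdist_le => e e0.
set t := pi * normc a ^+ 2.
have := @is_cvg_series_exp_coeff R t; rewrite -/(expR t) => /cvgrPdist_le.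
have e1 : 0 < e ^+ 2 / (nrm2 F + 1).
  by rewrite divr_gt0 ?exprn_gt0 // ltr_wpDl // nrm2_ge0.
move=> /(_ _ e1); apply: filterS => n Hn.
have h := taylor_bound a n fF.
have {}Hn : expR t - \sum_(0 <= k < n) t ^+ k / k`!%:R <= e ^+ 2 / (nrm2 F + 1).
  by apply: le_trans (ler_norm _) Hn.
have : normc (F a - partial_sum F n a) <= e.
  rewrite -ler_sqr ?nnegrE ?normc_ge0 ?(ltW e0) //; apply: le_trans h _.
  apply: le_trans (ler_wpM2l (nrm2_ge0 F) Hn) _.
  rewrite mulrCA ler_piMr ?sqr_ge0 // ler_pdivrMr ?mul1r ?lerDl //.
  by rewrite ltr_wpDl // nrm2_ge0.
move=> he; have h1 := le_normcB (F a) (partial_sum F n a).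
have h2 := le_normcB (partial_sum F n a) (F a).
rewrite -(normcN (partial_sum F n a - F a)) opprB in h2.
rewrite ler_norml; lra.
Qed.

Lemma fatou_bound (f : nat -> Pl -> R) (g : Pl -> R) (B : R) :
  (forall n, measurable_fun setT (f n)) -> (forall n p, 0 <= f n p) ->
  (forall p, f n p @[n --> \oo] --> g p) ->
  (forall n, (\int[mu2]_p (f n p)%:E <= B%:E)%E) -> (\int[mu2]_p (g p)%:E <= B%:E)%E.
Proof.
move=> mf f0 fg fB.
have := @fatou _ _ _ mu2 setT measurableT (fun n p => (f n p)%:E)
  (fun n => (measurable_EFinP _ _).2 (mf n)) (fun n p _ => f0 n p).
have -> : (\int[mu2]_p limn_einf (fun n => (f n p)%:E) = \int[mu2]_p (g p)%:E)%E.
  apply: eq_integral => p _; apply: (cvg_limn_einf_sup _).1.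
  by apply/fine_cvgP; split; [exact: nearW|exact: fg].
move=> /le_trans; apply.
rewrite limn_einf_lim; apply: lime_le; first exact: is_cvg_einfs.
apply: nearW => n; apply: le_trans (fB n).
by apply: ereal_inf_lbound; exists n => /=.
Qed.

(** Fatou's lemma along the Taylor sums, whose squared norms are the partial sums of squared
    coefficients. *)
Lemma parseval_le F B : fock F ->
  (forall n, \sum_(0 <= k < n) normc (inner F (fmon k)) ^+ 2 <= B) -> nrm2 F <= B.
Proof.
move=> fF h; have lF := fock_L2 fF.
rewrite -lee_fin -nrm2E //; apply: (fatou_bound (f := fun n p => normc (partial_sum F n (toC p)) ^+ 2 * w (toC p))).
- by move=> n; apply: measurable_sqn; exact: (L2_partial_sum F n).1.
- by move=> n p; exact: sqn_ge0.
- move=> p; apply: cvgM; last exact: cvg_cst.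
  by under eq_fun do rewrite expr2; rewrite expr2; apply: cvgM; exact: taylor_cvg.
- move=> n; rewrite -/(sqnorm (partial_sum F n)) nrm2E; last exact: L2_partial_sum.
  rewrite lee_fin; apply: le_trans (h n); rewrite le_eqVlt; apply/orP; left; apply/eqP.
  apply: (@complexI R); rewrite -(inner_sqnorm (L2_partial_sum F n)).
  rewrite (inner_suml _ _ (@L2_fmon R) (L2_partial_sum F n)).
  rewrite rmorph_sum; rewrite !big_nat; apply: eq_bigr => k /andP[_ kn].
  rewrite [RHS]normc_sqE; congr (_ * _).
  rewrite (innerJ (L2_partial_sum F n) (@L2_fmon R k)); congr conjc.
  rewrite (inner_suml _ _ (@L2_fmon R) (@L2_fmon R k)).
  rewrite (bigD1_seq k) //= ?mem_index_iota ?iota_uniq //.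
  rewrite inner_fmon eqxx mulr1 big1 ?addr0 // => i ik.
  by rewrite inner_fmon (negPf ik) mulr0.
Qed.

End Reproducing.

(** * Completeness of the monomials *)

Section Density.
Variable R : realType.
Local Notation C := R[i].
Implicit Types (F G H : C -> C) (a z : C).

Lemma fock_lin a F G : fock F -> fock G -> fock (fun z => a * F z + G z).
Proof.
move=> fF fG; split; last exact: (L2_lin a (fock_L2 fF) (fock_L2 fG)).2.
exact: (entireD (entireZ (a := a) fF.1) fG.1).
Qed.

Lemma fock0 : fock (fun=> 0 : C).
Proof. by split; [exact: (@entire_cst _ 0)|exact: (@L2_0 R).2]. Qed.

Lemma fockZ a F : fock F -> fock (fun z => a * F z).
Proof.
move=> fF; have := fock_lin a fF fock0.
by under eq_fun do rewrite addr0.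
Qed.

Lemma fockB F G : fock F -> fock G -> fock (fun z => F z - G z).
Proof.
move=> fF fG; have := fock_lin (-1) fG fF.
by under eq_fun do rewrite mulN1r addrC.
Qed.

Lemma fock_sum (I : Type) (r : seq I) (c : I -> C) (F : I -> C -> C) :
  (forall i, fock (F i)) -> fock (fun z => \sum_(i <- r) c i * F i z).
Proof.
move=> h; split; last by exact: (L2_sum r c (fun i => fock_L2 (h i))).2.
by apply: entire_sum => i; exact: (entireZ (a := c i) (h i).1).
Qed.

Lemma inner_partial_sum F n k : (k < n)%N ->
  inner (partial_sum F n) (fmon k) = inner F (fmon k).
Proof.
move=> kn; rewrite (inner_suml _ _ (@L2_fmon R) (@L2_fmon R k)).
rewrite (bigD1_seq k) //= ?mem_index_iota ?iota_uniq //.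
rewrite inner_fmon eqxx mulr1 big1 ?addr0 // => i ik.
by rewrite inner_fmon (negPf ik) mulr0.
Qed.

Lemma nrm2_remainder F n : L2 F ->
  nrm2 (fun z => F z - partial_sum F n z) =
  nrm2 F - \sum_(0 <= k < n) normc (inner F (fmon k)) ^+ 2.
Proof.
move=> lF; set S := partial_sum F n.
have lS : L2 S := L2_partial_sum F n.
have lD := L2B lF lS.
have SD : inner S (fun z => F z - S z) = 0.
  rewrite (inner_suml _ _ (@L2_fmon R) lD) big_nat big1 // => k /andP[_ kn].
  rewrite (innerJ lD (@L2_fmon R k)) (innerBl lF lS (@L2_fmon R k)).
  by rewrite inner_partial_sum // subrr conjc0 mulr0.
apply: (@complexI R); rewrite -(inner_sqnorm lD) (innerBl lF lS lD) SD subr0.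
rewrite (innerBr lF lS lF) (inner_sqnorm lF) [RHS]rmorphB [X in _ = _ - X]rmorph_sum.
congr (_ - _); rewrite (inner_sumr _ _ (@L2_fmon R) lF).
by apply: eq_bigr => k _; rewrite mulrC -normc_sqE.
Qed.

(** [H] is orthogonal to the Taylor sums of [F], and [parseval_le] makes the remainder of [F]
    arbitrarily small in norm, so Cauchy-Schwarz excludes a nonzero inner product. [H] need not be
    entire: it will be an error [f - H] of a projection. *)
Lemma fock_dense H F : L2 H -> fock F -> (forall k, inner H (fmon k) = 0) -> inner H F = 0.
Proof.
move=> lH fF H0; have lF := fock_L2 fF.
apply/eqP/negPn/negP => HF.
set x := normc (inner H F) ^+ 2.
have x0 : 0 < x.
  rewrite exprn_gt0 // lt_neqAle normc_ge0 andbT eq_sym.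
  by apply: contra HF => /eqP /eq0_normc ->.
have n0 := nrm2_ge0 H.
have n1 : 0 < nrm2 H + 1 by rewrite ltr_wpDl.
have [n Hn] : exists n, nrm2 F - x / (nrm2 H + 1) <
    \sum_(0 <= k < n) normc (inner F (fmon k)) ^+ 2.
  apply: contrapT => /forallNP h.
  have := @parseval_le R F (nrm2 F - x / (nrm2 H + 1)) fF.
  move=> /(_ (fun n => _))/wrap[].
    by move=> n; rewrite leNgt; apply/negP; exact: h.
  by rewrite lerBrDl gerDr leNgt divr_gt0.
have lD := L2B lF (L2_partial_sum F n).
have := cauchy_schwarz lH lD.
rewrite (innerBr lF (L2_partial_sum F n) lH) (inner_sumr _ _ (@L2_fmon R) lH).
rewrite big1 ?subr0; last by move=> k _; rewrite H0 mulr0.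
rewrite nrm2_remainder // -/x leNgt => /negP; apply.
apply: (@le_lt_trans _ _ (nrm2 H * (x / (nrm2 H + 1)))).
  by rewrite ler_wpM2l //; move: Hn; move: (\sum_(_ <= _ < _) _) => y; lra.
by rewrite mulrCA gtr_pMr // ltr_pdivrMr // mul1r ltrDl.
Qed.

Lemma fock_coef0 F : fock F -> (forall k, inner F (fmon k) = 0) -> F = fun=> 0.
Proof.
move=> fF h; apply/funext => a; rewrite -(reproducing a fF).
exact: fock_dense (fock_L2 fF) (fock_kern a) h.
Qed.

Lemma fock_single F k : fock F -> (forall i, i != k -> inner F (fmon i) = 0) ->
  F = fun z => inner F (fmon k) * fmon k z.
Proof.
move=> fF h.
have fZ : fock (fun z => inner F (fmon k) * fmon k z) by apply: fockZ; exact: fock_fmon.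
have := fock_coef0 (fockB fF fZ) => /(_ _)/wrap[].
  move=> i; rewrite (innerBl (fock_L2 fF) (fock_L2 fZ) (@L2_fmon R i)).
  rewrite (innerZl _ (@L2_fmon R k) (@L2_fmon R i)) inner_fmon.
  have [<-|ki] := eqVneq k i; first by rewrite mulr1 subrr.
  by rewrite mulr0 subr0 h // eq_sym.
move=> E; apply/funext => z; apply/eqP; rewrite -subr_eq0.
by have /(congr1 (fun f => f z)) /= -> := E.
Qed.

End Density.

                                    

(** * Gram matrices as integral operators *)

Section Gram.
Variable R : realType.
Local Notation C := R[i].
Local Notation mu2 := (@leb2 R).
Local Notation Re := (@complex.Re R).

Lemma cintegrable_sum (I : Type) (r : seq I) (c : I -> C) (F : I -> C -> C) :
  (forall i, cintegrable (F i)) ->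
  cintegrable (fun z => \sum_(i <- r) c i * F i z) /\
  integralC (fun z => \sum_(i <- r) c i * F i z) = \sum_(i <- r) c i * integralC (F i).
Proof.
move=> iF; elim: r => [|i r [IH1 IH2]].
  have E : (fun z : C => \sum_(i <- [::]) c i * F i z) = fun=> 0.
    by apply/funext => z; rewrite big_nil.
  rewrite E big_nil; split; first by split; exact: (integrable0 mu2).
  by rewrite /integralC /= /Rintegral integral0.
have [h1 h2] := cintegrable_lin (c i) (iF i) IH1.
have E : (fun z : C => \sum_(j <- i :: r) c j * F j z) =
    fun z => c i * F i z + \sum_(j <- r) c j * F j z.
  by apply/funext => z; rewrite big_cons.
by rewrite E big_cons h2 IH2.
Qed.

Variables (n : nat) (e : 'I_n -> C -> C) (v : C -> R).
Hypothesis ie : forall k l, cintegrable (fun z => e k z * conjc (e l z) * (v z)%:C).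

Definition gram : 'M[C]_n :=
  \matrix_(k, l) integralC (fun z => e k z * conjc (e l z) * (v z)%:C).

Lemma gram_herm : gram \is hermsymmx.
Proof.
apply/is_hermitianmxP; rewrite expr0 scale1r; apply/matrixP => k l; rewrite !mxE.
rewrite -[RHS]/(conjc _) -(cintegrable_J (ie l k)).2; apply: congr1; apply/funext => z.
by rewrite !conjcM conjcK conjc_real (mulrC (conjc _)).
Qed.

(** This turns inequalities between quadratic forms of Gram matrices into pointwise inequalities
    between integrands. *)
Lemma qf_gram m (X : 'M[C]_(m, n)) :
  plane_integrable (fun p => \sum_j normc (\sum_k X j k * e k (toC p)) ^+ 2 * v (toC p)) /\
  qf gram X = \int[mu2]_p (\sum_j normc (\sum_k X j k * e k (toC p)) ^+ 2 * v (toC p)).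
Proof.
pose c (x : 'I_m * ('I_n * 'I_n)) := X x.1 x.2.1 * conjc (X x.1 x.2.2).
pose F (x : 'I_m * ('I_n * 'I_n)) z := e x.2.1 z * conjc (e x.2.2 z) * (v z)%:C.
have iF x : cintegrable (F x) by exact: ie.
have [i1 i2] := cintegrable_sum (index_enum _) c iF.
have E z : \sum_x c x * F x z =
    (\sum_j normc (\sum_k X j k * e k z) ^+ 2 * v z)%:C.
  rewrite rmorph_sum /=.
  rewrite -(pair_bigA _ (fun j kl => c (j, kl) * F (j, kl) z)) /=.
  apply: eq_bigr => j _.
  rewrite rmorphM /= normc_sqE rmorph_sum big_distrlr /= mulr_suml.
  rewrite -(pair_bigA _ (fun k l => c (j, (k, l)) * F (j, (k, l)) z)) /=.
  apply: eq_bigr => k _; rewrite mulr_suml; apply: eq_bigr => l _.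
  by rewrite /c /F /= rmorphM /=; ring.
move/funext : E => E; rewrite E in i1 i2; split; first exact: i1.1.
transitivity (Re (\sum_x c x * integralC (F x))); last by rewrite -i2.
rewrite /qf; congr Re; rewrite /mxtrace.
rewrite -(pair_bigA _ (fun j kl => c (j, kl) * integralC (F (j, kl)))) /=.
apply: eq_bigr => j _; rewrite mxE.
rewrite -(pair_bigA _ (fun k l => c (j, (k, l)) * integralC (F (j, (k, l))))) /=.
rewrite exchange_big /=; apply: eq_bigr => l _.
rewrite mxE mulr_suml; apply: eq_bigr => k _.
by rewrite !mxE /c /=; ring.
Qed.

End Gram.

(** * Norms of monomials on the sphere *)

Section BetaIntegral.
Variable R : realType.
Local Notation lam := (@lebesgue_measure R).

                                                                       
(** At [x] in [[0, 1]] this is the probability of at most [k] successes in [M+1] trials of success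
    probability [1 - x]; it is a primitive of a single Bernstein term. *)
Definition beta_poly M k : {poly R} :=
  \sum_(0 <= j < k.+1) ((1 - 'X) ^+ j * 'X ^+ (M.+1 - j)) *+ 'C(M.+1, j).

(** The derivatives of consecutive terms telescope, by the two absorption identities for binomial
    coefficients; only the last term survives. *)
Lemma deriv_beta_poly M k : (k <= M)%N ->
  (beta_poly M k)^`()%R = ((1 - 'X) ^+ k * 'X ^+ (M - k)) *+ (M.+1 * 'C(M, k)).
Proof.
elim: k => [|k IH] kM.
  rewrite /beta_poly big_nat1 !expr0 !mul1r !bin0 muln1 !subn0 derivMn.
  by rewrite derivXn mulr1n.
rewrite /beta_poly big_nat_recr //= -/(beta_poly M k) derivD IH ?(ltnW kM) //.
rewrite derivMn derivM deriv_exp !derivXn derivB derivX derivC sub0r subSS mulN1r /=.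
have E1 : ((k.+1 * 'C(M.+1, k.+1))%N%:R : {poly R}) = (M.+1 * 'C(M, k))%N%:R.
  by rewrite -(mul_bin_diag M.+1 k).
have E2 : (((M - k) * 'C(M.+1, k.+1))%N%:R : {poly R}) = (M.+1 * 'C(M, k.+1))%N%:R.
  by rewrite (mul_bin_down M.+1 k.+1) subSS.
rewrite -[in RHS]mulr_natr -E2 -[_ *+ (M.+1 * _)]mulr_natr -E1 !natrM.
rewrite subnS.
move: ('C(M.+1, k.+1)) ((M - k)%N) => c d.
rewrite -[(_ + _) *+ c]mulr_natr -[- _ *+ _]mulr_natr -['X^_ *+ d]mulr_natr.
by move: (_ ^+ k) (_ ^+ k.+1) ('X^d) ('X^(d.-1)) (k.+1%:R) (d%:R) (c%:R) => A B X Y x y u; ring.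
Qed.

Lemma beta_poly0 M k : (k <= M)%N -> (beta_poly M k).[0] = 0.
Proof.
move=> kM; rewrite /beta_poly horner_sum big_nat big1 // => j /andP[_ jk].
rewrite hornerMn !hornerE subSn; last by rewrite (leq_trans _ kM).
by rewrite expr0n mulr0 mul0rn.
Qed.

Lemma beta_poly1 M k : (beta_poly M k).[1] = 1.
Proof.
rewrite /beta_poly horner_sum big_nat_recl //= big1 ?addr0.
  by rewrite hornerMn bin0 !hornerE subn0 expr1n.
by move=> j _; rewrite hornerMn !hornerE subrr expr0n /= mul0r mul0rn.
Qed.

Variables (b : R) (b0 : 0 < b).

(** Only [t >= 0] matters; the absolute value makes the function positive and continuous on the
    whole line. *)
Definition sphere_base (t : R) : R := (1 + b * `|t|)^-1.

Lemma sphere_base_gt0 t : 0 < sphere_base t.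
Proof. by rewrite invr_gt0 ltr_pwDl // mulr_ge0 // ltW. Qed.

Lemma continuous_sphere_base : continuous sphere_base.
Proof.
move=> t; apply: cvgV; first by rewrite gt_eqF // -invr_gt0; exact: sphere_base_gt0.
by apply: cvgD; [exact: cvg_cst|apply: cvgM; [exact: cvg_cst|exact: norm_continuous]].
Qed.

(** The substitution [x = 1 / (1 + b t)] turns the integrand into the derivative of [beta_poly],
    which runs from [1] at [t = 0] to [0] at infinity. *)
Lemma integral_beta M k : (k <= M)%N ->
  (\int[lam]_(t in `[0%R, +oo[)
     (M.+1%:R * b * 'C(M, k)%:R * (b * t) ^+ k * sphere_base t ^+ M.+2)%:E = 1)%E.
Proof.
move=> kM; pose v t := (1 + b * t)^-1.
have vE (t : R) : 0 <= t -> sphere_base t = v t by move=> t0; rewrite /sphere_base ger0_norm.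
pose F t := 1 - (beta_poly M k).[v t].
have dF (t : R) : 0 <= t -> is_derive t 1 F
    (M.+1%:R * b * 'C(M, k)%:R * (b * t) ^+ k * sphere_base t ^+ M.+2).
  move=> t0; have v0 : 1 + b * t != 0.
    by rewrite gt_eqF // ltr_pwDl // mulr_ge0 // ltW.
  have d1 : is_derive t 1 (fun t : R => 1 + b * t) (0 + b * 1).
    exact: (is_deriveD (is_derive_cst (1 : R) t 1) (is_deriveZ b (is_derive_id t 1))).
  have d2 := @is_deriveV R (fun t => 1 + b * t) t _ 1 v0 d1.
  have d3 := is_derive1_comp (is_derive_poly (beta_poly M k) (v t)) d2.
  have d4 := is_deriveB (is_derive_cst (1 : R) t 1) d3.
  apply: (is_derive_eq d4); rewrite sub0r deriv_beta_poly // hornerMn hornerM !horner_exp.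
  rewrite hornerD hornerN hornerC hornerX vE //.
  have -> : 1 - v t = b * t * v t by rewrite /v; field.
  rewrite -[LHS]/(- ((b * t * v t) ^+ k * v t ^+ (M - k) *+ (M.+1 * 'C(M, k)) *
    (- (1 + b * t) ^- 2 * (0 + b * 1)))) -exprVn -/(v t) -mulr_natr natrM.
  have -> : M.+2 = (k + (M - k) + 2)%N by lia.
  by rewrite !exprD exprMn add0r mulr1; ring.
have cf : continuous (fun t : R =>
    M.+1%:R * b * 'C(M, k)%:R * (b * t) ^+ k * sphere_base t ^+ M.+2).
  move=> t.
  have c1 : (fun t : R => b * t) @ t --> b * t by apply: cvgM; [exact: cvg_cst|exact: cvg_id].
  have c2 := cvg_comp _ (fun x => x ^+ k) c1 (@exprn_continuous R k _).
  have c3 := cvg_comp _ (fun x => x ^+ M.+2) (@continuous_sphere_base t) (@exprn_continuous R M.+2 _).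
  exact: (cvgM (cvgM (cvg_cst (M.+1%:R * b * 'C(M, k)%:R)) c2) c3).
rewrite (@ge0_continuous_FTC2y _ (fun t : R =>
    M.+1%:R * b * 'C(M, k)%:R * (b * t) ^+ k * sphere_base t ^+ M.+2) F 0 1).
- by rewrite /F /v mulr0 addr0 invr1 beta_poly1 subrr sube0.
- move=> t t0; have b1 := ltW b0.
  apply: mulr_ge0; last by rewrite exprn_ge0 // ltW // sphere_base_gt0.
  by rewrite mulr_ge0 ?exprn_ge0 // mulr_ge0 // mulr_ge0.
- exact: (continuous_subspaceT cf).
- rewrite -[X in _ --> X]subr0; apply: cvgB; first exact: cvg_cst.
  rewrite -(beta_poly0 kM).
  apply: (cvg_comp v (horner (beta_poly M k))); last exact: continuous_horner.
  apply: (@squeeze_cvgr _ _ _ _ (cst 0) (fun t => b^-1 * t^-1)); last 2 first.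
  + exact: cvg_cst.
  + have V : (fun t : R => t^-1) @ +oo --> (0 : R).
      by apply/(gtr0_cvgV0 (f := @id R)); [exact: nbhs_pinfty_gt|exact: cvg_id].
    have := cvgM (cvg_cst (b^-1 : R)) V; rewrite mulr0; exact.
  near=> t; have t0 : 0 < t by near: t; exact: nbhs_pinfty_gt.
  have bt : 0 < b * t by rewrite mulr_gt0.
  have bt1 : 0 < 1 + b * t by lra.
  by rewrite invr_ge0 (ltW bt1) /= -invfM lef_pV2 ?posrE //; lra.
- by move=> t t0; case: (dF t (ltW t0)).
- apply: cvg_at_right_filter; apply: differentiable_continuous.
  by apply/derivable1_diffP; case: (dF 0 (lexx _)).
- move=> t; rewrite in_itv /= andbT => t0; rewrite derive1E.
  by case: (dF t (ltW t0)).
Unshelve. all: by end_near. Qed.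

End BetaIntegral.

(** * The spherical model: polynomials of bounded degree *)

Section Sphere.
Variable R : realType.
Local Notation C := R[i].
Local Notation mu2 := (@leb2 R).
Local Notation Pl := (plane R).
Variables (b : R) (b0 : 0 < b).

Local Notation q z := (pi * normc z ^+ 2).
Local Notation v z := (sphere_base b (q z)).

(** The orthonormal basis of polynomials of degree at most [M] for the weight [v^(M+2)]; the sphere
    of area [1/b] is seen in stereographic coordinates, with area element [v^2 dA]. *)
Definition smon M k (z : C) : C :=
  (Num.sqrt (M.+1%:R * b * 'C(M, k)%:R * (b * pi) ^+ k))%:C * z ^+ k.

Lemma pi_normc_sq_ge0 (z : C) : 0 <= q z.
Proof. by rewrite mulr_ge0 ?pi_ge0 ?sqr_ge0. Qed.

Lemma pisq_toC (p : R * R) : q (toC p) = pisq p.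
Proof. by rewrite normc_sq. Qed.

Lemma normcX (z : C) k : normc (z ^+ k) = normc z ^+ k.
Proof. by elim: k => [|k IH]; rewrite ?expr0 ?normc1 // !exprS normcM IH. Qed.

Lemma normc_smon M k z :
  normc (smon M k z) ^+ 2 = M.+1%:R * b * 'C(M, k)%:R * (b * q z) ^+ k.
Proof.
have b1 := ltW b0; rewrite normc_sqrt; last first.
  by rewrite !mulr_ge0 // exprn_ge0 // mulr_ge0 // pi_ge0.
by rewrite normcX -exprM mulnC exprM -mulrA -exprMn mulrA.
Qed.

(** By the binomial theorem the kernel on the diagonal has constant density [(M+1) b] with respect
    to spherical area, which reflects the homogeneity of the sphere. *)
Lemma sum_smon M z :
  \sum_(k < M.+1) normc (smon M k z) ^+ 2 * v z ^+ M.+2 = M.+1%:R * b * v z ^+ 2.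
Proof.
have q1 : 0 < 1 + b * q z by rewrite ltr_pwDl // mulr_ge0 ?pi_normc_sq_ge0 // ltW.
transitivity (M.+1%:R * b * (\sum_(k < M.+1) 1 ^+ (M - k) * (b * q z) ^+ k *+ 'C(M, k)) *
    v z ^+ M.+2).
  rewrite -mulr_suml; congr (_ * _); rewrite mulr_sumr; apply: eq_bigr => k _.
  by rewrite normc_smon expr1n mul1r -mulr_natr; ring.
rewrite -exprDn /sphere_base ger0_norm ?pi_normc_sq_ge0 // -[M.+2]addn2 exprD mulrA; congr (_ * _).
by rewrite -[LHS]mulrA -exprMn divff ?expr1n ?mulr1 // gt_eqF.
Qed.

Lemma measurable_sphere_base : measurable_fun setT (sphere_base b).
Proof. exact: continuous_measurable_fun (continuous_sphere_base b0). Qed.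

Lemma integral_smon M k : (k <= M)%N ->
  (\int[mu2]_p (normc (smon M k (toC p)) ^+ 2 * v (toC p) ^+ M.+2)%:E = 1)%E.
Proof.
move=> kM; rewrite -(integral_beta b0 kM).
transitivity (\int[mu2]_p ((pisq p) ^+ k *
    (M.+1%:R * b * 'C(M, k)%:R * b ^+ k * sphere_base b (pisq p) ^+ M.+2))%:E)%E.
  apply: eq_integral => p _; rewrite normc_smon pisq_toC exprMn; congr (_%:E); ring.
rewrite (ge0_integral_radial_moment (chi := fun t =>
    M.+1%:R * b * 'C(M, k)%:R * b ^+ k * sphere_base b t ^+ M.+2)).
- apply: eq_integral => t _; congr (_%:E).
  by rewrite exprMn; move: (_ ^+ M.+2) => x; ring.
- apply: measurable_funM; first exact: measurable_cst.
  exact: measurable_funX measurable_sphere_base.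
- move=> t; have b1 := ltW b0; apply: mulr_ge0; last by rewrite exprn_ge0 // ltW // sphere_base_gt0.
  by rewrite !mulr_ge0 // exprn_ge0.
Qed.

Lemma borel_sphere_base : measurable_fun setT (fun p : R * R => v (toC p)).
Proof.
under eq_fun do rewrite pisq_toC.
exact: (measurableT_comp measurable_sphere_base (@measurable_pisq R)).
Qed.

Lemma sphere_base_normc_gt0 z : 0 < v z. Proof. exact: sphere_base_gt0. Qed.

Lemma plane_integrable_smon M k : (k <= M)%N ->
  plane_integrable (fun p : Pl => normc (smon M k (toC p)) ^+ 2 * v (toC p) ^+ M.+2).
Proof.
move=> kM; apply/integrableP; split.
  apply/measurable_EFinP; apply: borel_plane_fun; apply: measurable_funM.
    exact: (cmeas_normc2 (cmeas_entire (entireZ (@entire_exp R k)))).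
  exact: measurable_funX borel_sphere_base.
rewrite (_ : (\int[mu2]_p _)%E = 1%E) ?ltry // -(integral_smon kM).
apply: eq_integral => p _; apply: gee0_abs; rewrite lee_fin.
exact: mulr_ge0 (sqr_ge0 _) (exprn_ge0 _ (ltW (sphere_base_normc_gt0 _))).
Qed.

Section Cutoff.
Variable chi : C -> R.
Hypothesis mchi : measurable_fun setT (fun p : Pl => chi (toC p)).
Hypothesis indic01 : forall z, 0 <= chi z <= 1.

Lemma cintegrable_smon M (k l : 'I_M.+1) :
  cintegrable (fun z => smon M k z * conjc (smon M l z) * (chi z * v z ^+ M.+2)%:C).
Proof.
have mw : measurable_fun setT (fun p : Pl => chi (toC p) * v (toC p) ^+ M.+2).
  by apply: measurable_funM mchi _; apply: measurable_funX; exact: borel_plane_fun borel_sphere_base.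
have me (i : 'I_M.+1) : plane_cmeas (smon M i).
  exact: (cmeas_borel (cmeas_entire (entireZ (@entire_exp R i)))).
have iM (i : 'I_M.+1) := plane_integrable_smon (ltn_ord i : (i <= M)%N).
apply: (cintegrable_dom (g := fun z => normc (smon M k z) ^+ 2 * v z ^+ M.+2 +
   normc (smon M l z) ^+ 2 * v z ^+ M.+2)).
- exact: (cmeasM (cmeasM (me k) (cmeasJ (me l))) (cmeas_real mw)).
- exact: plane_integrableD (iM k) (iM l).
- move=> z; rewrite (normcM (_ * _)) (normcM (smon M k z)) normc_conj normc_real.
  have /andP[c0 c1] := indic01 z; have v0 : 0 <= v z ^+ M.+2 := exprn_ge0 _ (ltW (sphere_base_normc_gt0 z)).
  rewrite (ger0_norm (mulr_ge0 c0 v0)) -mulrDl mulrA; apply: (ler_wpM2r v0).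
  have := sqr_ge0 (normc (smon M k z) - normc (smon M l z)).
  have := normc_ge0 (smon M k z); have := normc_ge0 (smon M l z).
  move: (normc (smon M k z)) (normc (smon M l z)) => y x x0 y0 xy.
  apply: (@le_trans _ _ (y * x)); last by nra.
  by rewrite ler_piMr // mulr_ge0.
Qed.

(** The matrix, in the basis [smon], of the compression of multiplication by [chi]. The parameter
    [b] stays fixed while [M] varies, as the descent requires. *)
Definition sphere_op M : 'M[C]_M.+1 :=
  gram (fun k : 'I_M.+1 => smon M k) (fun z => chi z * v z ^+ M.+2).

Lemma sphere_op_psd M p (X : 'M[C]_(p, M.+1)) : 0 <= qf (sphere_op M) X.
Proof.
rewrite (qf_gram (@cintegrable_smon M) X).2; apply: Rintegral_ge0 => // x _.
apply: sumr_ge0 => j _; have /andP[c0 _] := indic01 (toC x).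
exact: mulr_ge0 (sqr_ge0 _) (mulr_ge0 c0 (exprn_ge0 _ (ltW (sphere_base_normc_gt0 _)))).
Qed.

(** Inserting [1 = (1 + b pi |z|^2) v] splits each density [|P|^2 v^(M+2)] into those of [P] and of
    [sqrt(b pi) z P] one level up; [keep_mx] and [shift_mx] express these two in the basis of that
    level. *)
Lemma sphere_op_rec M p (X : 'M[C]_(p, M.+1)) : qf (sphere_op M) X =
  qf (sphere_op M.+1) (X *m keep_mx R M) + qf (sphere_op M.+1) (X *m shift_mx R M).
Proof.
have [i1 ->] := qf_gram (@cintegrable_smon M.+1) (X *m keep_mx R M).
have [i2 ->] := qf_gram (@cintegrable_smon M.+1) (X *m shift_mx R M).
rewrite (qf_gram (@cintegrable_smon M) X).2 -(RintegralD measurableT i1 i2).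
apply: eq_Rintegral => x _; set z := toC x; rewrite -big_split /=; apply: eq_bigr => j _.
have b1 := ltW b0.
have EK : \sum_k (X *m keep_mx R M) j k * smon M.+1 k z = \sum_k X j k * smon M k z.
  transitivity (\sum_k \sum_i X j i * (keep_mx R M i k * smon M.+1 k z)).
    by apply: eq_bigr => k _; rewrite mxE mulr_suml; apply: eq_bigr => i _; rewrite mulrA.
  rewrite exchange_big /=; apply: eq_bigr => i _; rewrite -mulr_sumr; congr (_ * _).
  under eq_bigr do rewrite mxE; rewrite sum_pick /smon mulrA -rmorphM /= -sqrtrM ?divr_ge0 //.
  congr ((Num.sqrt _)%:C * _).
  have : ((M.+1 - i) * 'C(M.+1, i))%N%:R = (M.+1 * 'C(M, i))%N%:R :> R.
    by rewrite (mul_bin_down M.+1 i).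
  rewrite !natrM => E.
  transitivity ((M.+1%:R * 'C(M, i)%:R) * (b * (b * pi) ^+ i)); last by ring.
  rewrite -E; have M2 : M.+2%:R != 0 :> R by rewrite pnatr_eq0.
  by move: (_ ^+ i) => y; field.
have ES : \sum_k (X *m shift_mx R M) j k * smon M.+1 k z =
    ((Num.sqrt (b * pi))%:C * z) * \sum_k X j k * smon M k z.
  transitivity (\sum_k \sum_i X j i * (shift_mx R M i k * smon M.+1 k z)).
    by apply: eq_bigr => k _; rewrite mxE mulr_suml; apply: eq_bigr => i _; rewrite mulrA.
  rewrite exchange_big /= mulr_sumr; apply: eq_bigr => i _; rewrite -mulr_sumr mulrCA.
  congr (_ * _); under eq_bigr do rewrite mxE; rewrite sum_pick /smon.
  have sqE : Num.sqrt (i.+1%:R / M.+2%:R) *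
      Num.sqrt (M.+2%:R * b * 'C(M.+1, i.+1)%:R * (b * pi) ^+ i.+1) =
      Num.sqrt (b * pi) * Num.sqrt (M.+1%:R * b * 'C(M, i)%:R * (b * pi) ^+ i).
    rewrite -!sqrtrM ?divr_ge0 ?mulr_ge0 ?pi_ge0 //; congr Num.sqrt.
    have : (i.+1 * 'C(M.+1, i.+1))%N%:R = (M.+1 * 'C(M, i))%N%:R :> R.
      by rewrite -(mul_bin_diag M.+1 i).
    rewrite !natrM => E.
    transitivity ((M.+1%:R * 'C(M, i)%:R) * (b * (b * pi) ^+ i.+1)); last by rewrite exprS; ring.
    rewrite -E; have M2 : M.+2%:R != 0 :> R by rewrite pnatr_eq0.
    by move: (_ ^+ i.+1) => y; field.
  rewrite lift0 mulrA -rmorphM sqE rmorphM exprS; ring.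
rewrite EK ES normcM exprMn normc_sqrt ?mulr_ge0 ?pi_ge0 //.
have q1 : 0 < 1 + b * q z by rewrite ltr_pwDl // mulr_ge0 ?pi_normc_sq_ge0.
have -> : v z ^+ M.+2 = (1 + b * q z) * v z ^+ M.+3.
  have bv : (1 + b * q z) * v z = 1.
    by rewrite /sphere_base ger0_norm ?pi_normc_sq_ge0 // divff // gt_eqF.
  by rewrite (exprS (v z) M.+2) mulrA bv mul1r.
by move: (v z ^+ M.+3) => y; ring.
Qed.

End Cutoff.
End Sphere.

(** * Ky Fan bounds on the sphere *)

Section SphereKyFan.
Variable R : realType.
Local Notation C := R[i].
Local Notation mu2 := (@leb2 R).
Local Notation Pl := (plane R).
Variables (b : R) (b0 : 0 < b).
Local Notation q z := (pi * normc z ^+ 2).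
Local Notation v z := (sphere_base b (q z)).

Lemma sphere_op_full M : sphere_op b (fun=> 1) M = 1%:M.
Proof.
have m1 : measurable_fun setT (fun p : Pl => (fun=> 1 : R) (toC p)) by exact: measurable_cst.
have h1 (z : C) : 0 <= (fun=> 1 : R) z <= 1 by rewrite ler01 lexx.
apply/matrixP => k l; rewrite !mxE; have [->|kl] := eqVneq k l.
  have lM : (l <= M)%N by rewrite -ltnS.
  have E z : smon b M l z * conjc (smon b M l z) * (1 * v z ^+ M.+2)%:C =
      (normc (smon b M l z) ^+ 2 * v z ^+ M.+2)%:C.
    by rewrite -normc_sqE -rmorphM mul1r.
  under eq_fun do rewrite E.
  rewrite /integralC; apply: complex_ext => /=.
    by rewrite /Rintegral integral_smon.
  by rewrite /Rintegral integral0_eq.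
have a0 (i : 'I_M.+1) : Num.sqrt (M.+1%:R * b * 'C(M, i)%:R * (b * pi) ^+ i) != 0.
  rewrite gt_eqF // sqrtr_gt0 !mulr_gt0 // ?exprn_gt0 ?mulr_gt0 ?pi_gt0 //.
  by rewrite ltr0n bin_gt0 -ltnS.
have := @monomial_orthZ R (fun t => 1 * sphere_base b t ^+ M.+2) _ _ k l _ kl (a0 k) (a0 l).
apply.
  apply: measurable_funM; first exact: measurable_cst.
  exact: measurable_funX (measurable_sphere_base b0).
exact: (@cintegrable_smon R b b0 (fun=> 1) m1 h1 M k l).
Qed.

Variables (Omega : set C) (s : R).
Hypothesis mOmega : lebesgue_measurable Omega.
Hypothesis areaOmega : area Omega = s%:E.

Let chi z : R := \1_Omega z.

Lemma measurable_indic_toC : measurable_fun setT (fun p : Pl => chi (toC p)).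
Proof. exact: measurable_indic (mOmega). Qed.

Lemma indic01 z : 0 <= chi z <= 1.
Proof. by rewrite /chi indicE; case: (_ \in _); rewrite ?lexx ?ler01. Qed.

Lemma integral_indic_toC : (\int[mu2]_p (chi (toC p))%:E = s%:E)%E.
Proof.
rewrite -areaOmega /area -[in RHS](setIT (_ @^-1` _)).
exact: (@integral_indic _ _ _ mu2 setT measurableT (@toC R @^-1` Omega) mOmega).
Qed.

Lemma plane_integrable_indic : plane_integrable (fun p : Pl => chi (toC p)).
Proof.
apply/integrableP; split; first exact/measurable_EFinP/measurable_indic_toC.
rewrite (_ : (\int[mu2]_p _)%E = s%:E) ?ltry // -integral_indic_toC.
by apply: eq_integral => p _; apply: gee0_abs; rewrite lee_fin; case/andP: (indic01 (toC p)).
Qed.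

Lemma area_ge0 : 0 <= s.
Proof. by rewrite -lee_fin -integral_indic_toC; apply: integral_ge0 => p _; rewrite lee_fin; case/andP: (indic01 (toC p)). Qed.

(** The bound [N] comes from [chi <= 1]. The other is the trace bound: by the Bessel inequality the
    density of the family is at most the diagonal kernel of [sum_smon], which is integrated over
    [Omega]. *)
Lemma sphere_op_base M N : kyfan_le (sphere_op b chi M) N (Num.min N%:R (M.+1%:R * (b * s))).
Proof.
move=> p X Xb Xf.
have [i1 ->] := qf_gram (cintegrable_smon b0 measurable_indic_toC indic01 (M := M)) X.
have vM z : 0 <= v z ^+ M.+2 := exprn_ge0 _ (ltW (sphere_base_normc_gt0 b0 z)).
rewrite le_min; apply/andP; split.
  apply: le_trans Xf.
  have m1 : measurable_fun setT (fun p : Pl => (fun=> 1 : R) (toC p)) by exact: measurable_cst.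
  have h1 (z : C) : 0 <= (fun=> 1 : R) z <= 1 by rewrite ler01 lexx.
  have [i2 e2] := qf_gram (cintegrable_smon b0 m1 h1 (M := M)) X.
  have -> : fro X = qf (sphere_op b (fun=> 1) M) X.
    by rewrite sphere_op_full /qf mulmx1 -fro_trE.
  rewrite e2; apply: (le_Rintegral measurableT i1 i2) => x _.
  apply: ler_sum => j _; apply: (ler_wpM2l (sqr_ge0 _)).
  by apply: (ler_wpM2r (vM _)); case/andP: (indic01 (toC x)).
have i2 := plane_integrableZ (M.+1%:R * b) plane_integrable_indic.
have -> : M.+1%:R * (b * s) = \int[mu2]_x (M.+1%:R * b * chi (toC x)).
  by rewrite (RintegralZl _ measurableT plane_integrable_indic) /Rintegral integral_indic_toC /= mulrA.
apply: (le_Rintegral measurableT i1 i2) => x _; set z := toC x.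
have [c0 c1] := andP (indic01 z).
rewrite -mulr_suml mulrCA [leRHS]mulrC; apply: (ler_wpM2l c0).
(* Since [v <= 1], the spherical area of [Omega] is at most its planar area. *)
apply: (@le_trans _ _ (M.+1%:R * b * v z ^+ 2)); last first.
  have /andP[w0 w1] : 0 <= v z <= 1.
    rewrite (ltW (sphere_base_normc_gt0 b0 z)) /= invf_le1 ?lerDl ?ltr_pwDl ?mulr_ge0 ?(ltW b0) //.
  by rewrite ler_piMr ?mulr_ge0 ?(ltW b0) // expr_le1.
rewrite -(sum_smon b0) -mulr_suml; apply: (ler_wpM2r (vM z)).
have := Xb (\col_k smon b M k z); rewrite mul1r /fro.
under eq_bigr do rewrite big_ord_recl big_ord0 addr0 mxE.
under [X in _ <= X -> _]eq_bigr do rewrite big_ord_recl big_ord0 addr0 mxE.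
move=> h; apply: le_trans h; rewrite le_eqVlt; apply/orP; left; apply/eqP.
by apply: eq_bigr => j _; congr (normc _ ^+ 2); apply: eq_bigr => k _; rewrite mxE.
Qed.

Lemma sphere_kyfan M N : b * s <= 1 -> (N <= M.+1)%N ->
  kyfan_le (sphere_op b chi M) N (binom_mean M.+1 (b * s) (minr_nat R N)).
Proof.
move=> bs; apply: (@kyfan_descent R (sphere_op b chi) (b * s)).
- by rewrite bs mulr_ge0 ?(ltW b0) ?area_ge0.
- by move=> m; apply: gram_herm; exact: (cintegrable_smon b0 measurable_indic_toC indic01).
- by move=> m x; exact: (sphere_op_psd b0 measurable_indic_toC indic01).
- by move=> m p X; exact: (sphere_op_rec b0 measurable_indic_toC indic01).
- exact: sphere_op_base.
Qed.

End SphereKyFan.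

(** * From the binomial law to the Poisson law *)

Section PoissonLimit.
Variable R : realType.
Implicit Types (p s : R).

Definition binom_pmf n p k : R := 'C(n, k)%:R * p ^+ k * (1 - p) ^+ (n - k).

Lemma binom_mean_eq n p k : binom_mean n p (fun i => (i == k)%:R) = binom_pmf n p k.
Proof.
elim: n k => [|n IH] k.
  by rewrite /binom_pmf /= bin0n sub0n expr0 mulr1 eq_sym; case: k => [|k] /=; rewrite ?mul0r // expr0 mulr1.
rewrite /= IH; case: k => [|k].
  rewrite (@eq_binom_mean R n p _ (fun=> 0)) // binom_mean_cst mulr0 addr0 /binom_pmf !bin0 !expr0 !subn0 exprS; ring.
rewrite (@eq_binom_mean R n p _ (fun i => (i == k)%:R)) // IH /binom_pmf binS natrD subSS.
have [nk|kn] := leqP n k.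
  by rewrite (bin_small (_ : n < k.+1)%N) // exprS; ring.
by rewrite -(subnSK kn) !exprS; ring.
Qed.

(** The layer formula: [min(N, K)] counts the [j < N] with [j < K]. *)
Lemma binom_mean_minr n p N :
  binom_mean n p (minr_nat R N) = \sum_(0 <= j < N) (1 - \sum_(0 <= i < j.+1) binom_pmf n p i).
Proof.
have gt j : binom_mean n p (fun k => (j < k)%N%:R) = 1 - \sum_(0 <= i < j.+1) binom_pmf n p i.
  elim: j => [|j IH].
    rewrite big_nat1 -binom_mean_eq -[X in X - _](binom_mean_cst n p 1).
    rewrite (@eq_binom_mean R n p _ (fun k => 1 * 1 + (-1) * (k == 0%N)%:R)).
      by rewrite binom_mean_lin mul1r mulN1r.
    by case=> [|k] /=; ring.
  rewrite big_nat_recr //= opprD addrA -IH -binom_mean_eq.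
  rewrite (@eq_binom_mean R n p _ (fun k => 1 * (j < k)%N%:R + (-1) * (k == j.+1)%:R)).
    by rewrite binom_mean_lin mul1r mulN1r.
  by move=> k; case: (ltngtP j.+1 k) => /= h; ring.
elim: N => [|N IH].
  by rewrite big_nil -[RHS](binom_mean_cst n p); apply: eq_binom_mean => k; rewrite /minr_nat; apply/min_idPl.
rewrite big_nat_recr //= -gt -IH -[X in X + _]mul1r -[X in _ + X]mul1r -binom_mean_lin.
apply: eq_binom_mean => k; rewrite /minr_nat !mul1r; have [h|h] := ltnP N k.
  by rewrite !min_l ?ler_nat // ?(ltnW h) // natr1.
by rewrite !min_r ?ler_nat // ?addr0 // ltnW.
Qed.

Lemma cvg_bin c k : 'C(M, k)%:R / (M + c.+1)%:R ^+ k @[M --> \oo] --> (k`!%:R^-1 : R).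
Proof.
elim: k => [|k IH].
  have -> : (0`!%:R^-1 : R) = 1 by exact: invr1.
  apply: cvg_near_cst; apply: nearW => M.
  by rewrite bin0 mulr1.
have k0 : k.+1%:R != 0 :> R by rewrite pnatr_eq0.
have V : ((M + c.+1)%:R^-1 : R) @[M --> \oo] --> (0 : R).
  have := @cvg_harmonic R; rewrite -(cvg_shiftn c); apply: cvg_trans.
  by apply: near_eq_cvg; apply: nearW => M /=; rewrite addnS.
have W : 1 - (k + c.+1)%:R * (M + c.+1)%:R^-1 @[M --> \oo] --> (1 : R).
  rewrite -[X in _ --> X]subr0; apply: cvgB; first exact: cvg_cst.
  by rewrite -[X in _ --> X](mulr0 (k + c.+1)%:R); apply: cvgM; [exact: cvg_cst|exact: V].
have -> : (k.+1`!%:R^-1 : R) = k`!%:R^-1 * 1 * k.+1%:R^-1.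
  by rewrite mulr1 factS natrM invfM mulrC.
apply: cvg_trans (cvgM (cvgM IH W) (cvg_cst (k.+1%:R^-1 : R))).
apply: near_eq_cvg; near=> M; cbv beta.
have kM : (k <= M)%N by near: M; exact: nbhs_infty_ge.
have Mc : (M + c.+1)%:R != 0 :> R by rewrite pnatr_eq0 addnS.
have : (k.+1 * 'C(M, k.+1))%N%:R = ((M - k) * 'C(M, k))%N%:R :> R by rewrite mul_bin_left.
rewrite !natrM (natrB _ kM) => E.
have -> : 'C(M, k.+1)%:R = (M%:R - k%:R) * 'C(M, k)%:R / k.+1%:R :> R.
  by rewrite -E mulrAC divff // mul1r.
have M0 : (M + c.+1)%:R ^+ k != 0 :> R by rewrite expf_neq0.
rewrite exprS.
have -> : (k + c.+1)%:R = (M + c.+1)%:R - (M%:R - k%:R) :> R by rewrite !natrD; ring.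
rewrite -[LHS]/('C(M, k)%:R / (M + c.+1)%:R ^+ k *
  (1 - ((M + c.+1)%:R - (M%:R - k%:R)) / (M + c.+1)%:R) * k.+1%:R^-1).
move: ((M + c.+1)%:R ^+ k : R) ((M + c.+1)%:R : R) ('C(M, k)%:R : R) (k.+1%:R : R) Mc M0 k0.
move=> y m x z m0 y0 z0.
by field; rewrite m0 y0 z0.
Unshelve. all: by end_near. Qed.

(** With [p = s/(n+1)], the inequality [1/(1-p) = 1 + p/(1-p) <= exp(p/(1-p))] is raised to the
    power [n+1]. *)
Lemma pow_lower s n i : 0 <= s < n.+1%:R ->
  expR (- (s / (1 - s / n.+1%:R))) <= (1 - s / n.+1%:R) ^+ (n - i).
Proof.
move=> /andP[s0 sn]; set p := s / n.+1%:R.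
have p0 : 0 <= p by rewrite divr_ge0.
have p1 : 0 < 1 - p by rewrite subr_gt0 ltr_pdivrMr ?mul1r.
apply: (@le_trans _ _ ((1 - p) ^+ n.+1)); last first.
  apply: ler_wiXn2l; rewrite ?(ltW p1) ?lerBlDr ?lerDl //.
  by rewrite (leq_trans (leq_subr _ _)).
have -> : s / (1 - p) = n.+1%:R * (p / (1 - p)).
  by rewrite mulrA [n.+1%:R * p]mulrC divfK // pnatr_eq0.
rewrite expRN expRM_natl -exprVn; apply: lerXn2r; rewrite ?nnegrE ?invr_ge0 ?expR_ge0 ?(ltW p1) //.
rewrite -[leRHS]invrK lef_pV2 ?posrE ?expR_gt0 ?invr_gt0 //.
apply: le_trans (expR_ge1Dx _); rewrite le_eqVlt; apply/orP; left; apply/eqP.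
by field; rewrite gt_eqF.
Qed.

Lemma poisson_lower_cvg s i : 'C(M.+1, i)%:R * (s / M.+2%:R) ^+ i *
    expR (- (s / (1 - s / M.+2%:R))) @[M --> \oo] --> s ^+ i / i`!%:R * expR (- s).
Proof.
have V : ((M.+2)%:R^-1 : R) @[M --> \oo] --> (0 : R).
  have := @cvg_harmonic R; rewrite -(cvg_shiftn 1); apply: cvg_trans.
  by apply: near_eq_cvg; apply: nearW => M /=; rewrite addn1.
apply: cvgM.
  have H := @cvg_bin 0 i; rewrite -(cvg_shiftn 1) in H.
  apply: cvg_trans (cvgM (cvg_cst (s ^+ i)) H).
  apply: near_eq_cvg; apply: nearW => M.
  rewrite -[LHS]/(s ^+ i * ('C(M + 1, i)%:R / (M + 1 + 1)%:R ^+ i)).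
  by rewrite !addn1 expr_div_n; ring.
have H : s / (1 - s / M.+2%:R) @[M --> \oo] --> s.
  rewrite -[X in _ --> X]divr1; apply: cvgM; first exact: cvg_cst.
  apply: cvgV; first exact: oner_neq0.
  rewrite -[X in _ --> X]subr0; apply: cvgB; first exact: cvg_cst.
  by rewrite -[X in _ --> X](mulr0 s); apply: cvgM; [exact: cvg_cst|exact: V].
by apply: (cvg_comp _ expR (cvgN H)); exact: continuous_expR.
Qed.

Lemma cvg_bigsum (I : Type) (r : seq I) (u : I -> nat -> R) (l : I -> R) :
  (forall i, u i @ \oo --> l i) ->
  (fun n => \sum_(i <- r) u i n) @ \oo --> \sum_(i <- r) l i.
Proof.
move=> ul; elim: r => [|i r IH].
  rewrite big_nil (_ : (fun n => _) = fun=> 0); first exact: cvg_cst.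
  by apply/funext => n; rewrite big_nil.
rewrite big_cons (_ : (fun n => _) = (fun n => u i n + \sum_(j <- r) u j n)).
  exact: cvgD (ul i) IH.
by apply/funext => n; rewrite big_cons.
Qed.

(** Only an upper bound is needed, so the binomial probabilities, which enter with a minus sign, are
    replaced by the lower bounds of [pow_lower]; these converge to Poisson probabilities. *)
Lemma binom_mean_minr_le s N : 0 <= s -> exists2 beta : nat -> R,
  beta @ \oo --> \sum_(0 <= j < N) poisson_tail j s &
  forall M, s < M.+2%:R -> binom_mean M.+1 (s / M.+2%:R) (minr_nat R N) <= beta M.
Proof.
move=> s0; exists (fun M => \sum_(0 <= j < N) (1 - \sum_(0 <= i < j.+1)
    'C(M.+1, i)%:R * (s / M.+2%:R) ^+ i * expR (- (s / (1 - s / M.+2%:R))))).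
  apply: (cvg_bigsum (u := fun j M => 1 - \sum_(0 <= i < j.+1)
    'C(M.+1, i)%:R * (s / M.+2%:R) ^+ i * expR (- (s / (1 - s / M.+2%:R))))) => j.
  apply: cvgB; first exact: cvg_cst.
  rewrite mulr_sumr; under eq_bigr do rewrite mulrC.
  apply: (cvg_bigsum (u := fun i M => 'C(M.+1, i)%:R * (s / M.+2%:R) ^+ i *
    expR (- (s / (1 - s / M.+2%:R))))) => i; exact: poisson_lower_cvg.
move=> M sM; rewrite binom_mean_minr; apply: ler_sum => j _.
rewrite lerD2l lerN2; apply: ler_sum => i _; apply: ler_wpM2l.
  by rewrite mulr_ge0 // exprn_ge0 // divr_ge0.
by apply: (@pow_lower s M.+1); rewrite s0.
Qed.

End PoissonLimit.

(** * The concentration bound for orthonormal families in the Fock space *)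

Section PlanarInequality.
Variable R : realType.
Local Notation C := R[i].
Local Notation mu2 := (@leb2 R).
Local Notation Pl := (plane R).
Local Notation Re := (@complex.Re R).
Local Notation Im := (@complex.Im R).
Local Notation w := (@gauss_weight R).
Local Notation q z := (pi * normc z ^+ 2).

Lemma fatou_cvg (f : nat -> Pl -> R) (g : Pl -> R) (B : nat -> R) (l : R) :
  (forall n, measurable_fun setT (f n)) -> (forall n p, 0 <= f n p) ->
  (forall p, f n p @[n --> \oo] --> g p) -> B @ \oo --> l ->
  (forall n, (\int[mu2]_p (f n p)%:E <= (B n)%:E)%E) -> (\int[mu2]_p (g p)%:E <= l%:E)%E.
Proof.
move=> mf f0 fg Bl fB; apply/lee_addgt0Pr => e e0.
have /cvgrPdist_le /(_ _ e0) [n0 _ Hn] := Bl.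
apply: (fatou_bound (f := fun n => f (n + n0)%N)) => //.
  by move=> p; have := fg p; rewrite -(cvg_shiftn n0).
move=> n; apply: le_trans (fB _) _; rewrite lee_fin.
by have := Hn (n + n0)%N (leq_addl _ _); rewrite /= ler_norml; lra.
Qed.

Lemma nrm2_fmon_sum n (d : 'I_n -> C) :
  nrm2 (fun z => \sum_k d k * fmon k z) = \sum_k normc (d k) ^+ 2.
Proof.
have le (k : 'I_n) : L2 (@fmon R k) by exact: L2_fmon.
have lS := L2_sum (index_enum _) d le.
apply: (@complexI R); rewrite -(inner_sqnorm lS) (inner_suml _ _ le lS) rmorph_sum.
apply: eq_bigr => k _; rewrite [RHS]normc_sqE; congr (_ * _).
rewrite (inner_sumr _ _ le (le k)) (bigD1 k) //= inner_fmon eqxx mulr1 big1 ?addr0 //.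
by move=> i ik; rewrite inner_fmon eq_sym (negPf (_ : i != k :> nat)) ?mulr0.
Qed.

Variables (p : nat) (f : 'I_p -> C -> C).
Hypothesis ff : forall j, fock (f j).
Hypothesis orthf : forall i j, inner (f i) (f j) = (i == j)%:R.

Let lf j : L2 (f j) := fock_L2 (ff j).

(** Taylor coefficients of the family, cut at a degree [n] independent of [M], so that the sums have
    a fixed number of terms when [M] tends to infinity. *)
Definition coef_mx n M : 'M[C]_(p, M.+1) :=
  \matrix_(j, k) (if (k < n)%N then inner (f j) (fmon k) else 0).

(** Applied to [x], the matrix gives the inner products of the [f j] with the polynomial whose
    coefficients are the conjugates of the [x k], cut at [n]; the claim is Bessel's inequality for
    the orthonormal family [f]. *)
Lemma bessel_coef n M : bessel (coef_mx n M) 1.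
Proof.
move=> x; rewrite mul1r.
pose d (k : 'I_M.+1) : C := if (k < n)%N then conjc (x k ord0) else 0.
have le (k : 'I_M.+1) : L2 (@fmon R k) by exact: L2_fmon.
have lg := L2_sum (index_enum _) d le.
have := bessel_ineq lf orthf lg; rewrite nrm2_fmon_sum => h.
rewrite /fro; under eq_bigr do rewrite big_ord_recl big_ord0 addr0 mxE.
under [leRHS]eq_bigr do rewrite big_ord_recl big_ord0 addr0.
apply: (@le_trans _ _ (\sum_k normc (d k) ^+ 2)); last first.
  apply: ler_sum => k _; rewrite /d; case: ifP => _; first by rewrite normc_conj.
  by rewrite normc0 expr0n sqr_ge0.
apply: le_trans h; rewrite le_eqVlt; apply/orP; left; apply/eqP; apply: eq_bigr => j _.
rewrite (innerJ (lf j) lg) normc_conj (inner_sumr _ _ le (lf j)).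
congr (normc _ ^+ 2); apply: eq_bigr => k _; rewrite mxE /d.
by case: ifP => _; rewrite ?conjcK ?conjc0 ?mul0r // mulrC.
Qed.

Lemma fro_coef n M : fro (coef_mx n M) <= p%:R.
Proof.
have -> : p%:R = \sum_(j < p) (1 : R) by rewrite sumr_const card_ord.
apply: ler_sum => j _.
have le (k : 'I_M.+1) : L2 (@fmon R k) by exact: L2_fmon.
have orth (i k : 'I_M.+1) : inner (@fmon R i) (fmon k) = (i == k)%:R by rewrite inner_fmon.
have := bessel_ineq le orth (lf j).
have -> : nrm2 (f j) = 1.
  by apply: (@complexI R); rewrite -(inner_sqnorm (lf j)) orthf eqxx.
apply: le_trans; apply: ler_sum => k _; rewrite mxE.
by case: ifP => _ //; rewrite normc0 expr0n sqr_ge0.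
Qed.

(** This is [1 + x <= exp x] at [x = pi |z|^2 / (m+1)], raised to the power [m+1]. It lets the
    spherical bound control the Gaussian integral before the limit is taken. *)
Lemma gauss_le_sphere m z : w z <= sphere_base m.+1%:R^-1 (q z) ^+ m.+1.
Proof.
rewrite /gauss_weight /sphere_base ger0_norm ?pi_normc_sq_ge0 // expRN exprVn.
have m0 : 0 < m.+1%:R^-1 :> R by rewrite invr_gt0.
have q1 : 0 < 1 + m.+1%:R^-1 * q z by rewrite ltr_pwDl // mulr_ge0 ?pi_normc_sq_ge0 // ltW.
rewrite lef_pV2 ?posrE ?expR_gt0 ?exprn_gt0 //.
have -> : expR (q z) = expR (m.+1%:R^-1 * q z) ^+ m.+1.
  by rewrite -expRM_natl (mulrA m.+1%:R) divff ?mul1r // pnatr_eq0.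
apply: lerXn2r; rewrite ?nnegrE ?expR_ge0 ?(ltW q1) //.
exact: expR_ge1Dx.
Qed.

Lemma smon_coef_cvg k : Num.sqrt (M.+1%:R * M.+2%:R^-1 * 'C(M, k)%:R * (M.+2%:R^-1 * pi) ^+ k)
   @[M --> \oo] --> (Num.sqrt (pi ^+ k / k`!%:R) : R).
Proof.
apply: (cvg_comp _ Num.sqrt); last exact: sqrt_continuous.
have V : ((M.+2)%:R^-1 : R) @[M --> \oo] --> (0 : R).
  have := @cvg_harmonic R; rewrite -(cvg_shiftn 1); apply: cvg_trans.
  by apply: near_eq_cvg; apply: nearW => M /=; rewrite addn1.
have W : 1 - M.+2%:R^-1 @[M --> \oo] --> (1 : R).
  by rewrite -[X in _ --> X]subr0; apply: cvgB; [exact: cvg_cst|exact: V].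
have -> : (pi ^+ k / k`!%:R : R) = 1 * (k`!%:R^-1) * pi ^+ k by rewrite mul1r mulrC.
apply: cvg_trans (cvgM (cvgM W (@cvg_bin R 1 k)) (cvg_cst (pi ^+ k))).
apply: near_eq_cvg; apply: nearW => M.
rewrite -[LHS]/((1 - M.+2%:R^-1) * ('C(M, k)%:R / (M + 2)%:R ^+ k) * pi ^+ k).
rewrite addn2 exprMn exprVn -(natr1 M.+1).
have M0 : M.+1%:R + 1 != 0 :> R by rewrite natr1 pnatr_eq0.
by move: (_ ^- k) (pi ^+ k) => y x; field.
Qed.

Variables (Omega : set C) (s : R).
Hypothesis mOmega : lebesgue_measurable Omega.
Hypothesis areaOmega : area Omega = s%:E.
Let chi z : R := \1_Omega z.
Let indic01 z : 0 <= chi z <= 1 := indic01 Omega z.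
Let mchi : measurable_fun setT (fun p : Pl => chi (toC p)) := measurable_indic_toC mOmega.

(** The coefficients of the truncated family are transplanted to the sphere with [b = 1/(M+2)],
    where [sphere_kyfan] applies. As [M] grows the transplants converge pointwise to the Taylor sums
    and the bounds to the Poisson expectation, so Fatou concludes. *)
Lemma trunc_conc n N : (p <= N)%N ->
  (\int[mu2]_x (\sum_j normc (partial_sum (f j) n (toC x)) ^+ 2 * (chi (toC x) * w (toC x)))%:E
   <= (\sum_(0 <= j < N) poisson_tail j s)%:E)%E.
Proof.
move=> pN; have s0 := area_ge0 mOmega areaOmega.
have [beta bl bM] := @binom_mean_minr_le R s N s0.
(* Starting the sequence at [K] ensures [n <= M+1], [N <= M+1] and [s < M+2] throughout. *)
pose K := (n + N + (Num.truncn s).+1)%N.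
pose bb M : R := M.+2%:R^-1.
pose P M j z := \sum_(0 <= k < n) inner (f j) (fmon k) * smon (bb M) M k z.
have bb0 M : 0 < bb M by rewrite invr_gt0.
have PE M j z : (n <= M.+1)%N -> \sum_k coef_mx n M j k * smon (bb M) M k z = P M j z.
  move=> nM; rewrite /P (big_nat_widen _ _ _ _ _ nM) big_mkord [RHS]big_mkcond /=.
  by apply: eq_bigr => k _; rewrite mxE; case: ifP => _; rewrite ?mul0r.
have mP M j : plane_cmeas (P M j).
  apply: cmeas_borel; apply: cmeas_entire; apply: entire_sum => k.
  by apply: entireZ; apply: entireZ; exact: entire_exp.
have mw : measurable_fun setT (fun x : Pl => chi (toC x) * w (toC x)).
  exact: (measurable_funM mchi (@measurable_gauss R)).
have w0 z : 0 <= w z := ltW (gauss_weight_gt0 z).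
have cw0 z : 0 <= chi z * w z by have /andP[c0 _] := indic01 z; exact: mulr_ge0.
have mF M : measurable_fun setT (fun x : Pl => \sum_j normc (P M j (toC x)) ^+ 2 * (chi (toC x) * w (toC x))).
  by apply: measurable_sum => j; exact: (measurable_funM (cmeas_normc2 (mP M j)) mw).
have F0 M x : 0 <= \sum_j normc (P M j (toC x)) ^+ 2 * (chi (toC x) * w (toC x)).
  by apply: sumr_ge0 => j _; exact: (mulr_ge0 (sqr_ge0 _) (cw0 _)).
apply: (fatou_cvg (f := fun i x => \sum_j normc (P (i + K)%N j (toC x)) ^+ 2 * (chi (toC x) * w (toC x)))
  (B := fun i => beta (i + K)%N)).
- by move=> i; exact: mF.
- by move=> i x; exact: F0.
- move=> x; apply: cvg_bigsum => j; apply: cvgM; last exact: cvg_cst.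
  set z := toC x.
  (* [L] stands for the real or the imaginary part; by real linearity, convergence reduces to that
     of the real coefficients in [smon_coef_cvg]. *)
  have key (L : C -> R) : (forall a c, L (a%:C * c) = a * L c) ->
      (forall a c, L (a + c) = L a + L c) -> L 0 = 0 ->
      L (P (i + K)%N j z) @[i --> \oo] --> L (partial_sum (f j) n z).
    move=> LZ LD L0.
    have Lsum (F : nat -> C) : L (\sum_(0 <= k < n) F k) = \sum_(0 <= k < n) L (F k).
      by elim/big_ind2: _ => // a1 a2 b1 b2; rewrite LD => -> ->.
    rewrite (cvg_shiftn K (fun M => L (P M j z))) /partial_sum Lsum.
    rewrite (_ : (fun M => _) = (fun M => \sum_(0 <= k < n) L (inner (f j) (fmon k) * smon (bb M) M k z))); last first.
      by apply/funext => M; rewrite Lsum.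
    apply: (cvg_bigsum (u := fun k M => L (inner (f j) (fmon k) * smon (bb M) M k z))) => k.
    rewrite /fmon /smon mulrCA LZ.
    rewrite (_ : (fun M => _) = (fun M => Num.sqrt (M.+1%:R * M.+2%:R^-1 * 'C(M, k)%:R * (M.+2%:R^-1 * pi) ^+ k) *
      L (inner (f j) (fmon k) * z ^+ k))); last first.
      by apply/funext => M; rewrite mulrCA LZ.
    by apply: cvgM; [exact: smon_coef_cvg|exact: cvg_cst].
  have k1 := key Re _ (@ReD R) erefl; have k2 := key Im _ (@ImD R) erefl.
  rewrite normc_sq (_ : (fun i => _) = (fun i => Re (P (i + K)%N j z) ^+ 2 + Im (P (i + K)%N j z) ^+ 2)); last first.
    by apply/funext => i; rewrite normc_sq.
  rewrite !expr2; apply: cvgD.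
    by apply: cvgM; apply: k1 => a c; rewrite ReM /= mul0r subr0.
  by apply: cvgM; apply: k2 => a c; rewrite ImM /= mul0r addr0.
- by rewrite (cvg_shiftn K beta).
move=> i; set M := (i + K)%N.
have nM : (n <= M.+1)%N by rewrite /M /K; lia.
have NM : (N <= M.+1)%N by rewrite /M /K; lia.
have sM : s < M.+2%:R.
  have := archi_boundP s0; rewrite /Num.bound => h.
  apply: (@lt_le_trans _ _ (Num.truncn s).+1%:R); first by rewrite truncnS_gt.
  by rewrite ler_nat /M /K; lia.
have bs : bb M * s <= 1 by rewrite mulrC ler_pdivrMr // mul1r ltW.
have [i1 e1] := qf_gram (cintegrable_smon (bb0 M) mchi indic01 (M := M)) (coef_mx n M).
have le1 x : \sum_j normc (P M j (toC x)) ^+ 2 * (chi (toC x) * w (toC x)) <=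
    \sum_j normc (\sum_k coef_mx n M j k * smon (bb M) M k (toC x)) ^+ 2 *
      (chi (toC x) * sphere_base (bb M) (q (toC x)) ^+ M.+2).
  apply: ler_sum => j _; rewrite PE //; apply: (ler_wpM2l (sqr_ge0 _)).
  have /andP[c0 _] := indic01 (toC x); apply: (ler_wpM2l c0).
  exact: gauss_le_sphere.
have i2 : plane_integrable (fun x : Pl => \sum_j normc (P M j (toC x)) ^+ 2 * (chi (toC x) * w (toC x))).
  by apply: (plane_integrable_le (mF M) i1) => x; rewrite ger0_norm.
rewrite -[leLHS]fineK; last exact: (integrable_fin_num measurableT i2).
rewrite lee_fin; apply: le_trans (bM M sM).
have -> : s / M.+2%:R = bb M * s by rewrite mulrC.
have fN : fro (coef_mx n M) <= N%:R by apply: le_trans (fro_coef n M) _; rewrite ler_nat.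
have h := sphere_kyfan (bb0 M) mOmega areaOmega bs NM (@bessel_coef n M) fN.
apply: le_trans h; rewrite [leRHS]e1.
by apply: (le_Rintegral measurableT i2 i1) => x _; exact: le1.
Qed.

(** A second use of Fatou's lemma, now letting the truncation degree tend to infinity. *)
Lemma planar_conc N : (p <= N)%N ->
  (\int[mu2]_x (\sum_j normc (f j (toC x)) ^+ 2 * (chi (toC x) * w (toC x)))%:E
   <= (\sum_(0 <= j < N) poisson_tail j s)%:E)%E.
Proof.
move=> pN.
have w0 z : 0 <= w z := ltW (gauss_weight_gt0 z).
have cw0 z : 0 <= chi z * w z by have /andP[c0 _] := indic01 z; exact: mulr_ge0.
apply: (fatou_bound (f := fun n x => \sum_j normc (partial_sum (f j) n (toC x)) ^+ 2 * (chi (toC x) * w (toC x)))).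
- move=> n; apply: measurable_sum => j.
  have mw := measurable_funM mchi (@measurable_gauss R).
  exact: (measurable_funM (cmeas_normc2 (L2_partial_sum (f j) n).1) mw).
- by move=> n x; apply: sumr_ge0 => j _; apply: mulr_ge0 => //; exact: sqr_ge0.
- move=> x; apply: cvg_bigsum => j; apply: cvgM; last exact: cvg_cst.
  by under eq_fun do rewrite expr2; rewrite expr2; apply: cvgM; exact: taylor_cvg.
- by move=> n; exact: trunc_conc.
Qed.

End PlanarInequality.

                                          

(** * From eigenvalue sequences to orthonormal eigenfunctions *)

Section Eigenvalues.
Variable R : realType.
Local Notation C := R[i].
Local Notation mu2 := (@leb2 R).
Local Notation Pl := (plane R).
Local Notation w := (@gauss_weight R).
Implicit Types (F G : C -> C).

Lemma fock_nrm2_eq0 F : fock F -> nrm2 F = 0 -> F = fun=> 0.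
Proof.
move=> fF F0; apply/funext => a; apply: eq0_normc; rewrite -(reproducing a fF).
have := cauchy_schwarz (fock_L2 fF) (L2_kern a); rewrite F0 mul0r => h.
by apply/eqP; rewrite -sqrf_eq0 eq_le h sqr_ge0.
Qed.

Variable (Omega : set C).
Hypothesis mOmega : lebesgue_measurable Omega.
Local Notation V := (fock_eigenspace (toeplitz Omega)).
Local Notation chi := (\1_Omega : C -> R).

Lemma indicC z : (\1_Omega z : C) = (chi z)%:C.
Proof. by rewrite !indicE; case: (_ \in _). Qed.

Lemma eigenspace_proj (mu : R) F : mu != 0 -> V mu F ->
  is_fock_proj (fun z => \1_Omega z * F z) (fun z => mu%:C * F z).
Proof.
move=> mu0 [fF TF]; rewrite -TF /toeplitz /fock_proj.
case: (pselect (exists H, is_fock_proj (fun z => \1_Omega z * F z) H)) => [|none].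
  exact: xgetPex.
(* Were there no projection, [fock_proj] would take its default value [0]; then [mu F = 0], so
   [F = 0], and [0] is a projection after all. *)
have T0 : toeplitz Omega F = fun=> 0.
  by rewrite /toeplitz /fock_proj xgetPN // => H pH; apply: none; exists H.
have F0 z : F z = 0.
  have := congr1 (fun f => f z) TF; rewrite T0 => /esym /eqP.
  rewrite mulf_eq0 => /orP[/eqP|/eqP //].
  by move=> /(congr1 (@complex.Re R)) /= /eqP; rewrite (negPf mu0).
rewrite -/(fock_proj _) -/(toeplitz Omega F) T0; split; first exact: fock0.
move=> G fG; rewrite -[RHS](inner0l (fock_L2 fG)); apply: inner_eql => z.
by rewrite F0 mulr0 subrr.
Qed.

Lemma eigenspace_inner (mu : R) F G : mu != 0 -> V mu F -> fock G ->
  inner (fun z => \1_Omega z * F z) G = mu%:C * inner F G.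
Proof.
move=> mu0 VF fG; have [_ /(_ _ fG)] := eigenspace_proj mu0 VF.
have lF := fock_L2 VF.1; have lG := fock_L2 fG.
rewrite (innerBl (L2_indic mOmega lF) (L2Z _ lF) lG) (innerZl _ lF lG).
by move/eqP; rewrite subr_eq0 => /eqP.
Qed.

Lemma inner_indicC F G : inner (fun z => \1_Omega z * F z) G = inner F (fun z => \1_Omega z * G z).
Proof.
rewrite /inner; apply: congr1; apply/funext => z.
by rewrite conjcM indicC conjc_real; ring.
Qed.

(** Self-adjointness: the indicator can be moved from one factor of the inner product to the
    other. *)
Lemma eigenspace_orth (mu nu : R) F G : mu != 0 -> nu != 0 -> mu != nu ->
  V mu F -> V nu G -> inner F G = 0.
Proof.
move=> mu0 nu0 mn VF VG; have lF := fock_L2 VF.1; have lG := fock_L2 VG.1.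
have := eigenspace_inner mu0 VF VG.1; rewrite inner_indicC.
rewrite (innerJ (L2_indic mOmega lG) lF) (eigenspace_inner nu0 VG VF.1).
rewrite conjcM conjc_real -(innerJ lG lF) => /eqP; rewrite -subr_eq0 -mulrBl mulf_eq0.
case/orP => [|/eqP //]; rewrite -rmorphB => /eqP /(congr1 (@complex.Re R)) /= /eqP.
by rewrite subr_eq0 eq_sym (negPf mn).
Qed.

Lemma inner_indic_self F : L2 F ->
  plane_integrable (fun p : Pl => normc (F (toC p)) ^+ 2 * (chi (toC p) * w (toC p))) /\
  inner (fun z => \1_Omega z * F z) F =
  (\int[mu2]_p (normc (F (toC p)) ^+ 2 * (chi (toC p) * w (toC p))))%:C.
Proof.
move=> lF; have [i1 i2] := inner_cintegrable (L2_indic mOmega lF) lF.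
have E z : \1_Omega z * F z * conjc (F z) * (w z)%:C = (normc (F z) ^+ 2 * (chi z * w z))%:C.
  by rewrite indicC -(mulrA _ (F z)) -normc_sqE -!rmorphM; congr (_%:C); ring.
split; first by apply: plane_integrable_eq i1 => p; rewrite E.
rewrite /inner (_ : (fun z => _) = (fun z => (normc (F z) ^+ 2 * (chi z * w z))%:C)); last exact/funext.
by rewrite /integralC; apply: complex_ext => //=; rewrite /Rintegral integral0_eq.
Qed.

Lemma eigenspace_integral (mu : R) F : mu != 0 -> V mu F -> inner F F = 1 ->
  \int[mu2]_p (normc (F (toC p)) ^+ 2 * (chi (toC p) * w (toC p))) = mu.
Proof.
move=> mu0 VF F1; have [_] := inner_indic_self (fock_L2 VF.1).
by rewrite (eigenspace_inner mu0 VF VF.1) F1 mulr1 => /(@complexI R) <-.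
Qed.

Lemma mem_lin_comb n (b : 'I_n -> C -> C) i : range (lin_comb b) (b i).
Proof.
exists (fun j => (j == i)%:R) => //; apply/funext => z.
rewrite /lin_comb (bigD1 i) //= eqxx mul1r big1 ?addr0 // => j /negPf ->.
by rewrite mul0r.
Qed.

(** Orthogonality to [r < n] functions is [r] linear conditions on [n] coefficients; a nonzero
    solution is normalized, its norm being nonzero because the [b i] are free. *)
Lemma unit_vector_orth n (b : 'I_n -> C -> C) r (F : 'I_r -> C -> C) :
  (forall c, lin_comb b c = (fun=> 0) -> forall i, c i = 0) ->
  (forall i, fock (b i)) -> (forall l, L2 (F l)) -> (r < n)%N ->
  exists G, [/\ range (lin_comb b) G, inner G G = 1 & forall l, inner G (F l) = 0].
Proof.
move=> free fb lF rn.
pose A : 'M[C]_(n, r) := \matrix_(i, l) inner (b i) (F l).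
have lb i := fock_L2 (fb i).
have : kermx A != 0.
  by rewrite -mxrank_eq0 mxrank_ker subn_eq0 -ltnNge (leq_ltn_trans (rank_leq_col A)).
case/rowV0Pn => u /sub_kermxP uA u0.
pose G0 := lin_comb b (fun i => u ord0 i).
have fG0 : fock G0 by exact: (fock_sum (index_enum _) (fun i => u ord0 i) fb).
have n0 : 0 < nrm2 G0.
  rewrite lt_neqAle nrm2_ge0 andbT; apply/eqP => /esym z0.
  move/negP: u0; apply; apply/eqP/rowP => i; rewrite mxE.
  exact: free (fock_nrm2_eq0 fG0 z0) i.
pose a : C := (Num.sqrt (nrm2 G0))^-1%:C.
have lG0 := fock_L2 fG0; have laG := L2Z a lG0.
exists (fun z => a * G0 z); split.
- exists (fun i => a * u ord0 i) => //; apply/funext => z.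
  by rewrite /G0 /lin_comb mulr_sumr; apply: eq_bigr => i _; rewrite mulrA.
- rewrite (innerZl _ lG0 laG) (innerJ laG lG0) (innerZl _ lG0 lG0) (inner_sqnorm lG0).
  rewrite conjcM !conjc_real -!rmorphM mulrA -invfM -expr2 sqr_sqrtr ?(ltW n0) //.
  by rewrite mulVf // gt_eqF.
move=> l; rewrite (innerZl _ lG0 (lF l)) /G0 (inner_suml _ _ lb (lF l)).
have /rowP /(_ l) := uA; rewrite !mxE => h.
by rewrite (_ : \sum_i _ = 0) ?mulr0 // -[RHS]h; apply: eq_bigr => i _; rewrite mxE.
Qed.

Variables (lam : nat -> R).
Hypothesis lamP : eigenvalue_seq (toeplitz Omega) lam.

(** Gram-Schmidt inside each eigenspace: the multiplicity clause of [eigenvalue_seq] leaves room for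
    one more vector at each step, and different eigenspaces are orthogonal. *)
Lemma orthonormal_eigenfunctions k : (forall j, (j < k)%N -> 0 < lam j) ->
  exists F : nat -> C -> C, (forall j, (j < k)%N -> V (lam j) (F j)) /\
   forall i j, (i < k)%N -> (j < k)%N -> inner (F i) (F j) = (i == j)%:R.
Proof.
have [_ _ mult] := lamP.
elim: k => [|k IH] pos; first by exists (fun=> fun=> 0).
have [|F [VF oF]] := IH; first by move=> j jk; apply: pos; exact: ltnW.
have mu0 := pos k (ltnSn k); set mu := lam k in mu0 *.
have [n [[b [free VE]] card]] := mult mu mu0.
pose S : {set 'I_k} := [set i : 'I_k | lam i == mu]%SET.
(* The index [k] itself also has eigenvalue [mu] and lies outside [S], while exactly [n] indices
   have it. *)
have Sn : (#|S| < n)%N.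
  have /card_set_bijP [phi [phiI phi_inj _]] := card.
  pose l := k :: [seq val i | i <- enum S].
  have lmu j : j \in l -> lam j = mu.
    rewrite inE => /orP[/eqP -> //|]; case/seq.mapP => i.
    by rewrite mem_enum inE => /eqP <- ->.
  have ul : uniq l.
    rewrite /= map_inj_uniq ?enum_uniq ?andbT; last exact: val_inj.
    by apply/seq.mapP => -[i _ ik]; have := ltn_ord i; rewrite -ik ltnn.
  have := @uniq_leq_size _ (map phi l) (iota 0 n).
  rewrite map_inj_in_uniq => [/(_ ul)|x y xl yl]; last first.
    by apply: phi_inj; rewrite inE; exact: lmu.
  rewrite /= size_map size_iota size_map -cardE; apply => x.
  have lm j : j \in l -> phi j \in iota 0 n.
    by move=> jl; rewrite mem_iota; exact: (phiI _ (lmu _ jl)).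
  by case/(@seq.mapP _ _ phi l) => j /lm + ->.
have fb i : fock (b i) by have : V mu (b i) by [rewrite VE; exact: mem_lin_comb]; case.
have lF (l : 'I_#|S|) : L2 (F (enum_val l)).
  exact: fock_L2 (VF _ (ltn_ord _)).1.
have [G [Gb G1 GF]] := unit_vector_orth free fb lF Sn.
have VG : V mu G by rewrite VE.
have lG := fock_L2 VG.1.
have GFj j : (j < k)%N -> inner G (F j) = 0.
  move=> jk; have [jm|jm] := eqVneq (lam j) mu.
    have jS : Ordinal jk \in S by rewrite inE /= jm.
    by have := GF (enum_rank_in jS (Ordinal jk)); rewrite enum_rankK_in.
  have j0 : 0 < lam j by apply: pos; exact: ltnW.
  rewrite eq_sym in jm.
  exact: (eigenspace_orth (lt0r_neq0 mu0) (lt0r_neq0 j0) jm VG (VF j jk)).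
exists (fun j => if j == k then G else F j); split.
  move=> j; rewrite ltnS leq_eqVlt; case: eqP => [-> //|_ /= jk]; exact: VF.
have lt x : (x < k.+1)%N -> x != k -> (x < k)%N.
  by move=> xk xk'; rewrite ltn_neqAle xk' -ltnS.
move=> i j ik jk.
have [iE|ik'] := eqVneq i k; have [jE|jk'] := eqVneq j k.
- by rewrite iE jE eqxx G1.
- by rewrite iE (GFj j (lt j jk jk')) eq_sym (negPf jk').
- rewrite jE (innerJ lG (fock_L2 (VF i (lt i ik ik')).1)) (GFj i (lt i ik ik')).
  by rewrite conjc0 (negPf ik').
- exact: (oF i j (lt i ik ik') (lt j jk jk')).
Qed.

(** The positive eigenvalues among the first [N] are the masses in [Omega] of orthonormal
    eigenfunctions, to which [planar_conc] applies. *)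
Lemma eigenvalue_sum_le (s : R) N : area Omega = s%:E ->
  \sum_(0 <= j < N) lam j <= \sum_(0 <= j < N) poisson_tail j s.
Proof.
move=> areaOmega; have [ninc lam0 _] := lamP.
(* From the first nonpositive term on the eigenvalues vanish, and no eigenfunction is attached to
   them. *)
pose p := find (fun j => lam j <= 0) (iota 0 N).
have pN : (p <= N)%N by rewrite -[leqRHS](size_iota 0 N) find_size.
have pos j : (j < p)%N -> 0 < lam j.
  move=> jp; have := before_find 0%N jp; rewrite nth_iota ?(leq_trans jp) // add0n.
  by rewrite leNgt => /negbFE.
have zero j : (p <= j < N)%N -> lam j = 0.
  move=> /andP[pj jN]; apply: le_anti; rewrite lam0 andbT.
  apply: le_trans (ninc _ _ pj) _.
  have hp : has (fun j => lam j <= 0) (iota 0 N) by rewrite has_find size_iota (leq_ltn_trans pj).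
  by have := nth_find 0%N hp; rewrite nth_iota -?/p ?(leq_ltn_trans pj).
have [F [VF oF]] := orthonormal_eigenfunctions pos.
have VFi (i : 'I_p) : V (lam i) (F i) by exact: VF.
have h := planar_conc (f := fun i : 'I_p => F i) (fun i => (VFi i).1)
  (fun i j => oF i j (ltn_ord i) (ltn_ord j)) mOmega areaOmega pN.
have Fint (i : 'I_p) : \int[mu2]_x (normc (F i (toC x)) ^+ 2 * (chi (toC x) * w (toC x))) = lam i.
  apply: eigenspace_integral; [|exact: VFi|by rewrite oF // eqxx].
  by rewrite gt_eqF // pos.
have -> : \sum_(0 <= j < N) lam j = \sum_(i < p) lam i.
  rewrite (big_cat_nat (n := p)) // big_mkord big_nat -[RHS]addr0; congr (_ + _).
  by apply: big1 => j; exact: zero.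
rewrite -lee_fin; apply: le_trans h; rewrite le_eqVlt; apply/orP; left; apply/eqP.
have iF (i : 'I_p) := (inner_indic_self (fock_L2 (VFi i).1)).1.
transitivity (\int[mu2]_x (\sum_(i < p) (normc (F i (toC x)) ^+ 2 * (chi (toC x) * w (toC x)))%:E))%E.
  rewrite (integral_sum measurableT iF) -sumEFin; apply: eq_bigr => i _.
  by rewrite -Fint [LHS]fineK //; exact: (integrable_fin_num measurableT (iF i)).
by apply: eq_integral => x _; rewrite sumEFin.
Qed.

End Eigenvalues.

(** * Uniqueness of the eigenvalue sequence *)

Section EigenvalueUniqueness.
Variable R : realType.
Local Notation C := R[i].
Implicit Types (F G : C -> C).

Lemma has_dim_leq (V : set (C -> C)) n n' : has_dim V n -> has_dim V n' -> (n' <= n)%N.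
Proof.
move=> [b [_ VE]] [b' [free' VE']].
have : forall i, exists c, lin_comb b c = b' i.
  move=> i; have : V (b' i) by rewrite VE'; exact: mem_lin_comb.
  by rewrite VE => -[c _ <-]; exists c.
move=> /choice[c cE]; rewrite leqNgt; apply/negP => nn.
pose A : 'M[C]_(n', n) := \matrix_(i, l) c i l.
have : kermx A != 0.
  by rewrite -mxrank_eq0 mxrank_ker subn_eq0 -ltnNge (leq_ltn_trans (rank_leq_col A)).
case/rowV0Pn => u /sub_kermxP uA /negP; apply; apply/eqP/rowP => i; rewrite mxE.
apply: (free' (fun i => u ord0 i)); apply/funext => z; rewrite /lin_comb.
transitivity (\sum_l (\sum_i u ord0 i * c i l) * b l z).
  under eq_bigr do rewrite -cE /lin_comb mulr_sumr.
  rewrite exchange_big; apply: eq_bigr => l _; rewrite mulr_suml.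
  by apply: eq_bigr => k _; rewrite mulrA.
rewrite big1 // => l _; have /rowP /(_ l) := uA; rewrite !mxE => h.
by rewrite (_ : \sum_i _ = 0) ?mul0r // -[RHS]h; apply: eq_bigr => k _; rewrite mxE.
Qed.

(** Equal multiplicities give injections between the level sets of [lam] and [lam']. If
    [lam' j < lam j], the [j+1] indices up to [j] would be injected into those where [lam'] is at
    least [lam j], all smaller than [j]. *)
Lemma eigenvalue_seq_le (T : (C -> C) -> C -> C) (lam lam' : nat -> R) :
  eigenvalue_seq T lam -> eigenvalue_seq T lam' -> forall j, lam j <= lam' j.
Proof.
move=> [d p m] [d' p' m'] j; rewrite leNgt; apply/negP => lt; set c := lam j in lt.
have c0 : 0 < c by apply: le_lt_trans lt; exact: p'.
have : forall mu, exists f : nat -> nat, 0 < mu ->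
    set_fun [set j | lam j = mu] [set j | lam' j = mu] f /\ set_inj [set j | lam j = mu] f.
  move=> mu; case: (ltP 0 mu) => [mu0|_]; last by exists id.
  have [n [h1 h2]] := m mu mu0; have [n' [h1' h2']] := m' mu mu0.
  have nn : n = n' by apply/eqP; rewrite eqn_leq (has_dim_leq h1' h1) (has_dim_leq h1 h1').
  rewrite -nn in h2'; have := card_eq_trans h2 (card_esym h2').
  by move=> /card_set_bijP[f [f1 f2 _]]; exists f.
move=> /choice[phi phiP].
pose g i := phi (lam i) i.
have ge i : (i <= j)%N -> c <= lam i by exact: d.
have pos i : (i <= j)%N -> 0 < lam i by move=> /ge; exact: lt_le_trans.
have gl i : (i <= j)%N -> lam' (g i) = lam i.
  by move=> ij; have [f1 _] := phiP _ (pos i ij); exact: (f1 i erefl).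
have ginj : {in iota 0 j.+1 &, injective g}.
  move=> x y; rewrite !mem_iota !add0n /= !ltnS => xj yj E.
  have lE : lam x = lam y by rewrite -(gl x xj) E gl.
  have [_ f2] := phiP _ (pos x xj).
  apply: f2; rewrite ?inE //.
  by move: E; rewrite /g lE.
have := @uniq_leq_size _ (map g (iota 0 j.+1)) (iota 0 j).
rewrite (map_inj_in_uniq ginj) iota_uniq size_map !size_iota ltnn.
move=> /(_ isT) h; suff : false by []; apply: h => x; case/seq.mapP => i.
rewrite !mem_iota !add0n /= ltnS => ij ->.
rewrite ltnNge; apply/negP => jg.
by have := d' _ _ jg; rewrite gl // leNgt (lt_le_trans lt) // ge.
Qed.

Lemma eigval_unique (Omega : set C) (lam : nat -> R) :
  eigenvalue_seq (toeplitz Omega) lam -> eigval Omega = lam.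
Proof.
move=> h; apply: xget_unique => // lam' h'; apply/funext => j.
by apply: le_anti; rewrite !(@eigenvalue_seq_le (toeplitz Omega)).
Qed.

End EigenvalueUniqueness.

(** * The spectrum of the centered disc *)

Section CenteredDisc.
Variable R : realType.
Local Notation C := R[i].
Local Notation mu2 := (@leb2 R).
Local Notation w := (@gauss_weight R).
Local Notation q z := (pi * normc z ^+ 2).
Implicit Types (F G : C -> C).

(** The difference of two projections lies in the Fock space and is orthogonal to every monomial,
    hence vanishes. *)
Lemma fock_proj_eq (f H : C -> C) : L2 f -> is_fock_proj f H -> fock_proj f = H.
Proof.
move=> lf pH; apply: xget_unique => // H' [fH' oH']; have [fH oH] := pH.
have lH := fock_L2 fH; have lH' := fock_L2 fH'.
have fD := fockB fH' fH.
suff : (fun z => H' z - H z) = fun=> 0.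
  move=> E; apply/funext => z; apply/eqP; rewrite -subr_eq0.
  by have := congr1 (fun f => f z) E => /= ->.
apply: fock_coef0 => // k; have fk := @fock_fmon R k; have lk := fock_L2 fk.
have h1 := oH _ fk; rewrite (innerBl lf lH lk) in h1.
have h2 := oH' _ fk; rewrite (innerBl lf lH' lk) in h2.
rewrite (innerBl lH' lH lk); apply/eqP; rewrite subr_eq0; move: h1 h2 => /eqP.
by rewrite subr_eq0 => /eqP <- /eqP; rewrite subr_eq0 eq_sym.
Qed.

Lemma centered_discE (s : R) (z : C) : (\1_(centered_disc s) z : C) = ((q z < s)%R%:R : R)%:C.
Proof.
rewrite indicE rmorph_nat; congr (nat_of_bool _)%:R.
by apply/idP/idP; rewrite inE.
Qed.

Lemma preimage_centered_disc (s : R) :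
  @toC R @^-1` centered_disc s = [set p : R * R | pisq p < s].
Proof.
apply/seteqP; split => p h.
  by have : q (toC p) < s := h; rewrite pisq_toC.
have : pisq p < s := h; rewrite -pisq_toC; exact.
Qed.

Lemma measurable_centered_disc (s : R) : measurable (@toC R @^-1` centered_disc s : set (R * R)).
Proof.
by rewrite preimage_centered_disc; exact: measurable_pisq_lt.
Qed.

Lemma lebesgue_centered_disc (s : R) : lebesgue_measurable (@centered_disc R s).
Proof. exact: borel_leb_measurable (measurable_centered_disc s). Qed.

Lemma area_centered_disc (s : R) : 0 <= s -> area (@centered_disc R s) = s%:E.
Proof.
move=> s0; rewrite /area leb2E; last exact: measurable_centered_disc.
by rewrite preimage_centered_disc area_pisq_lt.
Qed.

Variable s : R.
Hypothesis s0 : 0 <= s.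
Local Notation D := (@centered_disc R s).
Local Notation g k := (poisson_tail k s).

(** The disc is rotation invariant, so distinct monomials stay orthogonal on it; the diagonal
    entries are those of [integral_fmon_disc]. *)
Lemma inner_disc_fmon i j :
  inner (fun z => \1_D z * fmon i z) (fmon j) = (g i)%:C * (i == j)%:R.
Proof.
have lD := L2_indic (lebesgue_centered_disc s) (@L2_fmon R i).
have [ij|ij] := eqVneq i j.
  rewrite -{}ij mulr1.
  have E z : \1_D z * fmon i z * conjc (fmon i z) * (w z)%:C =
      ((q z < s)%R%:R * (normc (fmon i z) ^+ 2 * w z))%:C.
    by rewrite centered_discE -(mulrA _ (fmon i z)) -normc_sqE -!rmorphM mulrA.
  rewrite /inner (_ : (fun z => _) = (fun z => ((q z < s)%R%:R * (normc (fmon i z) ^+ 2 * w z))%:C)); last exact/funext.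
  rewrite /integralC; apply: complex_ext; last by rewrite /= /Rintegral integral0_eq.
  transitivity (\int[mu2]_p ((q (toC p) < s)%R%:R * (normc (fmon i (toC p)) ^+ 2 * w (toC p)))).
    by [].
  rewrite /Rintegral -[RHS]/(fine (g i)%:E) -(integral_fmon_disc i s0); congr fine.
  by apply: eq_integral => p _; rewrite pisq_toC.
rewrite mulr0.
pose chi (t : R) := (t < s)%R%:R * expR (- t).
have E z : \1_D z * fmon i z * conjc (fmon j z) * (w z)%:C =
    fmon i z * conjc (fmon j z) * (chi (q z))%:C.
  by rewrite centered_discE /chi rmorphM /=; ring.
have iD := inner_cintegrable lD (@L2_fmon R j).
rewrite /inner (_ : (fun z => _) = (fun z => fmon i z * conjc (fmon j z) * (chi (q z))%:C)); last exact/funext.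
apply: fmon_orth_chi => //; last by move/funext : E => <-.
apply: measurable_funM; last first.
  apply: continuous_measurable_fun => t.
  by apply: continuous_comp; [exact: opp_continuous|exact: continuous_expR].
rewrite (_ : (fun t => _) = \1_(`]-oo, s[%classic : set R)).
  by apply: measurable_indic; exact: measurable_itv.
by apply/funext => t; rewrite indicE; congr (nat_of_bool _)%:R; apply/idP/idP;
   rewrite inE /= in_itv.
Qed.

Local Notation V := (fock_eigenspace (toeplitz D)).

Lemma disc_proj_fmon k :
  is_fock_proj (fun z => \1_D z * fmon k z) (fun z => (g k)%:C * fmon k z).
Proof.
have lD := L2_indic (lebesgue_centered_disc s) (@L2_fmon R k).
have lk := @L2_fmon R k; have lZ := L2Z (g k)%:C lk.
split; first exact: fockZ (@fock_fmon R k).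
move=> G fG; apply: (fock_dense (L2B lD lZ) fG) => j.
rewrite (innerBl lD lZ (@L2_fmon R j)) (innerZl _ lk (@L2_fmon R j)).
by rewrite inner_disc_fmon inner_fmon subrr.
Qed.

Lemma eigenspace_coef (mu : R) F k : mu != 0 -> V mu F -> mu != g k -> inner F (fmon k) = 0.
Proof.
move=> mu0 VF mk; have mD := lebesgue_centered_disc s.
have lF := fock_L2 VF.1; have lk := @L2_fmon R k.
have := eigenspace_inner mD mu0 VF (@fock_fmon R k); rewrite inner_indicC.
rewrite (innerJ (L2_indic mD lk) lF).
have [_ /(_ _ VF.1)] := disc_proj_fmon k.
rewrite (innerBl (L2_indic mD lk) (L2Z _ lk) lF) (innerZl _ lk lF) => /eqP.
rewrite subr_eq0 => /eqP ->.
rewrite conjcM conjc_real -(innerJ lk lF) => /eqP; rewrite -subr_eq0 -mulrBl mulf_eq0.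
case/orP => [|/eqP //]; rewrite -rmorphB => /eqP /(congr1 (@complex.Re R)) /= /eqP.
by rewrite subr_eq0 eq_sym (negPf mk).
Qed.

Lemma poisson_tail_ge0 k : 0 <= g k.
Proof.
rewrite -lee_fin -integral_poisson_pmf //; apply: integral_ge0 => t; rewrite /= in_itv /= andbT => t0.
by rewrite lee_fin mulr_ge0 // poisson_pmf_ge0.
Qed.

Lemma poisson_tail_nonincreasing : nonincreasing_seq (fun k => g k).
Proof.
by apply/nonincreasing_seqP => k; rewrite poisson_tailS gerBl poisson_pmf_ge0.
Qed.

(** Positivity forces [s > 0], and then the tails decrease strictly: the positive eigenvalues of a
    disc are simple. For [s = 0] all tails vanish. *)
Lemma poisson_tail_inj i j : 0 < g i -> g i = g j -> i = j.
Proof.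
move=> gi E.
have sp : 0 < s.
  by rewrite lt_neqAle s0 andbT; apply/eqP => s00; move: gi; rewrite -s00 poisson_tail0 ltxx.
have lt k : g k.+1 < g k.
  by rewrite poisson_tailS gtrBl mulr_gt0 ?expR_gt0 // divr_gt0 ?exprn_gt0 // ltr0n fact_gt0.
have lt2 x y : (x < y)%N -> g y < g x.
  by move=> xy; apply: le_lt_trans (lt x); exact: poisson_tail_nonincreasing.
by case: (ltngtP i j) => // /lt2; rewrite E ltxx.
Qed.

Lemma fmon_neq0 k : fmon k <> (fun=> 0 : C).
Proof.
move=> E; have := @inner_fmon R k k; rewrite eqxx.
rewrite {1}E (inner0l (@L2_fmon R k)) => /eqP; by rewrite eq_sym oner_eq0.
Qed.

(** An eigenfunction for [mu] has nonzero coefficients only at indices [k] with [g k = mu]; by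
    completeness its eigenspace is the line of [fmon k], or zero if there is no such [k]. *)
Lemma disc_eigenvalue_seq : eigenvalue_seq (toeplitz D) (fun k => g k).
Proof.
have mD := lebesgue_centered_disc s.
split; [exact: poisson_tail_nonincreasing|exact: poisson_tail_ge0|move=> mu mu0].
have mu1 := lt0r_neq0 mu0.
case: (pselect (exists k, g k = mu)) => [[k gk]|none]; last first.
  exists 0%N; split.
    exists (fun=> fun=> 0); split; first by move=> c _ [].
    have V0 F : V mu F -> F = fun=> 0.
      move=> VF; apply: (fock_coef0 VF.1) => k; apply: (eigenspace_coef mu1 VF).
      by apply/eqP => E; apply: none; exists k.
    apply/seteqP; split => F.
      move=> /V0 ->; exists (fun=> 0) => //; apply/funext => z.
      by rewrite /lin_comb big_ord0.
    move=> [c _ <-]; have -> : lin_comb (fun=> fun=> 0) c = fun=> 0 :> C.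
      by apply/funext => z; rewrite /lin_comb big_ord0.
    split; first exact: fock0.
    have l0 := L2_indic mD (@L2_0 R).
    apply: fock_proj_eq => //; split; first by apply: fockZ; exact: fock0.
    move=> G fG; rewrite -[RHS](inner0l (fock_L2 fG)); apply: inner_eql => z.
    by rewrite !mulr0 subrr.
  rewrite (_ : [set j | _] = set0) ?II0 //.
  by apply/seteqP; split => // j /= gj; apply: none; exists j.
exists 1%N; split; last first.
  rewrite (_ : [set j | _] = [set k]).
    exact: card_set1.
  apply/seteqP; split => j /=; last by move=> ->.
  by move=> gj; apply: poisson_tail_inj; rewrite gj ?gk.
exists (fun=> fmon k); split.
  move=> c E i; have E' z : c i * fmon k z = 0.
    by have := congr1 (fun f => f z) E; rewrite /lin_comb big_ord1 (ord1 i).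
  apply/eqP/negPn/negP => ci; apply: (@fmon_neq0 k); apply/funext => z.
  by have /eqP := E' z; rewrite mulf_eq0 (negPf ci) => /eqP.
apply/seteqP; split => F.
  move=> VF; exists (fun=> inner F (fmon k)) => //.
  rewrite [RHS](@fock_single R F k VF.1) => [|i ik].
    by apply/funext => z; rewrite /lin_comb big_ord1.
  apply: (eigenspace_coef mu1 VF); rewrite -gk; apply/eqP => E.
  by move/eqP : ik; apply; apply/esym/poisson_tail_inj => //; rewrite gk.
move=> [c _ <-]; have -> : lin_comb (fun=> fmon k) c = fun z => c ord0 * fmon k z.
  by apply/funext => z; rewrite /lin_comb big_ord1.
have fk := @fock_fmon R k; have lk := @L2_fmon R k.
split; first exact: fockZ.
apply: fock_proj_eq; first exact: L2_indic mD (L2Z _ lk).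
split; first by apply: fockZ; exact: fockZ.
move=> G fG; have [_ /(_ _ fG) h] := disc_proj_fmon k.
have lB := L2B (L2_indic mD lk) (L2Z (g k)%:C lk).
transitivity (inner (fun z => c ord0 * (\1_D z * fmon k z - (g k)%:C * fmon k z)) G).
  by apply: inner_eql => z; rewrite gk; ring.
by rewrite (innerZl _ lB (fock_L2 fG)) h mulr0.
Qed.

End CenteredDisc.

(** * Weyl translations and discs with arbitrary center *)

Section Weyl.
Variable R : realType.
Local Notation C := R[i].
Local Notation w := (@gauss_weight R).
Local Notation borel2 := ((@lebesgue_measure R) \x (@lebesgue_measure R))%E.
Implicit Types (F G : C -> C) (c z : C).

Definition weyl_factor c z : C := cexp (pi%:C * conjc c * z - (pi * normc c ^+ 2 / 2)%:C).

(** The Weyl operator: the exponential factor compensates the displacement of the Gaussian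
    ([weyl_weight]), which makes translation by [c] unitary. *)
Definition weyl c F z : C := F (z - c) * weyl_factor c z.

Lemma weyl_factor_inv c z : weyl_factor c (z + c) * weyl_factor (- c) z = 1.
Proof.
rewrite /weyl_factor -cexpD normcN normc_sq -[RHS]cexp0; congr cexp.
by case: c => x y; case: z => u v; apply: complex_ext => /=; field.
Qed.

Lemma weylK c F : weyl (- c) (weyl c F) = F.
Proof.
apply/funext => z; rewrite /weyl opprK addrK -mulrA weyl_factor_inv mulr1 //.
Qed.

Lemma weylVK c F : weyl c (weyl (- c) F) = F.
Proof. by rewrite -{1}(opprK c) weylK. Qed.

Lemma weyl_weight c z : normc (weyl_factor c z) ^+ 2 * w z = w (z - c).
Proof.
rewrite normc_cexp /gauss_weight expr2 -!expRD; congr expR; rewrite !normc_sq.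
by case: z => x y; case: c => u v /=; field.
Qed.

Lemma entire_weyl_factor c : entire (weyl_factor c).
Proof.
have e1 : entire (fun z => pi%:C * conjc c * z + - (pi * normc c ^+ 2 / 2)%:C).
  apply: entireD; last exact: (@entire_cst R (- (pi * normc c ^+ 2 / 2)%:C)).
  exact: (entireZ (a := pi%:C * conjc c) (@entire_id R)).
exact: (entire_comp (@entire_cexp R) e1).
Qed.

Lemma weylZ c (a : C) F : weyl c (fun z => a * F z) = fun z => a * weyl c F z.
Proof. by apply/funext => z; rewrite /weyl mulrA. Qed.

Lemma weyl_integrand c F G z : weyl c F z * conjc (weyl c G z) * (w z)%:C =
  (fun z => F z * conjc (G z) * (w z)%:C) (z + (- c)).
Proof.
have E : (w (z + - c))%:C = weyl_factor c z * conjc (weyl_factor c z) * (w z)%:C.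
  by rewrite -weyl_weight -normc_sqE; exact: rmorphM.
by rewrite [RHS]/= E /weyl conjcM; ring.
Qed.

(** Borel measurability rather than measurability for the completed measure, because the translation
    invariance of integrals is established for Borel functions. *)
Definition borelC F := cmeas (fun p : R * R => F (toC p)).

Lemma borelC_entire F : entire F -> borelC F. Proof. exact: cmeas_entire. Qed.

Lemma inner_weyl c F G : borelC F -> borelC G -> inner (weyl c F) (weyl c G) = inner F G.
Proof.
move=> mF mG; rewrite /inner.
rewrite -[RHS](integralC_trans (F := fun z => F z * conjc (G z) * (w z)%:C) (- c)).
  by apply: congr1; apply/funext => z; exact: weyl_integrand.
exact: (cmeasM (cmeasM mF (cmeasJ mG)) (cmeas_real (@borel_gauss R))).
Qed.

Lemma fock_weyl c F : fock F -> fock (weyl c F).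
Proof.
move=> fF; have lF := fock_L2 fF; have mF := cmeas_entire fF.1.
have eW : entire (weyl c F).
  have e1 : entire (fun z => F (z - c)) by exact: (@entire_shift R F (- c) fF.1).
  exact: (@entireM R (fun z => F (z - c)) (weyl_factor c) e1 (@entire_weyl_factor c)).
split => //; suff /L2P : L2 (weyl c F) by case/L2P.
apply/L2P; split; first exact: cmeas_borel (cmeas_entire eW).
have := (L2P F).1 lF => -[_ iF].
have mf : measurable_fun setT (fun p : R * R => normc (F (toC p)) ^+ 2 * w (toC p)).
  exact: measurable_funM (cmeas_normc2 mF) (@borel_gauss R).
have := plane_integrable_tau (measurable_trans (- c)) (@trans_inv R (- c)) mf iF.
apply: plane_integrable_eq => p; by rewrite toC_trans -weyl_weight /weyl (normcM (F _)) exprMn mulrA.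
Qed.

Lemma weyl_proj c f H : borelC f -> is_fock_proj f H -> is_fock_proj (weyl c f) (weyl c H).
Proof.
move=> mf [fH oH]; split; first exact: fock_weyl.
move=> G fG; have fG' := fock_weyl (- c) fG.
rewrite -(oH _ fG') -(inner_weyl c _ (borelC_entire fG'.1)).
  rewrite weylVK; apply: inner_eql => z; rewrite /weyl; ring.
have mH : borelC (fun z => -1 * H z) by apply: cmeasM (cmeas_cst _ (-1)) (borelC_entire fH.1).
have := cmeasD mf mH.
by rewrite /borelC; under eq_fun do rewrite mulN1r.
Qed.

(** The Weyl operator preserves the Fock space and inner products, hence commutes with projection,
    and it carries the indicator of [Omega] to that of the translate. *)
Lemma eigenspace_weyl (Omega : set C) c (mu : R) F : mu != 0 ->
  measurable (@toC R @^-1` Omega : set (R * R)) ->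
  measurable (@toC R @^-1` [set z | Omega (z - c)] : set (R * R)) ->
  fock_eigenspace (toeplitz Omega) mu F ->
  fock_eigenspace (toeplitz [set z | Omega (z - c)]) mu (weyl c F).
Proof.
move=> mu0 mO mO' VF; have fW := fock_weyl c VF.1; split => //.
have mI : borelC (fun z => \1_Omega z : C).
  have : measurable_fun setT (\1_(@toC R @^-1` Omega) : R * R -> R) by exact: measurable_indic.
  move=> /(@cmeas_real R); rewrite /borelC; congr cmeas; apply/funext => p.
  by rewrite !indicE rmorph_nat; congr (nat_of_bool _)%:R; apply/idP/idP; rewrite !inE.
have mf : borelC (fun z => \1_Omega z * F z) by exact: cmeasM mI (borelC_entire VF.1.1).
have := weyl_proj c mf (eigenspace_proj mu0 VF).
have -> : weyl c (fun z => \1_Omega z * F z) =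
    fun z => \1_[set z | Omega (z - c)] z * weyl c F z.
  apply/funext => z; rewrite /weyl [RHS]mulrA.
  have -> // : (\1_[set z | Omega (z - c)] z : C) = \1_Omega (z - c).
  by rewrite !indicE; congr (nat_of_bool _)%:R; apply/idP/idP; rewrite !inE.
rewrite weylZ; apply: fock_proj_eq.
exact: L2_indic (borel_leb_measurable mO') (fock_L2 fW).
Qed.

Lemma has_dim_weyl (V V' : set (C -> C)) c n :
  (forall F, V F -> V' (weyl c F)) -> (forall F, V' F -> V (weyl (- c) F)) ->
  has_dim V n -> has_dim V' n.
Proof.
move=> VV' V'V [b [free VE]].
have wl c' b1 (a : 'I_n -> C) : weyl c' (lin_comb b1 a) = lin_comb (fun i => weyl c' (b1 i)) a.
  apply/funext => z; rewrite /weyl /lin_comb mulr_suml.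
  by apply: eq_bigr => i _; rewrite mulrA.
exists (fun i => weyl c (b i)); split.
  move=> a; rewrite -wl => E; apply: free.
  rewrite -[LHS](weylK c) E; apply/funext => z; by rewrite /weyl mul0r.
apply/seteqP; split => F.
  move=> /V'V; rewrite VE => -[a _ E]; exists a => //.
  by rewrite -wl E weylVK.
move=> [a _ <-]; rewrite -wl; apply: VV'; rewrite VE; by exists a.
Qed.

Lemma eigenvalue_seq_weyl (Omega : set C) c lam :
  measurable (@toC R @^-1` Omega : set (R * R)) ->
  measurable (@toC R @^-1` [set z | Omega (z - c)] : set (R * R)) ->
  eigenvalue_seq (toeplitz Omega) lam ->
  eigenvalue_seq (toeplitz [set z | Omega (z - c)]) lam.
Proof.
move=> mO mO' [d p m]; split; [exact: d|exact: p|move=> mu mu0]; have [n [h1 h2]] := m mu mu0.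
have mu1 := lt0r_neq0 mu0.
exists n; split; last exact: h2.
apply: (@has_dim_weyl (fock_eigenspace (toeplitz Omega) mu)
  (fock_eigenspace (toeplitz [set z | Omega (z - c)]) mu) c) h1 => F VF.
  exact: (eigenspace_weyl mu1 mO mO' VF).
have E : [set z | [set z0 | Omega (z0 - c)] (z - (- c))] = Omega.
  by apply/seteqP; split => z; rewrite /= opprK addrK.
by have := @eigenspace_weyl _ (- c) mu F mu1 mO'; rewrite E; exact.
Qed.

Lemma preimage_shift (Omega : set C) c :
  @toC R @^-1` [set z | Omega (z - c)] = trans (- c) @^-1` (@toC R @^-1` Omega).
Proof.
apply/seteqP; split => p h.
  by have : Omega (toC (trans (- c) p)) by rewrite toC_trans.
by have : Omega (toC (trans (- c) p)) := h; rewrite toC_trans.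
Qed.

Lemma measurable_shift (Omega : set C) c :
  measurable (@toC R @^-1` Omega : set (R * R)) ->
  measurable (@toC R @^-1` [set z | Omega (z - c)] : set (R * R)).
Proof.
move=> mO; rewrite preimage_shift -[X in measurable X]setTI.
exact: (measurable_trans (- c) measurableT mO).
Qed.

Lemma area_shift (Omega : set C) c : measurable (@toC R @^-1` Omega : set (R * R)) ->
  area [set z | Omega (z - c)] = area Omega.
Proof.
move=> mO; have mO' := measurable_shift c mO; rewrite /area (leb2E mO) (leb2E mO').
pose f (p : R * R) : \bar R := (\1_(@toC R @^-1` Omega) p)%:E.
have mf : measurable_fun setT f by apply/measurable_EFinP; exact: measurable_indic.
have f0 p : (0 <= f p)%E by rewrite lee_fin.
have I (A : set (R * R)) : measurable A -> (\int[borel2]_p (\1_A p)%:E = borel2 A)%E.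
  by move=> mA; rewrite integral_indic // setIT.
rewrite -(I _ mO) -(I _ mO') -[RHS](@trans_inv R (- c) f mf f0).
by apply: eq_integral => p _; rewrite preimage_shift /f !indicE.
Qed.

(** The term of index [k] occurs in the tails of index [k, ..., N-1], that is [N - k] times. *)
Lemma sum_poisson_tail s N : \sum_(0 <= j < N) poisson_tail j s =
  N%:R - expR (- s) * \sum_(0 <= k < N) (N - k)%:R * (s ^+ k / (k`!)%:R) :> R.
Proof.
elim: N => [|N IH]; first by rewrite !big_nil mulr0 subrr.
rewrite big_nat_recr //= IH /poisson_tail.
have -> : \sum_(0 <= k < N.+1) (N.+1 - k)%:R * (s ^+ k / k`!%:R) =
    \sum_(0 <= k < N) (N - k)%:R * (s ^+ k / k`!%:R) + \sum_(0 <= k < N.+1) s ^+ k / k`!%:R.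
  rewrite big_nat_recr // [in RHS]big_nat_recr //= addrA -big_split /= subSnn mul1r; congr (_ + _).
  rewrite !big_nat; apply: eq_bigr => k /andP[_ kN].
  by rewrite subSn 1?ltnW // -natr1 mulrDl mul1r.
by rewrite mulrDr -natr1; ring.
Qed.

End Weyl.

(** * Eigenvalue sums of general sets and of discs *)

Section Conclusion.
Variable R : realType.
Local Notation C := R[i].

Lemma eigval_centered_disc (s : R) : 0 <= s -> eigval (centered_disc s) = (fun j => poisson_tail j s).
Proof. by move=> s0; apply: eigval_unique; exact: disc_eigenvalue_seq. Qed.

Lemma eigval_sum_le (Omega : set C) (s : R) N : lebesgue_measurable Omega ->
  area Omega = s%:E -> \sum_(0 <= j < N) eigval Omega j <= \sum_(0 <= j < N) poisson_tail j s.
Proof.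
move=> mO aO; have s0 := area_ge0 mO aO.
have [[lam hlam]|none] := pselect (exists lam, eigenvalue_seq (toeplitz Omega) lam).
  by rewrite (eigval_unique hlam); exact: (eigenvalue_sum_le mO hlam).
(* Without an eigenvalue sequence [eigval] is the default zero sequence, and the bound is a sum of
   nonnegative tails. *)
rewrite /eigval xgetPN => [|lam hlam]; last by apply: none; exists lam.
by apply: ler_sum => j _; exact: poisson_tail_ge0.
Qed.

Lemma discE (c : C) (r : R) : 0 < r ->
  disc c r = [set z | centered_disc (pi * r ^+ 2) (z - c)].
Proof.
move=> r0; apply/seteqP; split => z h.
  have nr : normc (z - c) < r := h.
  have : pi * normc (z - c) ^+ 2 < pi * r ^+ 2.
    by rewrite ltr_pM2l ?pi_gt0 // ltr_pXn2r ?nnegrE ?normc_ge0 // ltW.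
  exact.
have : pi * normc (z - c) ^+ 2 < pi * r ^+ 2 := h.
rewrite ltr_pM2l ?pi_gt0 // ltr_pXn2r ?nnegrE ?normc_ge0 ?(ltW r0) //; exact.
Qed.

(** Both sets are empty, which covers the degenerate discs of area [0]. *)
Lemma disc_le0 (c : C) (r : R) : r <= 0 -> disc c r = centered_disc 0.
Proof.
move=> r0; apply/seteqP; split => z h.
  have nr : normc (z - c) < r := h.
  by have := le_lt_trans (normc_ge0 _) (lt_le_trans nr r0); rewrite ltxx.
have : pi * normc z ^+ 2 < 0 := h.
by rewrite ltNge mulr_ge0 ?pi_ge0 // sqr_ge0.
Qed.

(** A disc of positive radius is a translate of the centered disc of area [pi r^2], which the
    hypothesis identifies with [s]; the Weyl operators transport the spectrum. *)
Lemma eigval_disc (c : C) (r s : R) : area (disc c r) = s%:E ->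
  eigval (disc c r) = (fun j => poisson_tail j s).
Proof.
have [r0|r0] := leP r 0.
  by rewrite (disc_le0 c r0) area_centered_disc // => -[<-]; exact: eigval_centered_disc.
have t0 : 0 <= pi * r ^+ 2 by rewrite mulr_ge0 ?pi_ge0 // sqr_ge0.
have mD := @measurable_centered_disc R (pi * r ^+ 2).
rewrite (discE c r0) (area_shift c mD) area_centered_disc // => -[<-].
apply: eigval_unique; apply: (eigenvalue_seq_weyl mD (measurable_shift c mD)).
exact: disc_eigenvalue_seq.
Qed.

End Conclusion.

Theorem theorem1 (R : realType) (Omega : set R[i]) (s : R) (N : nat)
    (mOmega : lebesgue_measurable Omega) (areaOmega : area Omega = s%:E)
    (N_ge1 : (1 <= N)%N) :
  let bound := N%:R - expR (- s) *
                 \sum_(0 <= k < N) (N - k)%:R * (s ^+ k / (k`!)%:R) in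
  [/\ \sum_(0 <= j < N) eigval Omega j
        <= \sum_(0 <= j < N) eigval (centered_disc s) j,
      \sum_(0 <= j < N) eigval (centered_disc s) j = bound,
      lebesgue_measurable (centered_disc s) /\ area (centered_disc s) = s%:E
    & forall (c : R[i]) (r : R), area (disc c r) = s%:E ->
        \sum_(0 <= j < N) eigval (disc c r) j = bound].
Proof.
have s0 := area_ge0 mOmega areaOmega.
move=> bound; have E : \sum_(0 <= j < N) poisson_tail j s = bound := sum_poisson_tail s N.
rewrite (eigval_centered_disc s0); split.
- exact: eigval_sum_le.
- exact: E.
- by split; [exact: lebesgue_centered_disc|exact: area_centered_disc].
- by move=> c r /eigval_disc ->; exact: E.
Qed.
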